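(* Let $\alpha,\gamma\in\mathbb{Z}$ with $\gamma>0$, $\alpha^\gamma\ne1$, and let $p$ be an odd prime dividing $\alpha-1$ (so $h=v_p(\alpha-1)>0$); if $p=3$ assume $\alpha^\gamma\not\equiv7\bmod 9$. Then $m=h+n$ and the following hold. (1) $$N_p=M_n\cap L_{2n}=\langle a^{p^{m+2h}},a^{p^{m+h}}b^{p^{m+h}},c^{p^{m+h}}\rangle=\langle b^{p^{m+2h}},a^{p^{m+h}}b^{p^{m+h}},c^{p^{m+h}}\rangle\cong C_{p^{2n}}\times C_{p^n}\times C_{p^n};$$ $$|N_p|=p^{4n},\quad |G_p/N_p|=p^{7h+3n},\quad |W_p|=p^{7h+4n}=p^{7m-3n}.$$ (2) $G_p/N_p$ is generated by elements $a_0,b_0,c_0$ subject to the defining relations $$c_0=[a_0,b_0],\quad a_0^{c_0}=a_0^{\alpha^\gamma},\quad {}^{c_0}b_0=b_0^{\alpha^\gamma},$$ $$a_0^{p^{m+2h}}=1,\quad a_0^{p^{m+h}}b_0^{p^{m+h}}=1,\quad b_0^{p^{m+2h}}=1,\quad c_0^{p^{m+h}}=1,$$ and every element of $G_p/N_p$ can be written in one and only one way in the form $a_0^{e_1}b_0^{e_2}c_0^{e_3}$ with $0\le e_1<p^{m+2h}$, $0\le e_2<p^{m+h}$, $0\le e_3<p^{m+h}$. (3) $W_p$ is generated by elements $a_0,b_0,c_0,d_0$ subject to the defining relations in (2) as well as $$a_0^{d_0}=a_0^{\alpha^{qk}},\quad {}^{d_0}b_0=b_0^{\alpha^{qk}},\quad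 d_0^{p^n}=c_0^q,$$ and every element of $W_p$ can be written in one and only one way in the form $a_0^{e_1}b_0^{e_2}c_0^{e_3}d_0^{e_4}$ with $0\le e_1<p^{m+2h}$, $0\le e_2<p^{m+h}$, $0\le e_3<p^{m+h}$, $0\le e_4<p^n$. (4) The automorphism $a\leftrightarrow b$, $c\leftrightarrow c^{-1}$ of $G_p$ induces an automorphism $a_0\leftrightarrow b_0$, $c_0\leftrightarrow c_0^{-1}$ of $G_p/N_p$, which extends to an automorphism of $W_p$ via $d_0\leftrightarrow d_0^{-1}$.
   Context: Conventions: $x^y=y^{-1}xy$, ${}^y x=yxy^{-1}$, $[x,y]=x^{-1}y^{-1}xy$; $C_s$ is the cyclic group of order $s$; $v_p$ is the $p$-adic valuation. $W=\langle X,Y,Z\mid X^Z=X^\alpha,\ {}^Z Y=Y^\alpha,\ Z^\gamma=[X,Y]\rangle$ (a finite group), $G=\langle A,B\mid A^{[A,B]}=A^{\alpha^\gamma},\ {}^{[A,B]}B=B^{\alpha^\gamma}\rangle$ (known to be finite and nilpotent), and $N$ is the kernel of the homomorphism $G\to W$, $A\mapsto X$, $B\mapsto Y$. $J=G_p$ is the Sylow $p$-subgroup of $G$, $N_p=N\cap G_p$, and $W_p$ is a Sylow $p$-subgroup of $W$. $a,b$ are the images of $A,B$ under the canonical projection $G\to G_p$, and $c=[a,b]$; $a_0,b_0,c_0$ are the images of $a,b,c$ in $G_p/N_p$, and $G_p/N_p$ is identified with a normal subgroup of $W_p$ (via the map induced by $G\to W$). $m=v_p(\alpha^\gamma-1)$,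 $n=v_p(\gamma)$, $\gamma=p^nk$, $h=v_p(\alpha-1)$, $q=|G/G_p|$. $Z(J)=Z_1(J)\subseteq Z_2(J)\subseteq\cdots$ is the upper central series; $Z_3(J)$ is known to be abelian here. $M_n$ is the subgroup of all $V\in Z_3(J)$ with $V^{p^n}\in Z(J)$, and $L_{2n}$ is the subgroup of all $V\in Z_3(J)$ with $V^{p^{2n}}=1$. *)

(* Defs.v *)
From mathcomp Require Import all_boot all_order all_algebra all_fingroup all_solvable.

Set Implicit Arguments.
Unset Strict Implicit.
Unset Printing Implicit Defensive.

Local Open Scope group_scope.

Definition padic_val (p : nat) (z : int) : nat := logn p `|z|%N.

Definition zexpg (H : groupType) (x : H) (z : int) : H :=
  match z with
  | Posz n => x ^+ n
  | Negz n => x ^- n.+1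
  end.

(* A list of relations between the entries of a sequence of group elements.
   It has to make sense in every group, finite or not. *)
Definition relations := forall H : groupType, seq H -> Prop.

(* G = < g | R >: the entries of g generate G and satisfy R, and (von Dyck)
   any choice of elements satisfying R in an arbitrary group H is the image of
   g under a homomorphism G -> H.  Unlike \isog Grp (...) of the library, H
   ranges over all groups, not only the finite ones, so that G is the abstract
   group defined by the presentation, not just its largest finite quotient. *)
Definition presented_by (gT : finGroupType) (G : {set gT}) (g : seq gT)
    (R : relations) : Prop :=
  [/\ <<[set x in g]>> = G, R gT g &
      forall (H : groupType) (h : seq H), R H h ->
        exists f : gT -> H,
          {in G &, {morph f : x y / x * y}} /\ map f g = h].

(* In all relations below, conjugation on the left is written
   y x y^-1 = x ^ y^-1, where x ^ y = y^-1 x y. *)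

Definition macdonald_rel (alpha : int) (gamma : nat) : relations :=
  fun H s => if s is [:: A; B] then
      let C := [~ A, B] in
      A ^ C = zexpg A (alpha ^+ gamma)%R /\
      B ^ C^-1 = zexpg B (alpha ^+ gamma)%R
    else False.

Definition wamsley_rel (alpha : int) (gamma : nat) : relations :=
  fun H s => if s is [:: X; Y; Z] then
      [/\ X ^ Z = zexpg X alpha,
          Y ^ Z^-1 = zexpg Y alpha &
          Z ^+ gamma = [~ X, Y]]
    else False.

Definition quotient_rel (alpha : int) (gamma p m h : nat) : relations :=
  fun H s => if s is [:: a; b; c] then
      [/\ c = [~ a, b],
          a ^ c = zexpg a (alpha ^+ gamma)%R &
          b ^ c^-1 = zexpg b (alpha ^+ gamma)%R] /\
      [/\ a ^+ (p ^ (m + 2 * h)) = 1,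
          a ^+ (p ^ (m + h)) * b ^+ (p ^ (m + h)) = 1,
          b ^+ (p ^ (m + 2 * h)) = 1 &
          c ^+ (p ^ (m + h)) = 1]
    else False.

Definition sylowW_rel (alpha : int) (gamma p m h n q k : nat) : relations :=
  fun H s => if s is [:: a; b; c; d] then
      quotient_rel alpha gamma p m h [:: a; b; c] /\
      [/\ a ^ d = zexpg a (alpha ^+ (q * k)%N)%R,
          b ^ d^-1 = zexpg b (alpha ^+ (q * k)%N)%R &
          d ^+ (p ^ n) = c ^+ q]
    else False.

(* The canonical projection of a finite nilpotent group G = G_p x G_p', with
   G_p = 'O_p(G) and G_p' = 'O_p^'(G), onto its Sylow p-subgroup G_p. *)
Definition sylow_proj (gT : finGroupType) (p : nat) (G : {set gT}) (x : gT)
    : gT := divgr 'O_p(G) 'O_p^'(G) x.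

Definition Mset (gT : finGroupType) (J : {set gT}) (p n : nat) : {set gT} :=
  [set V in 'Z_3(J) | V ^+ (p ^ n) \in 'Z(J)].

Definition Lset (gT : finGroupType) (J : {set gT}) (p r : nat) : {set gT} :=
  [set V in 'Z_3(J) | V ^+ (p ^ r) == 1].

(* Main.v *)
(** A lower bound for the orders of G_p and W_p comes from a permutation
    representation: on triples (i, j, k), to be read as Z^k X^i Y^j, right
    multiplication by X, Y and Z is given by explicit polynomials in s, where
    12 s = alpha^gamma - 1 modulo a high power of p.  They satisfy Wamsley's
    relations and act transitively on p^(7h+4n) points; the case gamma = 1
    gives p^(7m) for Macdonald's group.

    The upper bounds come from power relations.  Conjugating
    [b^alpha, a] by z, which normalises <a> and <b> and centralises c, yields
    a^w = (b^-w)^(z c^alpha) with w = e * Sum_(t < alpha) t (1+e)^t and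
    e = alpha^gamma - 1.  The p-part of w being known, some a^(p^r) is central
    and is, up to a unit exponent, a power of b; so every element has the form
    a^i b^j c^k with bounded exponents.  For z = c this bounds G_p, for z = Z
    it bounds the image of G_p in W_p and hence, by counting, determines N_p.
    Since the normal forms are unique, the centre, Z_3(G_p), the isomorphism
    types and the presentations can be read off from them. *)

Require Import Defs.
From mathcomp Require Import all_boot all_order all_algebra all_fingroup all_solvable.
From mathcomp Require Import ring zify.

Set Implicit Arguments.
Unset Strict Implicit.
Unset Printing Implicit Defensive.

Import GRing.Theory.
Local Open Scope group_scope.

(** The prime 3 shapes the arithmetic. With e = alpha^gamma - 1 the exponents of the model have
    coefficients such as e/2, e^2/6 and e^2/8, and e = 12 s makes them integral for all primes at
    once. For p = 3 this costs one factor: p^m divides 3 s, but perhaps not s. Hence every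
    divisibility involving s is assumed of a multiple of 3 s, 9 s^2 or 27 s^3, and the missing
    factor comes from 3 | v^3 - v. The upper bounds need the exact p-part of w; for p = 3 it is
    larger than expected precisely when alpha^gamma is 7 modulo 9, whence that exclusion.

    A presentation is tested on every group H, also on infinite ones, while G is known through its
    universal property. So each homomorphism to H starts as a map on all of G. The relations give
    the images of A and B p-power order, so a and b have the same images as A and B; the map is then
    pushed down to G_p/N_p or extended to W_p. *)

Ltac dvdz_sum :=
  repeat first [apply: rpredD | apply: rpredB | rewrite rpredN];
  apply: dvdz_mulr => //.

(** * The permutation model *)

Section ModelPolynomials.

Local Open Scope ring_scope.
Local Open Scope int_scope.

Variables (s g : int).

(* With 12 s = alpha^gamma - 1 and g = gamma, the p-part of W satisfies
   Z^k X^i Y^j X^t = Z^(Kpol t j k) X^(Ipol t i j) Y^(Jpol t j),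
   and Ipol 1 i j = (i + 1) * Bpol j. *)
Definition Bpol (j : int) : int := 1 - 12 * s * j + 72 * s ^+ 2 * (j * (j + 1)).

Definition Jpol (t j : int) : int :=
  j + 6 * s * (t * (j * (j + 1)))
  + 18 * s ^+ 2 * (t * (t - 1) * (j * (j + 1) * (2 * j + 1)))
  + 24 * s ^+ 2 * (t * (j ^+ 3 - j)) + 9 * s ^+ 3 * (t * (t - 1) * (j * (j + 1))).

Definition Ipol (t i j : int) : int :=
  i * (1 - 12 * s * (t * j) - 36 * s ^+ 2 * (t * (t - 1) * (j * (j + 1)))
       + 72 * s ^+ 2 * (t * j * (t * j + 1)))
  + t - 6 * s * (j * (t * (t + 1))) + 36 * s ^+ 2 * (j * (j + 1) * (t * (t + 1)))
  - 24 * s ^+ 2 * (j * (t ^+ 3 - t)).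

Definition Kpol (t j k : int) : int :=
  k - g * (t * j + 3 * s * (t * (t - 1) * (j * (j + 1)))).

Lemma cubeB_dvd3 (v : int) : exists c : int, v ^+ 3 - v = 3 * c.
Proof.
have [q [r [-> r_lt3]]] : exists q, exists r : nat, v = q * 3 + r%:Z /\ (r < 3)%N.
  exists (v %/ 3)%Z, `|(v %% 3)%Z|%N; split; last lia.
  rewrite {1}(divz_eq v 3); lia.
case: r r_lt3 => [|[|[|//]]] _.
- by exists (9 * q ^+ 3 - q); ring.
- by exists (9 * q ^+ 3 + 9 * q ^+ 2 + 2 * q); ring.
- by exists (9 * q ^+ 3 + 18 * q ^+ 2 + 11 * q + 2); ring.
Qed.

Variables (Q L K x : int).
Hypothesis s3Q : (Q %| 27 * s ^+ 3)%Z.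
Hypothesis s2xQ : (Q %| 9 * s ^+ 2 * x)%Z.
Hypothesis sx2Q : (Q %| 3 * s * x ^+ 2)%Z.
Hypothesis sxL : (L %| 3 * s * x)%Z.
Hypothesis sLQ : (Q %| 3 * s * L)%Z.
Hypothesis LxQ : (Q %| L * x)%Z.
Hypothesis s2K : (K %| g * (9 * s ^+ 2))%Z.
Hypothesis sxK : (K %| g * (3 * s * x))%Z.
Hypothesis gLK : (K %| g * L)%Z.
Hypothesis LQ : (L %| Q)%Z.

(** For p = 3 the coefficient 9 s^3 lacks one factor 3; the difference v^3 - v supplies it. *)
Lemma s3cubeQ v : (Q %| 9 * s ^+ 3 * (v ^+ 3 - v))%Z.
Proof.
have [c ->] := cubeB_dvd3 v.
rewrite (_ : 9 * s ^+ 3 * (3 * c) = 27 * s ^+ 3 * c); last by ring.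
by rewrite dvdz_mulr.
Qed.

(** Since [Jpol t j - j] has a factor 3 s, the power of s in front decides how much of it survives
    modulo [Q]: nothing after 9 s^2, and only the first-order term after 3 s in [Jpol_s1]. *)
Lemma Jpol_s2 t j : (Q %| 9 * s ^+ 2 * (Jpol t j - j))%Z.
Proof.
rewrite (_ : _ * _ = 27 * s ^+ 3 * (2 * t * (j * (j + 1))
  + 6 * s * (t * (t - 1) * (j * (j + 1) * (2 * j + 1)))
  + 8 * s * (t * (j ^+ 3 - j)) + 3 * s ^+ 2 * (t * (t - 1) * (j * (j + 1))))).
  by rewrite dvdz_mulr.
by rewrite /Jpol; ring.
Qed.

Lemma Jpol_s1 t j :
  (Q %| 3 * s * (Jpol t j - j) - 18 * s ^+ 2 * (t * (j * (j + 1))))%Z.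
Proof.
rewrite (_ : _ - _ = 27 * s ^+ 3 * (2 * (t * (t - 1) * (j * (j + 1) * (2 * j + 1)))
   + s * (t * (t - 1) * (j * (j + 1)))) + 9 * s ^+ 3 * (j ^+ 3 - j) * (8 * t)).
  by have s3v := s3cubeQ j; dvdz_sum.
by rewrite /Jpol; ring.
Qed.

Lemma Jpol_cube t j :
  (Q %| 24 * s ^+ 2 * ((Jpol t j ^+ 3 - Jpol t j) - (j ^+ 3 - j))
        + 9 * s ^+ 3 * (t * (j * (j + 1))))%Z.
Proof.
have J2 := Jpol_s2 t j; have J1 := Jpol_s1 t j.
set d := Jpol t j - j in J1 J2.
have [d' def_d] : exists d', d = 3 * s * d'.
  exists (2 * (t * (j * (j + 1)))
  + 6 * s * (t * (t - 1) * (j * (j + 1) * (2 * j + 1)))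
  + 8 * s * (t * (j ^+ 3 - j)) + 3 * s ^+ 2 * (t * (t - 1) * (j * (j + 1)))).
  by rewrite /d /Jpol; ring.
rewrite (_ : _ + _ = 9 * s ^+ 2 * d * (8 * j ^+ 2 + 8 * j * d)
  + 27 * s ^+ 3 * (24 * s ^+ 2 * d' ^+ 3 - 5 * (t * (j * (j + 1))))
  - (3 * s * d - 18 * s ^+ 2 * (t * (j * (j + 1)))) * (8 * s)).
  by dvdz_sum.
have -> : Jpol t j = j + d by rewrite /d; ring.
transitivity (24 * s ^+ 2 * (3 * j ^+ 2 * d + 3 * j * d ^+ 2 + d ^+ 3 - d)
  + 9 * s ^+ 3 * (t * (j * (j + 1)))); first ring.
have -> : d ^+ 3 = 27 * s ^+ 3 * d' ^+ 3 by rewrite def_d; ring.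
ring.
Qed.

(** [Jpol t] is a closed form for the t-th iterate of [Jpol 1], truncated where terms vanish modulo
    [Q]. With [IpolS] and [KpolS] this is the step from X^t to X^(t+1), for negative t as well. *)
Lemma JpolS t j : (Q %| Jpol (t + 1) j - Jpol 1 (Jpol t j))%Z.
Proof.
have J2 := Jpol_s2 t j; have J1 := Jpol_s1 t j; have J3 := Jpol_cube t j.
set J := Jpol t j in J1 J2 J3 *.
rewrite (_ : _ - _ =
   27 * s ^+ 3 * (t * (j * (j + 1)))
   - (24 * s ^+ 2 * ((J ^+ 3 - J) - (j ^+ 3 - j)) + 9 * s ^+ 3 * (t * (j * (j + 1)))) * 1
   - (3 * s * (J - j) - 18 * s ^+ 2 * (t * (j * (j + 1)))) * (2 * (J + j + 1))
   - 9 * s ^+ 2 * (J - j) * (4 * (t * (j * (j + 1))))).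
  by dvdz_sum.
have defJ : Jpol (t + 1) j = J + 6 * s * (j * (j + 1))
   + 36 * s ^+ 2 * (t * (j * (j + 1) * (2 * j + 1)))
   + 24 * s ^+ 2 * (j ^+ 3 - j) + 18 * s ^+ 3 * (t * (j * (j + 1))).
  by rewrite /J /Jpol; ring.
by rewrite defJ /(Jpol 1); ring.
Qed.

Lemma IpolS t i j :
  (Q %| Ipol (t + 1) i j - (Ipol t i j + 1) * Bpol (Jpol t j))%Z.
Proof.
have J2 := Jpol_s2 t j; have J1 := Jpol_s1 t j.
have B_J : (Q %| Bpol (Jpol t j) - (Bpol j - 72 * s ^+ 2 * (t * (j * (j + 1)))))%Z.
  rewrite (_ : _ - _ = 9 * s ^+ 2 * (Jpol t j - j) * (8 * (Jpol t j + j + 1))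
    - (3 * s * (Jpol t j - j) - 18 * s ^+ 2 * (t * (j * (j + 1)))) * 4).
    by dvdz_sum.
  by rewrite /Bpol; ring.
have -> : Ipol (t + 1) i j - (Ipol t i j + 1) * Bpol (Jpol t j)
  = 27 * s ^+ 3 * (16 * t * j ^+ 2 * (1 + t + 2 * j + t * j - t ^+ 2 * j)
      + 16 * i * t * j ^+ 2 * (5 - 3 * t + 3 * j - t * j)
      + 32 * s * t * j ^+ 2 * (- 5 + 2 * t + 5 * t ^+ 2 - 2 * t ^+ 3)
      + 32 * s * t * j ^+ 3 * (- 8 + 2 * t + 8 * t ^+ 2 - 2 * t ^+ 3)
      + 96 * s * t * j ^+ 4 * (t ^+ 2 - 1)
      + 96 * i * s * t * j ^+ 2 * (- 3 + 4 * t - t ^+ 2 - 4 * j + 4 * t * j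
                                   - j ^+ 2 + t ^+ 2 * j ^+ 2))
    - 9 * s ^+ 3 * (t ^+ 3 - t) * (80 * j ^+ 2)
    - (Bpol (Jpol t j) - (Bpol j - 72 * s ^+ 2 * (t * (j * (j + 1)))))
      * (Ipol t i j + 1).
  by rewrite /Bpol /Ipol; ring.
by have s3v := s3cubeQ t; dvdz_sum.
Qed.

Lemma KpolS t j k : (K %| Kpol (t + 1) j k - (Kpol t j k - g * Jpol t j))%Z.
Proof.
have [c def_c] := cubeB_dvd3 j.
rewrite (_ : _ - _ = g * (9 * s ^+ 2) *
   (2 * (t * (t - 1) * (j * (j + 1) * (2 * j + 1))) + 8 * t * c
    + s * (t * (t - 1) * (j * (j + 1))))); first by dvdz_sum.
by rewrite /Kpol /Jpol def_c; ring.
Qed.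

End ModelPolynomials.

Section ModelMaps.

Local Open Scope ring_scope.
Local Open Scope int_scope.

Variables (s x be Q L K : int) (gam : nat).
Let al : int := 1 + x.
Let g : int := gam%:Z.
Hypothesis s3Q : (Q %| 27 * s ^+ 3)%Z.
Hypothesis s2xQ : (Q %| 9 * s ^+ 2 * x)%Z.
Hypothesis sx2Q : (Q %| 3 * s * x ^+ 2)%Z.
Hypothesis sxL : (L %| 3 * s * x)%Z.
Hypothesis sLQ : (Q %| 3 * s * L)%Z.
Hypothesis LxQ : (Q %| L * x)%Z.
Hypothesis s2K : (K %| g * (9 * s ^+ 2))%Z.
Hypothesis sxK : (K %| g * (3 * s * x))%Z.
Hypothesis gLK : (K %| g * L)%Z.
Hypothesis LQ : (L %| Q)%Z.
Hypothesis al_be : (Q %| al * be - 1)%Z.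
Hypothesis al_g : (Q %| al ^+ gam - (1 + 12 * s))%Z.

Definition pt := (int * int * int)%type.

Definition Xmap (t : int) (v : pt) : pt :=
  (Ipol s t v.1.1 v.1.2, Jpol s t v.1.2, Kpol s g t v.1.2 v.2).
Definition Ymap (v : pt) : pt := (v.1.1, v.1.2 + 1, v.2).
(** Moving Z to the left across X^i Y^j multiplies i by alpha = 1 + x and divides j by alpha; [be]
    is the inverse of alpha modulo [Q]. *)
Definition Zmap (v : pt) : pt := ((1 + x) * v.1.1, be * v.1.2, v.2 + 1).

(* Besides X^Q = 1 = Z^K, the model identifies (i, j) with (i + L, j + L), which
   accounts for the relation X^L Y^L = 1. *)
Definition eqv (v w : pt) : Prop :=
  [/\ (Q %| (v.1.1 - v.1.2) - (w.1.1 - w.1.2))%Z, (L %| v.1.2 - w.1.2)%Z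
    & (K %| v.2 - w.2)%Z].

Lemma eqv_coord (v w : pt) : (Q %| v.1.1 - w.1.1)%Z -> (Q %| v.1.2 - w.1.2)%Z ->
  (K %| v.2 - w.2)%Z -> eqv v w.
Proof.
move=> h1 h2 h3; split=> //; last exact: dvdz_trans h2.
rewrite (_ : _ - _ = (v.1.1 - w.1.1) - (v.1.2 - w.1.2)); last by ring.
by rewrite rpredB.
Qed.

Lemma eqvP v w : eqv v w -> exists l q r : int,
  v = (w.1.1 + L * l + Q * q, w.1.2 + L * l, w.2 + K * r).
Proof.
case: v w => [[i j] k] [[i' j'] k'] /= [/= /dvdzP[q eq_q] /dvdzP[l eq_l] /dvdzP[r eq_r]].
exists l, q, r; congr (_, _, _).
- by rewrite mulrC -eq_l mulrC -eq_q; ring.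
- by rewrite mulrC -eq_l; ring.
- by rewrite mulrC -eq_r; ring.
Qed.

Lemma Ymap_eqv v w : eqv v w -> eqv (Ymap v) (Ymap w).
Proof.
case: v w => [[i j] k] [[i' j'] k'] [/= h1 h2 h3]; split=> //=.
  by rewrite (_ : _ - _ = i - j - (i' - j')); last ring.
by rewrite (_ : _ - _ = j - j'); last ring.
Qed.

Lemma be1L : (Q %| L * (be - 1))%Z.
Proof.
rewrite (_ : _ * _ = (al * be - 1) * L - L * x * be); last by rewrite /al; ring.
by dvdz_sum.
Qed.

Lemma Zmap_eqv v w : eqv v w -> eqv (Zmap v) (Zmap w).
Proof.
move=> /eqvP [l [q [r ->]]]; case: w => [[i j] k] /=; have := be1L => hbe; split=> /=.
- rewrite (_ : _ - _ = L * x * l + Q * (al * q) - L * (be - 1) * l).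
    by dvdz_sum.
  by rewrite /al; ring.
- by rewrite (_ : _ - _ = L * (be * l)) ?dvdz_mulr //; ring.
- by rewrite (_ : _ - _ = K * r) ?dvdz_mulr //; ring.
Qed.

Lemma Ipol1 i j : Ipol s 1 i j = (i + 1) * Bpol s j.
Proof. by rewrite /Ipol /Bpol; ring. Qed.

Lemma Xmap_eqv v w : eqv v w -> eqv (Xmap 1 v) (Xmap 1 w).
Proof.
move=> /eqvP [l [q [r ->]]]; case: w => [[i j] k] /=; split=> /=; rewrite ?Ipol1.
- rewrite (_ : _ - _ = 3 * s * L * (l * (- 6 - 4 * i - 8 * j - 6 * (L * l)
     + 8 * s * (4 + 3 * i + 9 * j + 6 * i * j + 3 * j * (L * l) + 3 * i * (L * l)
                + 6 * (L * l) + 2 * (L * l) ^+ 2)))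
     + Q * (q * Bpol s (j + L * l))).
    by dvdz_sum.
  by rewrite /Bpol /Jpol; ring.
- rewrite (_ : _ - _ = L * (l * (1 + 3 * s * (2 + 2 * (L * l) + 4 * j
     + 8 * s * (- 1 + (L * l) ^+ 2 + 3 * j * (L * l) + 3 * j ^+ 2))))).
    by rewrite dvdz_mulr.
  by rewrite /Jpol; ring.
- rewrite (_ : _ - _ = K * r - g * L * l); first by dvdz_sum.
  by rewrite /Kpol; ring.
Qed.

Lemma Xmap0 v : Xmap 0 v = v.
Proof.
by case: v => [[i j] k]; rewrite /Xmap /Ipol /Jpol /Kpol /=; congr (_, _, _); ring.
Qed.

Lemma XmapS t v : eqv (Xmap (t + 1) v) (Xmap 1 (Xmap t v)).
Proof.
case: v => [[i j] k]; apply: eqv_coord => /=.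
- by rewrite Ipol1 IpolS.
- exact: JpolS.
- rewrite (_ : Kpol s g 1 _ _ = Kpol s g t j k - g * Jpol s t j).
    exact: (@KpolS _ _ K).
  by rewrite {1}/Kpol; ring.
Qed.

Lemma Zmap_iter n v :
  iter n Zmap v = ((1 + x) ^+ n * v.1.1, be ^+ n * v.1.2, v.2 + n%:Z).
Proof.
elim: n => [|n IHn] /=.
  by case: v => [[i j] k] /=; rewrite !expr0 !mul1r addr0.
by rewrite IHn /Zmap /= !exprS !mulrA -addrA -addn1 PoszD.
Qed.

Lemma be_g : (Q %| be ^+ gam * (1 + 12 * s) - 1)%Z.
Proof.
have albeg : (Q %| al ^+ gam * be ^+ gam - 1)%Z.
  rewrite (_ : _ - _ = (al * be) ^+ gam - 1 ^+ gam); last by rewrite expr1n exprMn.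
  by rewrite subrXX dvdz_mulr.
rewrite (_ : _ - _ = al ^+ gam * be ^+ gam - 1
                     - (al ^+ gam - (1 + 12 * s)) * be ^+ gam); last ring.
by rewrite rpredB // dvdz_mulr.
Qed.

(** Permutations compose from left to right, so this is X Y = Y X Z^gam, that is Z^gam = [X, Y]. In
    the same way [YZmap] is Z Y = Y^al Z and [XZmap] is X Z = Z X^al. *)
Lemma XYmap v : eqv (Ymap (Xmap 1 v)) (iter gam Zmap (Xmap 1 (Ymap v))).
Proof.
rewrite Zmap_iter; case: v => [[i j] k]; apply: eqv_coord => /=; rewrite ?Ipol1.
- rewrite (_ : _ - _ = 27 * s ^+ 3 * (- (i + 1) * (64 + 96 * j + 32 * j ^+ 2))
    - (al ^+ gam - (1 + 12 * s)) * ((i + 1) * Bpol s (j + 1))).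
    by dvdz_sum.
  by rewrite /Bpol /al; ring.
- have s3v := s3cubeQ s3Q j.
  rewrite (_ : _ - _ = 9 * s ^+ 3 * (j ^+ 3 - j) * (32 * be ^+ gam)
     - (be ^+ gam * (1 + 12 * s) - 1) * (Jpol s 1 j + 1)).
    by have hbe := be_g; dvdz_sum.
  by rewrite /Jpol; ring.
- by rewrite (_ : _ - _ = 0) ?dvdz0 // /Kpol /g; ring.
Qed.

Lemma YZmap v : eqv (Ymap (Zmap v)) (Zmap (v.1.1, v.1.2 + al, v.2)).
Proof.
case: v => [[i j] k]; apply: eqv_coord => /=; rewrite ?subrr ?dvdz0 //.
by rewrite (_ : _ - _ = (al * be - 1) * (-1)) ?dvdz_mulr //; ring.
Qed.

Lemma ZZmap v : eqv (Zmap (be * v.1.1, al * v.1.2, v.2 - 1)) v.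
Proof.
case: v => [[i j] k]; apply: eqv_coord => /=.
- by rewrite (_ : _ - _ = (al * be - 1) * i) ?dvdz_mulr // /al; ring.
- by rewrite (_ : _ - _ = (al * be - 1) * j) ?dvdz_mulr // /al; ring.
- by rewrite (_ : _ - _ = 0) ?dvdz0 //; ring.
Qed.

Lemma cancel_al y : (Q %| al * y)%Z -> (Q %| y)%Z.
Proof.
move=> h; rewrite (_ : y = al * y * be - (al * be - 1) * y); last ring.
by rewrite rpredB // dvdz_mulr.
Qed.

(** Writing the exponent of Y as [al * j] keeps [be] out of the arguments of the polynomials. The
    second coordinates differ by a multiple of 3 s x, which is known to vanish modulo [L] only; the
    first ones make up for it, so the two points agree for [eqv] and not coordinate by
    coordinate. *)
Lemma XZmap_alj i j k :
  eqv (al * (i + 1) * Bpol s (al * j), be * Jpol s 1 (al * j), k)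
      (Ipol s al (al * i) j, Jpol s al j, k).
Proof.
have [c def_c] := cubeB_dvd3 j.
have Dj : al * Jpol s al j - Jpol s 1 (al * j) = 3 * s * x * (al * j *
  (2 + s * (6 * x - 2 + 18 * j * al + 4 * j ^+ 2 * al + 3 * s * al * (1 + j)))).
  by rewrite /Jpol /al; ring.
split=> /=; last by rewrite subrr dvdz0.
  apply: cancel_al.
  have -> : al * (al * (i + 1) * Bpol s (al * j) - be * Jpol s 1 (al * j)
                  - (Ipol s al (al * i) j - Jpol s al j))
    = 9 * s ^+ 2 * x * (4 * c + j * (10 + 18 * j + 4 * i * (1 + j) + s * (1 + j)))
    - 3 * s * x ^+ 2 * (2 * j * al - j * s * (68 + 50 * x + 8 * x ^+ 2)
        - 6 * j ^+ 2 * s * (22 + 17 * x + 4 * x ^+ 2) - 4 * j ^+ 3 * s * (2 + x)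
        - 12 * i * j * s * (1 + j) * (3 + 3 * x + x ^+ 2)
        - 3 * j * s ^+ 2 * (1 + j) * (2 + x))
    - (al * be - 1) * Jpol s 1 (al * j).
    have -> : 9 * s ^+ 2 * x * (4 * c + j * (10 + 18 * j + 4 * i * (1 + j) + s * (1 + j)))
      = 12 * s ^+ 2 * x * (j ^+ 3 - j)
        + 9 * s ^+ 2 * x * (j * (10 + 18 * j + 4 * i * (1 + j) + s * (1 + j))).
      by rewrite def_c; ring.
    by rewrite /Ipol /Jpol /Bpol /al; ring.
  by dvdz_sum.
have al_beL : (L %| al * be - 1)%Z by apply: dvdz_trans al_be.
rewrite (_ : _ - _ = (al * be - 1) * Jpol s al j
    - (al * Jpol s al j - Jpol s 1 (al * j)) * be); last ring.
by rewrite Dj; apply: rpredB; apply: dvdz_mulr => //; apply: dvdz_mulr.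
Qed.

Lemma eqv_trans u v w : eqv u v -> eqv v w -> eqv u w.
Proof.
case: u v w => [[i1 j1] k1] [[i2 j2] k2] [[i3 j3] k3].
move=> [/= a1 a2 a3] [/= b1 b2 b3]; split=> /=.
- rewrite (_ : _ - _ = i1 - j1 - (i2 - j2) + (i2 - j2 - (i3 - j3))); [exact: rpredD | ring].
- rewrite (_ : _ - _ = j1 - j2 + (j2 - j3)); [exact: rpredD | ring].
- rewrite (_ : _ - _ = k1 - k2 + (k2 - k3)); [exact: rpredD | ring].
Qed.

Lemma XZmap v : eqv (Zmap (Xmap 1 v)) (Xmap al (Zmap v)).
Proof.
case: v => [[i j] k].
have := XZmap_alj i (be * j) (Kpol s g al (be * j) (k + 1)).
apply: eqv_trans; apply: eqv_coord => /=.
- rewrite Ipol1 (_ : _ - _ = (al * be - 1) * (al * (i + 1) * j *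
    (12 * s - 72 * s ^+ 2 * (al * be * j + j + 1)))); first by dvdz_sum.
  by rewrite /Bpol /al; ring.
- rewrite (_ : _ - _ = (al * be - 1) * (- be * j * (1 + 6 * s * (al * be * j + j + 1)
    + 24 * s ^+ 2 * ((al * be * j) ^+ 2 + al * be * j * j + j ^+ 2 - 1)))).
    by dvdz_sum.
  by rewrite /Jpol /al; ring.
- have gQ : (K %| g * Q)%Z.
    by apply: dvdz_trans gLK _; have /dvdzP[q ->] := LQ; rewrite mulrCA dvdz_mull.
  have gabe : (K %| g * (al * be - 1))%Z.
    by have /dvdzP[q ->] := al_be; rewrite mulrCA dvdz_mull.
  rewrite (_ : _ - _ = g * (al * be - 1) * j
      + g * (3 * s * x) * (al * (be * j * (be * j + 1)))); first by dvdz_sum.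
  by rewrite /Kpol /al; ring.
Qed.

End ModelMaps.

(** * Permutations of a finite quotient and integers modulo q *)

Section LiftPerm.

Variables (V : Type) (T : finType) (proj : V -> T) (lift : T -> V).
Hypothesis liftK : cancel lift proj.

(** A one-sided inverse is enough, [T] being finite. *)
Lemma lift_perm_exists (f f' : V -> V) :
    (forall v w, proj v = proj w -> proj (f v) = proj (f w)) ->
    (forall v, proj (f (f' v)) = proj v) ->
  exists F : {perm T}, forall v, F (proj v) = proj (f v).
Proof.
move=> f_proj f'K; pose F t := proj (f (lift t)).
have FE v : F (proj v) = proj (f v) by apply: f_proj; rewrite liftK.
have F'K : cancel (fun t => proj (f' (lift t))) F.
  by move=> t; rewrite FE f'K liftK.
have F_inj : injective F by apply: can_inj (canF_sym F'K).
by exists (perm F_inj) => v; rewrite permE.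
Qed.

End LiftPerm.

Lemma perm_expgE (T : finType) (F : {perm T}) n u : (F ^+ n) u = iter n F u.
Proof. by elim: n => [|n IHn]; rewrite ?perm1 // expgSr permM IHn. Qed.

Lemma zexpg_orbit (T : finType) (F : {perm T}) (u : int -> T) :
  (forall z, F (u z) = u (z + 1)%R) -> forall z, (zexpg F z) (u 0%R) = u z.
Proof.
move=> uS [r | r].
  rewrite /= perm_expgE; elim: r => //= r ->.
  by rewrite uS -addn1 PoszD.
rewrite /=; elim: r => [|r IHr].
  by apply: (@perm_inj _ F); rewrite permKV uS NegzE addNr.
rewrite expgS invgM permM IHr; apply: (@perm_inj _ F).
by rewrite permKV uS; congr u; rewrite !NegzE; lia.
Qed.

Lemma intr_Zp_eq0 (q : nat) (z : int) : 1 < q ->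
  (z%:~R == 0 :> 'Z_q)%R = (q%:Z %| z)%Z.
Proof.
move=> q_gt1; apply/idP/idP => [|/dvdzP[c ->]]; last first.
  by rewrite rmorphM /= -pmulrn pchar_Zp ?mulr0.
have [r z_eq r_lt] : exists2 r : nat, z = ((z %/ q%:Z)%Z * q%:Z + r%:Z)%R & r < q.
  exists `|(z %% q%:Z)%Z|%N; last by lia.
  by rewrite {1}(divz_eq z q%:Z); lia.
rewrite {1}z_eq rmorphD rmorphM /= -!pmulrn pchar_Zp // mulr0 add0r.
move=> /eqP/(congr1 val); rewrite /= val_Zp_nat // modn_small // => r0.
by rewrite z_eq r0 addr0 dvdz_mull.
Qed.

Lemma intr_Zp_eq (q : nat) (y z : int) : 1 < q ->
  (y%:~R = z%:~R :> 'Z_q)%R <-> (q%:Z %| (y - z)%R)%Z.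
Proof.
move=> q_gt1; rewrite -intr_Zp_eq0 // rmorphB subr_eq0.
by split=> /eqP.
Qed.

Section Model.

Variables (alpha : int) (gam p h n : nat).
Hypotheses (p_pr : prime p) (p_odd : odd p) (h_gt0 : 0 < h).
Hypothesis alpha_h : ((p ^ h)%N%:Z %| (alpha - 1)%R)%Z.
Hypothesis gam_n : p ^ n %| gam.
Let m := (h + n)%N.
Hypothesis alphaX_m : ((p ^ m)%N%:Z %| (alpha ^+ gam - 1)%R)%Z.

Let Q := (p ^ (m + 2 * h))%N.
Let L := (p ^ (m + h))%N.
Let K := (p ^ (m + h + n))%N.

Lemma inv_mod_exists (a : int) (q : nat) : coprime `|a| q ->
  exists b : int, (q%:Z %| (a * b - 1)%R)%Z.
Proof.
move=> co_aq; have [u [v uv]] := Bezoutz a q%:Z.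
have gcd1 : gcdn `|a| q = 1%N by apply/eqP.
exists u; rewrite (_ : _ - _ = - (v * q%:Z))%R; first by rewrite rpredN dvdz_mull.
have {uv} uv : (u * a + v * q%:Z = 1)%R by rewrite uv /gcdz !absz_nat gcd1.
by rewrite -uv; ring.
Qed.

(** For p other than 3, dividing by 12 modulo [Q] is possible. For p = 3 only 4 is inverted, and the
    factor 3 is taken out of p^m, where m > 0. *)
Lemma twelfth_exists : exists s : int,
  ((p ^ m)%N%:Z %| (3 * s)%R)%Z /\ (Q%:Z %| (alpha ^+ gam - (1 + 12 * s))%R)%Z.
Proof.
have /dvdzP[u def_u] := alphaX_m.
have co2 k : coprime 2 (p ^ k) by rewrite coprimeXr // coprime2n.
have [p3 | p_neq3] := eqVneq p 3%N.
  have [b hb] : exists b : int, (Q%:Z %| (4 * b - 1)%R)%Z.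
    by apply: (@inv_mod_exists 4); rewrite (coprimeXl 2 (co2 _)).
  have m_eq : (p ^ m = 3 * p ^ m.-1)%N by rewrite -[in RHS]p3 -expnS prednK // addn_gt0 h_gt0.
  exists ((p ^ m.-1)%N%:Z * u * b)%R; split.
    by rewrite m_eq PoszM -!mulrA dvdz_mul2l // dvdz_mulr.
  rewrite (_ : _ - _ = - ((4 * b - 1) * (u * (p ^ m)%N%:Z)))%R.
    by rewrite rpredN dvdz_mulr.
  by rewrite opprD addrA def_u m_eq PoszM; ring.
have [b hb] : exists b : int, (Q%:Z %| (12 * b - 1)%R)%Z.
  apply: (@inv_mod_exists 12); rewrite -[X in coprime X _]/(2 ^ 2 * 3)%N coprimeMl.
  rewrite coprimeXl ?co2 //= coprimeXr // prime_coprime // dvdn_prime2 //.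
  by rewrite eq_sym.
exists ((alpha ^+ gam - 1) * b)%R; split.
  by rewrite dvdz_mull // dvdz_mulr.
rewrite (_ : _ - _ = - ((12 * b - 1) * (alpha ^+ gam - 1)))%R; last by ring.
by rewrite rpredN dvdz_mulr.
Qed.

Lemma wamsley_model : exists (T : finType) (X Y Z : {perm T}),
  wamsley_rel alpha gam [:: X; Y; Z] /\
  (p ^ (7 * h + 4 * n) %| #|<<[set x in [:: X; Y; Z]]>>|)%N.
Proof.
have [s [s_m alphaX]] := twelfth_exists.
have [x def_al] : exists x, alpha = (1 + x)%R by exists (alpha - 1)%R; lia.
have x_h : ((p ^ h)%N%:Z %| x)%Z by rewrite -[x](addKr 1%R) -def_al addrC.
have x_p : (p%:Z %| x)%Z.
  by apply: dvdz_trans x_h; rewrite dvdzE /= dvdn_exp.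
have [be albe] : exists b : int, (Q%:Z %| ((1 + x) * b - 1)%R)%Z.
  apply: inv_mod_exists; rewrite coprime_sym coprimeXl // prime_coprime //.
  apply/negP => /= p_al.
  have : (p%:Z %| (1 + x - x)%R)%Z by rewrite rpredB.
  by rewrite addrK dvdzE /= dvdn1 => /eqP p1; have := prime_gt1 p_pr; rewrite p1.
have [P PX] : exists P : int, forall k, ((p ^ k)%N%:Z = P ^+ k)%R.
  by exists p%:Z%R => k; elim: k => // k IHk; rewrite expnS exprS PoszM IHk.
have dvdP i k c : i <= k -> ((p ^ i)%N%:Z %| (c * P ^+ k)%R)%Z.
  by move=> le_ik; rewrite -PX dvdz_mull // dvdzE dvdn_exp2l.
have /dvdzP[sg def_s] := s_m; have /dvdzP[x' def_x] := x_h.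
have [g' def_g] : exists g' : int, (gam%:Z = g' * (p ^ n)%N%:Z)%R.
  by have /dvdnP[g' ->] := gam_n; exists (Posz g'); rewrite PoszM.
rewrite !PX in def_s def_x def_g.
have s3Q : (Q%:Z %| (27 * s ^+ 3)%R)%Z.
  rewrite (_ : 27 * s ^+ 3 = sg ^+ 3 * P ^+ (m + m + m))%R;
    first by apply: dvdP; rewrite /m; clear; lia.
  by rewrite (_ : 27 * s ^+ 3 = (3 * s) ^+ 3)%R; [rewrite def_s !exprD; ring | ring].
have s2xQ : (Q%:Z %| (9 * s ^+ 2 * x)%R)%Z.
  rewrite (_ : 9 * s ^+ 2 * x = sg ^+ 2 * x' * P ^+ (m + m + h))%R;
    first by apply: dvdP; rewrite /m; clear; lia.
  by rewrite (_ : 9 * s ^+ 2 * x = (3 * s) ^+ 2 * x)%R; [rewrite def_s def_x !exprD; ring | ring].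
have sx2Q : (Q%:Z %| (3 * s * x ^+ 2)%R)%Z.
  rewrite (_ : 3 * s * x ^+ 2 = sg * x' ^+ 2 * P ^+ (m + h + h))%R;
    first by apply: dvdP; rewrite /m; clear; lia.
  by rewrite def_s def_x !exprD; ring.
have sxL : (L%:Z %| (3 * s * x)%R)%Z.
  rewrite (_ : 3 * s * x = sg * x' * P ^+ (m + h))%R;
    first by apply: dvdP; rewrite /m; clear; lia.
  by rewrite def_s def_x !exprD; ring.
have sLQ : (Q%:Z %| (3 * s * L%:Z)%R)%Z.
  rewrite (_ : 3 * s * L%:Z = sg * P ^+ (m + m + h))%R;
    first by apply: dvdP; rewrite /m; clear; lia.
  by rewrite def_s /L PX !exprD; ring.
have LxQ : (Q%:Z %| (L%:Z * x)%R)%Z.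
  rewrite (_ : L%:Z * x = x' * P ^+ (m + h + h))%R;
    first by apply: dvdP; rewrite /m; clear; lia.
  by rewrite def_x /L PX !exprD; ring.
have s2K : (K%:Z %| (gam%:Z * (9 * s ^+ 2))%R)%Z.
  rewrite (_ : gam%:Z * (9 * s ^+ 2) = g' * sg ^+ 2 * P ^+ (n + m + m))%R;
    first by apply: dvdP; rewrite /m; clear; lia.
  by rewrite (_ : 9 * s ^+ 2 = (3 * s) ^+ 2)%R; [rewrite def_s def_g !exprD; ring | ring].
have sxK : (K%:Z %| (gam%:Z * (3 * s * x))%R)%Z.
  rewrite (_ : gam%:Z * (3 * s * x) = g' * sg * x' * P ^+ (n + m + h))%R;
    first by apply: dvdP; rewrite /m; clear; lia.
  by rewrite def_s def_g def_x !exprD; ring.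
have gLK : (K%:Z %| (gam%:Z * L%:Z)%R)%Z.
  rewrite (_ : gam%:Z * L%:Z = g' * P ^+ (n + m + h))%R;
    first by apply: dvdP; rewrite /m; clear; lia.
  by rewrite def_g /L PX !exprD; ring.
have LQ : (L%:Z %| Q%:Z)%Z by rewrite dvdzE dvdn_exp2l // leq_add2l mul2n -addnn leq_addr.
have Q_gt1 : 1 < Q by rewrite (ltn_exp2l 0) ?prime_gt1 // /m; clear -h_gt0; lia.
have L_gt1 : 1 < L by rewrite (ltn_exp2l 0) ?prime_gt1 // /m; clear -h_gt0; lia.
have K_gt1 : 1 < K by rewrite (ltn_exp2l 0) ?prime_gt1 // /m; clear -h_gt0; lia.
(* The classes of [eqv] are the values of (i - j, j, k) modulo (Q, L, K); the exponents m + 2h, m +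
   h and m + h + n add up to 7h + 4n. *)
pose T := ('Z_Q * 'Z_L * 'Z_K)%type.
pose proj (v : pt) : T := ((v.1.1 - v.1.2)%:~R, v.1.2%:~R, v.2%:~R)%R.
pose lift (t : T) : pt := ((t.1.1 : nat)%:Z + (t.1.2 : nat)%:Z, (t.1.2 : nat)%:Z, (t.2 : nat)%:Z)%R.
have projP v w : proj v = proj w <-> eqv Q L K v w.
  split=> [[e1 e2 e3] | [d1 d2 d3]].
    by split; [apply/(intr_Zp_eq _ _ Q_gt1) | apply/(intr_Zp_eq _ _ L_gt1)
             | apply/(intr_Zp_eq _ _ K_gt1)].
  by congr (_, _, _); [apply/(intr_Zp_eq _ _ Q_gt1) | apply/(intr_Zp_eq _ _ L_gt1)
             | apply/(intr_Zp_eq _ _ K_gt1)].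
have liftK : cancel lift proj.
  by case=> [[w j] k]; rewrite /proj /lift /= addrK -!pmulrn !natr_Zp.
have al_be := albe; have alphaX' := alphaX; rewrite def_al in alphaX'.
have [X XE] : exists X : {perm T}, forall v, X (proj v) = proj (Xmap s gam 1 v).
  apply: (lift_perm_exists liftK (f' := Xmap s gam (-1))) => v.
    by move=> w /projP vw; apply/projP/Xmap_eqv.
  (* The step law at t = -1 makes [Xmap (-1)] a right inverse of [Xmap 1]. *)
  rewrite -[in RHS](Xmap0 s gam v); apply/esym/projP.
  exact: (@XmapS s Q L K gam s3Q s2K LQ (-1) v).
have [Y YE] : exists Y : {perm T}, forall v, Y (proj v) = proj (Ymap v).
  apply: (lift_perm_exists liftK (f' := fun v => (v.1.1, v.1.2 - 1, v.2)%R)) => v.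
    by move=> w /projP vw; apply/projP/Ymap_eqv.
  by rewrite /Ymap /= subrK; case: v => [[]].
have [Z ZE] : exists Z : {perm T}, forall v, Z (proj v) = proj (Zmap x be v).
  apply: (lift_perm_exists liftK
            (f' := fun v => (be * v.1.1, (1 + x) * v.1.2, v.2 - 1)%R)) => v.
    by move=> w /projP vw; apply/projP/Zmap_eqv.
  exact/projP/ZZmap.
have projK t : exists v, t = proj v by exists (lift t); rewrite liftK.
have YnE r v : (Y ^+ r) (proj v) = proj (iter r Ymap v).
  by rewrite perm_expgE; elim: r => //= r ->; rewrite YE.
have ZnE r v : (Z ^+ r) (proj v) = proj (iter r (Zmap x be) v).
  by rewrite perm_expgE; elim: r => //= r ->; rewrite ZE.
have XzE z v : (zexpg X z) (proj v) = proj (Xmap s gam z v).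
  rewrite -{1}(Xmap0 s gam v).
  apply: (zexpg_orbit (u := fun z => proj (Xmap s gam z v))) => {}z.
  by rewrite XE; apply/esym/projP; exact: (@XmapS s Q L K gam).
have YzE z v : (zexpg Y z) (proj v) = proj (v.1.1, v.1.2 + z, v.2)%R.
  have := @zexpg_orbit _ Y (fun z => proj (v.1.1, v.1.2 + z, v.2)%R).
  rewrite /= addr0; case: v => [[i j] k] /= -> // {}z.
  by rewrite YE /Ymap /= addrA.
exists T, X, Y, Z; split.
  split.
  - apply: (mulgI Z); rewrite -conjgC; apply/permP => t.
    have [v ->] := projK t.
    by rewrite !permM XE !ZE XzE def_al; apply/projP; exact: XZmap.
  - rewrite conjgE invgK mulgA; apply: (canLR (mulgK Z)); apply/permP => t.
    have [v ->] := projK t.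
    by rewrite !permM YzE !ZE YE def_al; apply/projP; exact: YZmap.
  - apply: (mulgI (Y * X)); rewrite -commgC; apply/permP => t.
    have [v ->] := projK t.
    by rewrite !permM XE !YE XE ZnE; apply/esym/projP; exact: XYmap.
set G := <<_>>; pose o := proj (0, 0, 0)%R.
have [XG YG ZG] : [/\ X \in G, Y \in G & Z \in G].
  by split; apply: mem_gen; rewrite inE !in_cons eqxx ?orbT.
have cardT : #|{: T}| = (p ^ (7 * h + 4 * n))%N.
  rewrite !card_prod !card_ord !Zp_cast // -!expnD; congr (_ ^ _)%N.
  by rewrite /m; clear; lia.
have orbT : orbit 'P G o = [set: T].
  apply/setP => t; rewrite inE.
  have [w [j [k ->]]] : exists i j k : nat, t = proj (i%:Z, j%:Z, k%:Z)%R.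
    case: t => [[w j] k]; exists (w + j)%N, j, k.
    by rewrite /proj /= PoszD addrK -!pmulrn !natr_Zp.
  apply/orbitP; exists (Z ^+ k * X ^+ w * Y ^+ j).
    by rewrite !groupM ?groupX.
  rewrite /= apermE !permM ZnE Zmap_iter /= !mulr0 add0r.
  rewrite -[X ^+ w]/(zexpg X w) -[Y ^+ j]/(zexpg Y j) XzE YzE; congr proj.
  by rewrite /Xmap /Ipol /Jpol /Kpol /=; congr (_, _, _); ring.
by rewrite -cardT -cardsT -orbT dvdn_orbit.
Qed.

End Model.

(** * Power relations *)

Section TSum.

Local Open Scope nat_scope.

(** Up to the factor e, the exponent collected in [a^k, b]: the step from t to t + 1 creates a^(-e
    t), and moving it to the right of c^t multiplies its exponent by (1 + e)^t. *)
Definition Tsum (e k : nat) : nat := \sum_(t < k) t * (1 + e) ^ t.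

Lemma TsumS e k : Tsum e k.+1 = Tsum e k + k * (1 + e) ^ k.
Proof. by rewrite /Tsum big_ord_recr. Qed.

Lemma expn_1D2 (e t : nat) : exists r, (1 + e) ^ t = 1 + e * t + e ^ 2 * r.
Proof.
elim: t => [|t [r IHt]]; first by exists 0; rewrite !muln0.
by exists (t + r + e * r); rewrite expnS IHt; ring.
Qed.

(** To first order in e, the sum is that of t plus e times that of t^2; the factor 6 clears both
    denominators. *)
Lemma Tsum_formula e k :
  exists r, 6 * Tsum e k.+1 = k * k.+1 * (3 + e * (2 * k + 1)) + 6 * e ^ 2 * r.
Proof.
elim: k => [|k [r IHk]]; first by exists 0; rewrite /Tsum big_ord1 !muln0 mul0n.
have [r' hr'] := expn_1D2 e k.+1.
by exists (r + k.+1 * r'); rewrite TsumS mulnDr IHk hr'; ring.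
Qed.

Variables (p m : nat).
Hypotheses (p_pr : prime p) (p_odd : odd p) (m_gt0 : 0 < m).

Lemma p_coprime2 k : coprime (p ^ k) 2.
Proof. by rewrite coprimeXl // coprimen2. Qed.

(** For p = 3 the factor 6 is not prime to p, but 3 | e allows cancelling 3, and the factor 2 that
    remains is. *)
Lemma Tsum_formula3 e k : 3 %| e -> exists r,
  2 * Tsum e k.+1 = k * k.+1 * (1 + e %/ 3 * (2 * k + 1)) + 2 * e ^ 2 * r.
Proof.
move=> /dvdnP[e1 ->]; have [r hr] := Tsum_formula (e1 * 3) k; exists r.
apply/eqP; rewrite mulnK // -(eqn_pmul2l (isT : 0 < 3)).
have -> : 3 * (2 * Tsum (e1 * 3) k.+1) = 6 * Tsum (e1 * 3) k.+1 by ring.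
by rewrite hr; apply/eqP; ring.
Qed.

Lemma p_coprime6 k : p != 3 -> coprime (p ^ k) 6.
Proof.
move=> p_neq3; rewrite (coprimeMr _ 2 3) p_coprime2 coprimeXl //.
by rewrite prime_coprime // dvdn_prime2.
Qed.

Lemma dvdn_Tsum e k d : p ^ m %| e -> d <= 2 * m -> p ^ d %| k ->
  p ^ d %| Tsum e k.
Proof.
move=> pm_e d_le pd_k; case: k pd_k => [|k] pd_k; first by rewrite /Tsum big_ord0.
have pd_e2 : p ^ d %| e ^ 2.
  by apply: dvdn_trans (dvdn_exp2l _ d_le) _; rewrite mulnC expnM dvdn_exp2r.
have [p3 | p_neq3] := eqVneq p 3; last first.
  have [r hr] := Tsum_formula e k.
  rewrite -(Gauss_dvdr _ (p_coprime6 d p_neq3)) hr.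
  by rewrite dvdn_add // dvdn_mulr // dvdn_mull.
have e3 : 3 %| e by rewrite -p3 (dvdn_trans _ pm_e) // dvdn_exp.
have [r hr] := Tsum_formula3 k e3.
rewrite -(Gauss_dvdr _ (p_coprime2 d)) hr.
by rewrite dvdn_add // dvdn_mulr // dvdn_mull.
Qed.

(** As h <= m, e^2 is divisible by p^(h+1), so the leading term x (x+1) (3 + e (2x+1)) decides. Its
    factor x + 1 is prime to p, and so is the last factor unless p = 3. *)
Lemma Tsum_val e x h : p ^ m %| e -> 0 < h <= m -> p ^ h %| x ->
    ~~ (p ^ h.+1 %| x) -> (p = 3 -> (1 + e) %% 9 <> 7) ->
  exists2 t, Tsum e x.+1 = p ^ h * t & coprime p t.
Proof.
move=> pm_e /andP[h_gt0 h_le] /dvdnP[x0 def_x] x_max e_mod.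
have ph_gt0 : 0 < p ^ h by rewrite expn_gt0 prime_gt0.
have p_x0 : ~~ (p %| x0).
  by apply: contra x_max => ?; rewrite def_x expnS dvdn_mul.
have p_e : p %| e by rewrite (dvdn_trans _ pm_e) // dvdn_exp.
have p_x : p %| x by rewrite def_x dvdn_mull // dvdn_exp.
have p_x1 : ~~ (p %| x.+1).
  by rewrite -addn1 dvdn_addr // dvdn1 neq_ltn prime_gt1 ?orbT.
have [e2 def_e2] : exists e2, e ^ 2 = p ^ h * (p * e2).
  have /dvdnP[u hu] := p_e.
  have /dvdnP[v hv] : p ^ h %| e by rewrite (dvdn_trans _ pm_e) // dvdn_exp2l.
  by exists (u * v); rewrite -mulnn {1}hv hu; ring.
have [p3 | p_neq3] := eqVneq p 3; last first.
  have [r hr] := Tsum_formula e x.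
  have ph_T : p ^ h %| Tsum e x.+1.
    rewrite -(Gauss_dvdr _ (p_coprime6 h p_neq3)) hr def_e2 def_x.
    apply: dvdn_add; apply: dvdn_mulr; last by apply/dvdn_mull/dvdn_mulr.
    by apply/dvdn_mulr/dvdn_mull.
  have /dvdnP[t def_t] := ph_T; exists t; first by rewrite mulnC.
  rewrite prime_coprime //; apply/negP => p_t.
  have hr' : 6 * t = x0 * x.+1 * (3 + e * (2 * x + 1)) + p * (6 * e2 * r).
    apply/eqP; rewrite -(eqn_pmul2l ph_gt0); apply/eqP.
    transitivity (6 * Tsum e x.+1); first by rewrite def_t; ring.
    by rewrite hr def_e2 {1}def_x; ring.
  have : p %| x0 * x.+1 * (3 + e * (2 * x + 1)).
    by rewrite -(@dvdn_addl (p * (6 * e2 * r))) ?dvdn_mulr // -hr' dvdn_mull.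
  rewrite !Euclid_dvdM // (negPf p_x0) (negPf p_x1) /= dvdn_addl ?dvdn_mulr //.
  by rewrite dvdn_prime2 // (negPf p_neq3).
have e3 : 3 %| e by rewrite -p3.
have [r hr] := Tsum_formula3 x e3.
have ph_T : p ^ h %| Tsum e x.+1.
  rewrite -(Gauss_dvdr _ (p_coprime2 h)) hr def_e2 def_x.
  apply: dvdn_add; apply: dvdn_mulr; last by apply/dvdn_mull/dvdn_mulr.
  by apply/dvdn_mulr/dvdn_mull.
have /dvdnP[t def_t] := ph_T; exists t; first by rewrite mulnC.
rewrite prime_coprime //; apply/negP => p_t.
have hr' : 2 * t = x0 * x.+1 * (1 + e %/ 3 * (2 * x + 1)) + p * (2 * e2 * r).
  apply/eqP; rewrite -(eqn_pmul2l ph_gt0); apply/eqP.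
  transitivity (2 * Tsum e x.+1); first by rewrite def_t; ring.
  by rewrite hr def_e2 {1}def_x; ring.
have : p %| x0 * x.+1 * (1 + e %/ 3 * (2 * x + 1)).
  by rewrite -(@dvdn_addl (p * (2 * e2 * r))) ?dvdn_mulr // -hr' dvdn_mull.
rewrite !Euclid_dvdM // (negPf p_x0) (negPf p_x1) /=.
have /dvdnP[x3 def_x3] := p_x; have /dvdnP[e1 def_e1] := e3.
(* Modulo 3 the remaining factor is 1 + e/3, which vanishes exactly when 1 + e is 7 modulo 9. *)
have := e_mod p3; rewrite def_x3 def_e1 p3 mulnK //; clear; lia.
Qed.

End TSum.

Section PowerRelations.

Variable gT : finGroupType.
Implicit Types a b c y z : gT.

Lemma conjg_exp_iter a c r k : a ^ c = a ^+ r -> a ^ (c ^+ k) = a ^+ (r ^ k)%N.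
Proof.
move=> ac; elim: k => [|k IHk]; first by rewrite expg0 conjg1 expn0 expg1.
by rewrite expgS conjgM ac conjXg IHk -expgM -expnSr.
Qed.

Lemma commXg_Tsum a b c e k : c = [~ a, b] -> a ^ c = a ^+ (1 + e) ->
  [~ a ^+ k, b] = c ^+ k * a ^- (e * Tsum e k).
Proof.
move=> def_c ac; elim: k => [|k IHk].
  by rewrite /Tsum big_ord0 muln0 !expg0 comm1g invg1 mulg1.
rewrite expgS commMgJ -def_c IHk TsumS.
have -> : c ^ (a ^+ k) = c * a ^- (e * k).
  rewrite conjgE mulgA [_ * c]conjgC conjVg conjXg ac -!mulgA; congr (_ * _).
  rewrite -expgM mulnDl mul1n expgD invMg -mulgA [_^-1 * a ^+ k]mulVg mulg1.
  by [].
have a_ck : a ^- (e * k) * c ^+ k = c ^+ k * a ^- ((1 + e) ^ k * (e * k)).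
  by rewrite conjgC conjVg conjXg (conjg_exp_iter _ ac) -expgM.
rewrite -mulgA (mulgA (a ^- _)) a_ck -mulgA mulgA -expgS -invMg -expgD.
by congr (_ * a ^- _); rewrite mulnDr; ring.
Qed.

End PowerRelations.

Lemma p_elt_expg_coprime (gT : finGroupType) (p : nat) (y : gT) (k u : nat) :
  prime p -> p.-elt y -> coprime p u -> y ^+ (k * u) = 1 -> y ^+ k = 1.
Proof.
move=> p_pr p_y co_pu /eqP; rewrite -order_dvdn => dv.
apply/eqP; rewrite -order_dvdn.
have /p_natP[r def_r] : p.-nat #[y] by [].
by rewrite -(@Gauss_dvdl _ _ u) // def_r coprimeXl.
Qed.

Lemma coprime_inv_modn (N t : nat) : coprime N t -> 0 < t -> exists u, t * u = 1 %[mod N].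
Proof.
move=> co_Nt t_gt0; have [u v uv _] := egcdnP N t_gt0.
exists u; rewrite mulnC uv -[1%N in RHS]add0n -(eqP co_Nt) [gcdn t N]gcdnC.
by rewrite -modnDml modnMl.
Qed.

Section CentralPowers.

Variables (gT : finGroupType) (a b z : gT) (p x e P h : nat).
Let c := [~ a, b].
Let al := x.+1.
Hypotheses (p_pr : prime p) (p_odd : odd p).
Hypotheses (p_a : p.-elt a) (p_b : p.-elt b).
Hypotheses (az : a ^ z = a ^+ al) (bz : (b ^+ al) ^ z = b) (cz : c ^ z = c).
Hypotheses (ac : a ^ c = a ^+ (1 + e)) (bc : b ^ c^-1 = b ^+ (1 + e)).
Hypotheses (p_e : p %| e) (p_x : p %| x).
Variable x0 : nat.
Hypotheses (def_x : x = (p ^ h * x0)%N) (co_px0 : coprime p x0).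
Variable t : nat.
Hypotheses (wP : (e * Tsum e al = P * t)%N) (co_pt : coprime p t) (t_gt0 : 0 < t).
Hypothesis PT : (P * p ^ h %| e * Tsum e P)%N.

Let co_al : coprime p al.
Proof. by rewrite prime_coprime // /al -addn1 dvdn_addr // dvdn1 neq_ltn prime_gt1 ?orbT. Qed.

(* With w = e * Tsum e al, conjugating [b^al, a] = c^-al b^-w by z gives
   [b, a^al] = a^w c^-al. *)
Lemma expg_conj_swap :
  a ^+ (e * Tsum e al) = ((b ^- (e * Tsum e al)) ^ z) ^ (c ^+ al).
Proof.
have ba : [~ b, a] = c^-1 by rewrite -invgR.
have h1 := commXg_Tsum al (erefl c) ac.
have h2 : [~ b ^+ al, a] = (c^-1) ^+ al * b ^- (e * Tsum e al).
  exact: commXg_Tsum (esym ba) bc.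
have := congr1 (conjg^~ z) h2; rewrite conjRg bz az -invgR h1 conjMg invMg invgK.
rewrite conjXg conjVg cz expVgn => h3.
by rewrite [RHS]conjgE mulgA -h3 mulgKV.
Qed.

(** The exponent s is an inverse of r modulo the order of y. The relations for b only give b as a
    conjugate of one of its powers, and this turns them around. *)
Lemma conj_expg_exists (y w : gT) (r : nat) :
  coprime p r -> p.-elt y -> (y ^+ r) ^ w = y -> exists s, y ^ w = y ^+ s.
Proof.
move=> co_pr p_y yw.
have /p_natP[k def_k] : p.-nat #[y] by [].
have co_yr : coprime #[y] r by rewrite def_k coprimeXl.
have r_gt0 : 0 < r.
  by case: r co_pr {yw co_yr} => //; rewrite /coprime gcdn0; have := prime_gt1 p_pr; case: p => [|[]].
have [s rs] := coprime_inv_modn co_yr r_gt0; exists s.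
rewrite -{2}yw conjXg -expgM; apply/esym/eqP.
by rewrite -{2}[y ^ w]expg1 eq_expg_mod_order orderJ rs.
Qed.

(** After removal of the unit t, [expg_conj_swap] makes a^P conjugate to b^(-P) by an element
    normalising <b>. So a^P lies in <b^P>, and as the orders agree both generate the same group,
    which commutes with a and b. The conjugation by c^al thus disappears, and a second use of z
    gives a^(P al^2) = a^P. Now al^2 - 1 = x (al + 1), where al + 1 = x + 2 is prime to the odd p,
    so its p-part is p^h. *)
Lemma central_powers :
  [/\ a ^+ (P * p ^ h) = 1, a ^+ P * b ^+ P = 1, b ^+ (P * p ^ h) = 1,
      c ^+ P = 1 & a ^+ P \in 'C[b]].
Proof.
set ya := a ^+ P; set yb := b ^+ P.
have [bz' bzE] : exists r, b ^ z = b ^+ r by apply: conj_expg_exists co_al p_b bz.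
have [bc' bcE] : exists r, b ^ (c ^+ al) = b ^+ r.
  suffices [r bcr] : exists r, b ^ c = b ^+ r by exists (r ^ al)%N; apply: conjg_exp_iter.
  apply: (@conj_expg_exists _ _ (1 + e)) => //; last by rewrite -bc conjgKV.
  by rewrite prime_coprime // dvdn_addl // dvdn1 neq_ltn prime_gt1 ?orbT.
(* One inverse of t, taken modulo a large power of p, serves for both a and b. *)
have [t' tt'a tt'b] : exists2 t', t * t' = 1 %[mod #[a]] & t * t' = 1 %[mod #[b]].
  have /p_natP[ka def_ka] : p.-nat #[a] by [].
  have /p_natP[kb def_kb] : p.-nat #[b] by [].
  have [|t' tt'] := @coprime_inv_modn (p ^ (ka + kb)) t _ t_gt0; first exact: coprimeXl.
  have tt'E k : k <= ka + kb -> t * t' = 1 %[mod p ^ k].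
    move=> k_le; have pk := dvdn_exp2l p k_le; rewrite -(modn_dvdm _ pk) tt'.
    by rewrite modn_dvdm.
  by exists t'; rewrite ?def_ka ?def_kb tt'E ?leq_addr ?leq_addl.
have expg_tt' y : t * t' = 1 %[mod #[y]] -> y ^+ (P * t * t') = y ^+ P.
  move=> tt'; rewrite -mulnA mulnC expgM; congr (_ ^+ _).
  by rewrite -[RHS]expg1; apply/eqP; rewrite eq_expg_mod_order tt'.
have ya_yb : ya = ((yb ^ z) ^ (c ^+ al))^-1.
  have := congr1 (fun y => y ^+ t') expg_conj_swap.
  rewrite /= wP -expgM expg_tt' // -/ya => ->.
  by rewrite -!conjXg expVgn -expgM expg_tt' // !conjVg.
have b_yb : commute b yb by apply: commuteX.
have ya_b : ya \in <[b]>.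
  by rewrite ya_yb groupV conjXg bzE !conjXg bcE !groupX ?cycle_id.
have ybzE : yb ^ z = yb ^+ bz' by rewrite conjXg bzE -!expgM mulnC.
have ybcE : yb ^ (c ^+ al) = yb ^+ bc' by rewrite conjXg bcE -!expgM mulnC.
have ya_in_yb : ya \in <[yb]>.
  by rewrite ya_yb groupV ybzE conjXg ybcE; do 2!apply: groupX; apply: cycle_id.
have yb_in_ya : yb \in <[ya]>.
  suffices /eqP -> : <[ya]> == <[yb]> by exact: cycle_id.
  rewrite eqEcard cycle_subG ya_in_yb -!orderE.
  by rewrite ya_yb orderV !orderJ leqnn.
have yb_a : commute a yb.
  have : yb \in <[a]> by apply: subsetP yb_in_ya; rewrite cycle_subG groupX ?cycle_id.
  by case/cycleP=> i ->; apply: commuteX.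
have yb_c : commute yb c.
  have /commgP/eqP : commute yb [~ a, b].
    by rewrite commgEl conjgE; do ![apply: commuteM | apply: commuteV | exact: commute_sym].
  by move/eqP/commgP.
have ya_ybz : ya = (yb ^ z)^-1.
  rewrite ya_yb; congr _^-1.
  rewrite ybzE.
  apply/conjg_fixP/commgP/commuteX/commute_sym/commuteX.
  exact/commute_sym.
have yb_ya : yb = ya ^- al.
  have : (yb ^ z) ^+ al = yb by rewrite -!conjXg -!expgM mulnC expgM conjXg bz.
  by move=> <-; rewrite ya_ybz expVgn invgK.
have ya_ph : ya ^+ (p ^ h) = 1.
  have p_ya : p.-elt ya by apply: p_eltX.
  apply: (@p_elt_expg_coprime _ p _ _ (x0 * al.+1)) => //.
    rewrite coprimeMr co_px0 prime_coprime // /al -addn2 dvdn_addr //.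
    by rewrite dvdn_prime2 //; apply: contraL p_odd => /eqP->.
  have : ya ^+ (al * al) = ya.
    apply: invg_inj; rewrite {2}ya_ybz invgK yb_ya conjVg conjXg.
    by congr _^-1; rewrite {2}/ya conjXg az -!expgM; congr (_ ^+ _); ring.
  rewrite mulnA -def_x (_ : al * al = x * al.+1 + 1)%N; last by rewrite /al; ring.
  by rewrite expgD expg1 => /(canRL (mulgK _)); rewrite mulgV.
have ya_al : ya ^+ al = ya.
  by rewrite /al expgS def_x expgM ya_ph expg1n mulg1.
have yab : ya * yb = 1 by rewrite yb_ya ya_al mulgV.
split=> //.
- by rewrite expgM.
- by rewrite expgM -/yb yb_ya ya_al expVgn ya_ph invg1.
(* The trivial commutator [a^P, b] is c^P times a power of a whose exponent is, by [PT], a multiple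
   of P p^h. *)
- have : [~ ya, b] = 1.
    by apply/eqP/commgP; case/cycleP: ya_b => i ->; apply/commute_sym/commuteX.
  rewrite (commXg_Tsum P (erefl c) ac).
  have /dvdnP[i ->] := PT; rewrite mulnC expgM [a ^+ _]expgM ya_ph expg1n.
  by rewrite invg1 mulg1.
- apply/cent1P; case/cycleP: ya_b => i ->; exact/commute_sym/commuteX.
Qed.

End CentralPowers.

(** * Lifting the exponent for an odd prime *)

Section LiftingTheExponent.

Local Open Scope nat_scope.

Lemma expn_1D3 (x t : nat) :
  exists r, (1 + x) ^ t = 1 + t * x + 'C(t, 2) * x ^ 2 + x ^ 3 * r.
Proof.
elim: t => [|t [r IHt]]; first by exists 0; rewrite !muln0.
by exists ('C(t, 2) + r + x * r); rewrite expnS IHt binS bin1; ring.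
Qed.

Variable p : nat.
Hypotheses (p_pr : prime p) (p_odd : odd p).

Lemma logn_mul1D y z : p %| z -> 0 < y -> logn p (y * (1 + z)) = logn p y.
Proof.
move=> p_z y_gt0; rewrite lognM // [logn p (1 + z)]logn_coprime ?addn0 //.
by rewrite prime_coprime // dvdn_addl // dvdn1 neq_ltn prime_gt1 ?orbT.
Qed.

(** Since p is odd it divides the binomial coefficient of x^2, and p x dominates all later terms. *)
Lemma logn_exp1D_p x : p %| x -> 0 < x -> logn p ((1 + x) ^ p - 1) = (logn p x).+1.
Proof.
move=> p_x x_gt0; have [r hr] := expn_1D3 x p; have /dvdnP[x1 def_x] := p_x.
have p_gt0 := prime_gt0 p_pr.
have /dvdnP[c2 def_c2] : p %| 'C(p, 2).
  apply: prime_dvd_bin => //=; rewrite ltn_neqAle prime_gt1 // andbT.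
  by apply: contraL p_odd => /eqP <-.
rewrite hr def_c2 -!addnA addKn.
have -> : p * x + (c2 * p * x ^ 2 + x ^ 3 * r) = (p * x) * (1 + x * (c2 + x1 * r)).
  have -> : x ^ 3 * r = x ^ 2 * (x1 * p) * r by rewrite -def_x; ring.
  by ring.
by rewrite logn_mul1D ?muln_gt0 ?p_gt0 ?dvdn_mulr // lognM // (logn_prime p p_pr) eqxx.
Qed.

Lemma logn_exp1D x k : p %| x -> 0 < x -> 0 < k ->
  logn p ((1 + x) ^ k - 1) = logn p x + logn p k.
Proof.
have [n] := ubnP k; elim: n k x => // n IHn k x k_le p_x x_gt0 k_gt0.
have p_gt0 := prime_gt0 p_pr; have p_gt1 := prime_gt1 p_pr.
have [/dvdnP[k' def_k] | p_k] := boolP (p %| k); last first.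
  have [r hr] := expn_1D2 x k; rewrite hr -addnA addKn.
  have -> : x * k + x ^ 2 * r = x * (k + x * r) by ring.
  have -> : logn p k = 0 by rewrite logn_coprime // prime_coprime.
  rewrite lognM // ?addn_gt0 ?k_gt0 //; congr (_ + _).
  by rewrite logn_coprime // prime_coprime // dvdn_addl // dvdn_mulr.
have k'_gt0 : 0 < k' by move: k_gt0; rewrite def_k; case: (k').
have [y def_y] : exists y, (1 + x) ^ p = 1 + y.
  by have [r ->] := expn_1D3 x p; exists (p * x + 'C(p, 2) * x ^ 2 + x ^ 3 * r); rewrite !addnA.
have logn_y : logn p y = (logn p x).+1.
  by have := logn_exp1D_p p_x x_gt0; rewrite def_y addKn.
have y_gt0 : 0 < y by case: (posnP y) logn_y => // ->; rewrite logn0.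
rewrite def_k [k' * p]mulnC expnM def_y IHn //.
- by rewrite logn_y lognM // (logn_prime p p_pr) eqxx addSnnS.
- by apply: leq_trans (_ : k <= n); rewrite // def_k ltn_Pmulr.
- have : 0 < logn p y by rewrite logn_y.
  by rewrite logn_gt0 mem_primes => /and3P[].
Qed.

End LiftingTheExponent.

(** * Counting normal forms; generators and central series *)

Lemma surj_card_unique (T : finType) (gT : finType) (A : {set gT}) (f : T -> gT) :
    (forall u, u \in A -> exists t, u = f t) -> #|T| <= #|A| ->
  injective f /\ (forall u, u \in A -> exists! t, u = f t).
Proof.
move=> f_surj cardTA.
have A_im : A \subset f @: [set: T].
  by apply/subsetP=> u /f_surj[t ->]; rewrite imset_f ?inE.
have f_inj : injective f.
  have /imset_injP f_injT : #|f @: [set: T]| == #|[set: T]|.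
    by rewrite eqn_leq leq_imset_card cardsT (leq_trans cardTA) // subset_leq_card.
  by move=> t t'; apply: f_injT; rewrite inE.
split=> // u /f_surj[t def_u]; exists t; split=> // t'.
by rewrite def_u => /f_inj.
Qed.

(** Multiples of [N2] in the exponent of b are absorbed by a through b^N2 = a^(-N2); only a needs
    the longer range [N1]. *)
Lemma factor_normal_form (gT : finGroupType) (a b c u : gT) (N1 N2 N3 : nat) :
    0 < N1 -> 0 < N2 -> 0 < N3 ->
    a ^+ N1 = 1 -> a ^+ N2 * b ^+ N2 = 1 -> c ^+ N3 = 1 ->
    u \in <[a]> * (<[b]> * <[c]>) ->
  exists e : 'I_N1 * 'I_N2 * 'I_N3, u = a ^+ e.1.1 * b ^+ e.1.2 * c ^+ e.2.
Proof.
move=> N1_gt0 N2_gt0 N3_gt0 a1 ab1 c1.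
case/mulsgP=> _ _ /cycleP[i ->] /mulsgP[_ _ /cycleP[j ->] /cycleP[k ->] ->] ->.
have bN : b ^+ N2 = a ^- N2 by apply/esym/mulg1_eq.
have : a ^+ i * b ^+ (j %/ N2 * N2) \in <[a]>.
  by rewrite groupM ?mem_cycle // mulnC expgM bN !(groupX, groupV) ?cycle_id.
case/cycleP=> i' def_i'.
exists (Ordinal (ltn_pmod i' N1_gt0), Ordinal (ltn_pmod j N2_gt0), Ordinal (ltn_pmod k N3_gt0)).
by rewrite /= (expg_mod _ a1) (expg_mod _ c1) -def_i' {1}(divn_eq j N2) expgD !mulgA.
Qed.

Lemma commuting_gen3P (gT : finGroupType) (x y z u : gT) :
    commute x y -> commute x z -> commute y z ->
  u \in <<[set x; y; z]>> -> exists i j k, u = x ^+ i * y ^+ j * z ^+ k.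
Proof.
move=> xy xz yz.
have cyx : <[y]> \subset 'C(<[x]>) by rewrite cent_cycle cycle_subG; apply/cent1P/esym.
have czxy : <[z]> \subset 'C(<[x]> <*> <[y]>).
  by rewrite centY !cent_cycle cycle_subG inE; apply/andP; split; apply/cent1P/esym.
have gen_sub : <<[set x; y; z]>> \subset <[x]> <*> <[y]> <*> <[z]>.
  rewrite gen_subG; apply/subsetP=> v; rewrite !inE -orbA => /or3P[] /eqP->.
  - by rewrite !mem_gen // !inE mem_gen ?orbT // !inE cycle_id.
  - by rewrite mem_gen // inE mem_gen // inE cycle_id orbT.
  - by rewrite mem_gen // inE cycle_id orbT.
move/(subsetP gen_sub); rewrite (cent_joinEr czxy) /= (cent_joinEr cyx).
case/mulsgP=> _ _ /mulsgP[_ _ /cycleP[i ->] /cycleP[j ->] ->] /cycleP[k ->] ->.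
by exists i, j, k.
Qed.

Lemma gen2_norm (gT : finGroupType) (a b : gT) (S : {set gT}) :
    (forall s, s \in S -> s ^ a \in <<S>> /\ s ^ b \in <<S>>) ->
  <<[set a; b]>> \subset 'N(<<S>>).
Proof.
move=> S_ab; rewrite gen_subG; apply/subsetP=> u /set2P u_ab.
rewrite inE -genJ gen_subG; apply/subsetP=> _ /imsetP[s /S_ab[sa sb] ->].
by case: u_ab => ->.
Qed.

Lemma ucnS_gen (gT : finGroupType) (G : {group gT}) (S : {set gT}) n x :
    G :=: <<S>> -> x \in G -> (forall s, s \in S -> [~ x, s] \in 'Z_n(G)) ->
  x \in 'Z_(n.+1)(G).
Proof.
move=> defG Gx xS; have nZG := ucn_norm n G; have Nx := subsetP nZG x Gx.
rewrite ucnSn mem_morphpre // inE mem_quotient //=.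
have sSN : S \subset 'N('Z_n(G)) by rewrite (subset_trans _ nZG) // defG subset_gen.
have -> : G / 'Z_n(G) = <<S / 'Z_n(G)>> by rewrite -quotient_gen // -defG.
rewrite cent_gen.
apply/centP=> _ /morphimP[s Ns Ss ->]; apply/commgP.
by rewrite -morphR //= coset_id // xS.
Qed.

(** * The Sylow subgroup of the Macdonald group *)

Section MacdonaldGroup.

Variables (gT : finGroupType) (J : {group gT}) (a b : gT) (p m e : nat).
Let c := [~ a, b].
Hypotheses (p_pr : prime p) (p_odd : odd p) (m_gt0 : 0 < m).
Hypotheses (e_gt0 : 0 < e) (logn_e : logn p e = m) (e_mod : p = 3 -> (1 + e) %% 9 <> 7).
Hypotheses (pJ : p.-group J) (defJ : J :=: <<[set a; b]>>).
Hypotheses (ac : a ^ c = a ^+ (1 + e)) (bc : b ^ c^-1 = b ^+ (1 + e)).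

Local Notation pm := (p ^ m)%N.
Local Notation p2m := (p ^ (2 * m))%N.
Local Notation p3m := (p ^ (3 * m))%N.
Let y := a ^+ p2m.

Let Ja : a \in J. Proof. by rewrite defJ mem_gen // !inE eqxx. Qed.
Let Jb : b \in J. Proof. by rewrite defJ mem_gen // !inE eqxx orbT. Qed.
Let Jc : c \in J. Proof. by rewrite groupR ?Ja ?Jb. Qed.

Lemma pm_e : pm %| e. Proof. by rewrite -logn_e pfactor_dvdnn. Qed.

Lemma p_dvd_e : p %| e. Proof. exact: dvdn_trans (dvdn_exp m_gt0 (dvdnn p)) pm_e. Qed.

(** This is [central_powers] with z = c and x = e, so that h = m, and w = e * Tsum e (1 + e) has
    p-part p^(2m). *)
Lemma macdonald_powers : [/\ y * b ^+ p2m = 1, a ^+ p3m = 1, b ^+ p3m = 1,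
  c ^+ p2m = 1 & commute y b].
Proof.
have e_max : ~~ (p ^ m.+1 %| e) by rewrite pfactor_dvdn // logn_e ltnn.
have [t Tt co_pt] : exists2 t, Tsum e e.+1 = (pm * t)%N & coprime p t.
  by apply: (@Tsum_val p m) => //; rewrite ?pm_e // m_gt0 leqnn.
have /dvdnP[e0 he0] := pm_e.
have t_gt0 : 0 < t by case: t co_pt {Tt} => //; rewrite /coprime gcdn0; case: p p_pr => [|[]].
have co_e0 : coprime p e0.
  rewrite prime_coprime //; apply: contra e_max => ?.
  by rewrite he0 expnS dvdn_mul.
have co_pte : coprime p (e0 * t) by rewrite coprimeMr co_e0.
have hp2 : (p2m = pm * pm)%N by rewrite mul2n -addnn expnD.
have hp3 : (p3m = p2m * pm)%N by rewrite -expnD; congr (_ ^ _)%N; ring.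
have := @central_powers gT a b c p e e p2m m p_pr p_odd.
rewrite -!/c -hp3.
case/(_ _ _ _ _ _ _ _ p_dvd_e p_dvd_e e0 _ co_e0 (e0 * t)%N _ co_pte).
- by rewrite (mem_p_elt pJ) ?Ja.
- by rewrite (mem_p_elt pJ) ?Jb.
- by rewrite ac.
- by rewrite -bc conjgKV.
- by rewrite conjgE mulKg.
- exact: ac.
- exact: bc.
- by rewrite mulnC.
- by rewrite Tt {1}he0 hp2; ring.
- by rewrite muln_gt0 t_gt0 andbT; case: (e0) co_e0 => //; rewrite /coprime gcdn0; case: p p_pr => [|[]].
- have := @dvdn_Tsum p m p_pr p_odd m_gt0 e p2m (2 * m) pm_e (leqnn _) (dvdnn _).
  by rewrite hp3 [(p2m * _)%N]mulnC => dT; apply: dvdn_mul => //; apply: pm_e.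
by move=> h1 h2 h3 h4 /cent1P h5; split.
Qed.

Lemma a_y : commute a y. Proof. exact: commuteX. Qed.
Lemma b_y : commute b y. Proof. by case: macdonald_powers => _ _ _ _ /commute_sym. Qed.

Lemma y_pm : y ^+ pm = 1.
Proof.
case: macdonald_powers => _ a1 _ _ _; rewrite -expgM -expnD -[RHS]a1.
by congr (_ ^+ (_ ^ _)); ring.
Qed.

Lemma y_center : y \in 'Z(J).
Proof.
rewrite inE groupX ?Ja //= defJ cent_gen; apply/centP=> u /set2P[] ->.
  exact/commute_sym/a_y.
exact/commute_sym/b_y.
Qed.

Lemma exp1De k : exists s, ((1 + e) ^ k = 1 + pm * s)%N.
Proof.
have [r ->] := expn_1D2 e k; have /dvdnP[e0 ->] := pm_e.
by exists (e0 * k + e0 * (e0 * pm) * r)%N; ring.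
Qed.

Lemma conj_cV_exists k : exists s, a ^ (c ^- k) = a ^+ (1 + pm * s).
Proof.
rewrite -expVgn invg_expg -expgM; have [s def_s] := exp1De (#[c].-1 * k).
by exists s; rewrite (conjg_exp_iter _ ac) def_s.
Qed.

Lemma commg_b_a j : [~ b ^+ j, a] = c ^- j * b ^- (e * Tsum e j).
Proof.
have ba : c^-1 = [~ b, a] by rewrite invgR.
by rewrite (commXg_Tsum j ba bc) expVgn.
Qed.

Lemma commg_a_b i : pm %| i -> exists r, [~ a ^+ i, b] = c ^+ i * y ^- r.
Proof.
move=> pm_i; rewrite (commXg_Tsum i (erefl c) ac).
have pm_T := dvdn_Tsum p_pr p_odd m_gt0 pm_e (leq_pmull m (isT : 0 < 2)) pm_i.
have /dvdnP[r ->] : p2m %| e * Tsum e i.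
  by rewrite mul2n -addnn expnD dvdn_mul // pm_e.
by exists r; rewrite mulnC expgM.
Qed.

Lemma y_comm u : u \in J -> commute y u.
Proof. by have /centerP[_ yC] := y_center; exact: yC. Qed.

Lemma conj_b_aX i : pm %| i -> exists r, b ^ (a ^+ i) = y ^+ r * (b * c ^- i).
Proof.
move=> pm_i; have [r hr] := commg_a_b pm_i; exists r.
rewrite -[LHS](mulKVg b) -commgEl -invgR hr invMg invgK mulgA.
by rewrite (commuteX r b_y) -mulgA.
Qed.

Lemma c_norm_b : <[c]> \subset 'N(<[b]>).
Proof.
rewrite cycle_subG -groupV; apply/normP/eqP; rewrite eqEcard cardJg leqnn andbT.
by rewrite -genJ conjg_set1 gen_subG sub1set bc groupX ?cycle_id.
Qed.

(** The product contains 1, and it suffices that right multiplication by a and by b preserves it.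
    Multiplication by b is harmless, as <b><c> is a group. For a, crossing c^k changes the exponent
    of a by a multiple of p^m only; one factor a crosses b^j by the commutator formula, and a power
    a^i with p^m | i conjugates b to a central factor times b c^(-i). *)
Lemma macdonald_factor : J :=: <[a]> * (<[b]> * <[c]>).
Proof.
pose H := (<[b]> <*> <[c]>)%G.
have defH : <[b]> * <[c]> = H by rewrite -norm_joinEr ?c_norm_b.
have Hb j : b ^+ j \in H by rewrite mem_gen // inE mem_cycle.
have Hc j : c ^+ j \in H by rewrite mem_gen // inE mem_cycle orbT.
rewrite defH; set S := <[a]> * H.
have SA x u : x \in <[a]> -> u \in S -> x * u \in S.
  by move=> Ax /mulsgP[x' h Ax' Hh ->]; rewrite mulgA mem_mulg // groupM.
have SH u h : u \in S -> h \in H -> u * h \in S.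
  by move=> /mulsgP[x h' Ax Hh' ->] Hh; rewrite -mulgA mem_mulg // groupM.
have SP u : u \in S -> exists i j k, u = a ^+ i * (b ^+ j * c ^+ k).
  move=> /mulsgP[_ h /cycleP[i ->]]; rewrite -defH => /mulsgP[_ _ /cycleP[j ->] /cycleP[k ->] ->] ->.
  by exists i, j, k.
have HS h : h \in H -> h \in S by move=> Hh; rewrite -[h]mul1g mem_mulg // group1.
have ba_S j i : pm %| i -> b ^+ j * a ^+ i \in S.
  move=> pm_i; have [r b_ai] := conj_b_aX pm_i.
  have y_bc : commute (y ^+ r) (b * c ^- i).
    apply/commute_sym/commuteX/commute_sym/y_comm.
    by rewrite groupM ?groupV ?groupX ?Jb ?Jc.
  rewrite conjgC conjXg b_ai expgMn //; apply: (SA _ _); first exact: mem_cycle.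
  apply: (SA _ _); first by rewrite !groupX ?cycle_id.
  by apply/HS/groupX; rewrite groupM ?groupV ?(Hb 1%N).
have Sa u : u \in S -> u * a \in S.
  move=> /SP[i [j [k ->]]]; rewrite -!mulgA; apply: (SA _ _); first exact: mem_cycle.
  have [s hs] := conj_cV_exists k.
  have -> : c ^+ k * a = a ^+ (1 + pm * s) * c ^+ k by rewrite conjgCV hs.
  rewrite !mulgA; apply: (SH _ _) => //; rewrite expgD expg1 mulgA.
  have [j1 ba_j1] : exists j1, b ^+ j * a = a * (b ^+ j1 * c ^- j).
    have : (b ^- (e * Tsum e j)) ^ (c ^+ j) \in <[b]>.
      rewrite memJ_norm ?groupV ?mem_cycle //.
      by apply: (subsetP c_norm_b); rewrite mem_cycle.
    case/cycleP=> r def_r; exists (j + r)%N.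
    by rewrite conjgC conjg_mulR commg_b_a [c ^- j * _]conjgCV invgK def_r expgD !mulgA.
  rewrite ba_j1 -!mulgA [c ^- j * _]conjgCV invgK conjXg (conjg_exp_iter _ ac).
  apply: (SA _ _); first exact: cycle_id.
  rewrite mulgA; apply: (SH _ _); last by rewrite groupV.
  by rewrite -expgM; apply: ba_S; rewrite mulnCA dvdn_mulr.
have Sb u : u \in S -> u * b \in S.
  move=> /SP[i [j [k ->]]]; rewrite -!mulgA; apply: (SA _ _); first exact: mem_cycle.
  by apply: HS; rewrite !groupM ?(Hb 1%N).
apply/eqP; rewrite eqEsubset; apply/andP; split.
  apply/subsetP=> u; rewrite {1}defJ => /gen_prodgP[n [g hg ->]].
  elim: n g hg => [|n IHn] g hg; first by rewrite big_ord0 HS.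
  rewrite big_ord_recr /=.
  have := IHn (fun i => g (widen_ord (leqnSn n) i)) (fun i => hg _).
  by case/set2P: (hg ord_max) => ->; [apply: Sa | apply: Sb].
by rewrite mul_subG ?cycle_subG ?Ja //= join_subG !cycle_subG Jb Jc.
Qed.

Let p3m_e : (p3m = pm * p2m)%N.
Proof. by rewrite -expnD; congr (_ ^ _)%N; ring. Qed.

Let p2m_e : (p2m = pm * pm)%N.
Proof. by rewrite mul2n -addnn expnD. Qed.

Lemma pm_gt0 k : 0 < p ^ k. Proof. by rewrite expn_gt0 prime_gt0. Qed.

Lemma exp_pm : exists s, ((1 + e) ^ pm = 1 + p2m * s)%N.
Proof.
have := logn_exp1D p_pr p_odd p_dvd_e e_gt0 (pm_gt0 m).
rewrite logn_e pfactorK // addnn -mul2n => lg.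
have : p2m %| (1 + e) ^ pm - 1 by rewrite -lg pfactor_dvdnn.
case/dvdnP=> s hs; exists s.
by rewrite mulnC -hs subnKC // expn_gt0.
Qed.

Lemma conj_a_cpm : exists s, a ^ (c ^+ pm) = a * y ^+ s.
Proof.
have [s hs] := exp_pm; exists s.
by rewrite (conjg_exp_iter _ ac) hs expgD expg1 expgM.
Qed.

Lemma b_p2m : b ^+ p2m = y^-1.
Proof. by case: macdonald_powers => /mulg1_eq. Qed.

Lemma conj_b_cpm : exists s,
  b ^ (c ^+ pm) = b * y ^+ s /\ b ^ (c ^- pm) = b * y ^- s.
Proof.
have [s hs] := exp_pm; exists s.
have b_cV : b ^ (c ^- pm) = b * y ^- s.
  by rewrite -expVgn (conjg_exp_iter _ bc) hs expgD expg1 expgM b_p2m expVgn.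
split=> //; have := b_cV; move/(congr1 (conjg^~ (c ^+ pm))); rewrite -conjgM mulVg conjg1 conjMg.
have -> : (y ^- s) ^ (c ^+ pm) = y ^- s.
  apply/conjg_fixP/commgP/commuteX/commute_sym/commuteV/commuteX/commute_sym.
  by apply: y_comm; rewrite Jc.
by move=> {2}->; rewrite mulgKV.
Qed.

Lemma apm_cpm : commute (a ^+ pm) (c ^+ pm).
Proof.
have [s hs] := conj_a_cpm; apply/commgP/conjg_fixP; rewrite conjXg hs expgMn.
  by rewrite -expgM mulnC expgM y_pm expg1n mulg1.
by apply/commuteX/a_y.
Qed.

Lemma bpm_cpm : commute (b ^+ pm) (c ^+ pm).
Proof.
have [s [hs _]] := conj_b_cpm; apply/commgP/conjg_fixP; rewrite conjXg hs expgMn.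
  by rewrite -expgM mulnC expgM y_pm expg1n mulg1.
by apply/commuteX/b_y.
Qed.

Lemma c_pm2 : c ^+ (pm * pm) = 1.
Proof. by rewrite -p2m_e; case: macdonald_powers. Qed.

(** Conjugation by a^pm sends b to y^r b c^(-pm). In the pm-th power the commutator [c^(-pm), b] =
    y^s has exponent ['C(pm, 2)], a multiple of pm as p is odd, and y^pm = 1. *)
Lemma apm_bpm : commute (a ^+ pm) (b ^+ pm).
Proof.
have [r hr] := conj_b_aX (dvdnn pm); have [s [_ hs]] := conj_b_cpm.
apply/commute_sym/commgP/conjg_fixP; rewrite conjXg hr.
have Jbc : b * c ^- pm \in J by rewrite groupM ?groupV ?groupX ?Jb ?Jc.
rewrite expgMn; last by apply/commute_sym/commuteX/commute_sym/y_comm.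
rewrite -expgM mulnC expgM y_pm expg1n mul1g.
have bc_y : [~ c ^- pm, b] = y ^+ s.
  by rewrite commgEr conjVg hs invMg invgK mulgKV.
rewrite expMg_Rmul ?bc_y; last 2 first.
- by apply/commuteX/commute_sym/y_comm; rewrite groupV groupX ?Jc.
- exact/commuteX/b_y.
rewrite expVgn -expgM c_pm2 invg1 mulg1.
have /dvdnP[i ->] : pm %| 'C(pm, 2).
  rewrite -(Gauss_dvdr _ (p_coprime2 p_odd m)).
  by rewrite -[2%N]/(2`!)%N mulnC bin_ffact ffactnS dvdn_mulr.
by rewrite -expgM mulnA mulnC expgM y_pm expg1n mulg1.
Qed.

Lemma commg_b_aX j : pm %| j -> exists r, [~ b ^+ j, a] = c ^- j * y ^+ r.
Proof.
move=> pm_j; rewrite commg_b_a.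
have pm_T := dvdn_Tsum p_pr p_odd m_gt0 pm_e (leq_pmull m (isT : 0 < 2)) pm_j.
have /dvdnP[r ->] : p2m %| e * Tsum e j by rewrite p2m_e dvdn_mul // pm_e.
by exists r; rewrite mulnC expgM b_p2m expVgn invgK.
Qed.

(** * The upper central series of the Macdonald Sylow subgroup *)

Lemma mem_ucnS n u : u \in J -> [~ u, a] \in 'Z_n(J) -> [~ u, b] \in 'Z_n(J) ->
  u \in 'Z_(n.+1)(J).
Proof. by move=> Ju ua ub; apply: ucnS_gen defJ Ju _ => s /set2P[] ->. Qed.

Lemma y_Z1 k : y ^+ k \in 'Z_1(J).
Proof. by rewrite ucn1 groupX // y_center. Qed.

Lemma cpm_Z2 : c ^+ pm \in 'Z_2(J).
Proof.
have [s hs] := conj_a_cpm; have [r [hr _]] := conj_b_cpm.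
apply: mem_ucnS; first by rewrite groupX ?Jc.
  by rewrite -invgR commgEl hs mulKg groupV y_Z1.
by rewrite -invgR commgEl hr mulKg groupV y_Z1.
Qed.

Lemma apm_Z3 : a ^+ pm \in 'Z_3(J).
Proof.
have [r hr] := commg_a_b (dvdnn pm).
apply: mem_ucnS; first by rewrite groupX ?Ja.
  by rewrite (eqP (introT commgP _)) ?group1 //; apply/commute_sym/commuteX.
by rewrite hr groupM ?cpm_Z2 // groupV (subsetP (ucn_subS _ _)) // y_Z1.
Qed.

Lemma bpm_Z3 : b ^+ pm \in 'Z_3(J).
Proof.
have [r hr] := commg_b_aX (dvdnn pm).
apply: mem_ucnS; first by rewrite groupX ?Jb.
  by rewrite hr groupM ?groupV ?cpm_Z2 // (subsetP (ucn_subS _ _)) // y_Z1.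
by rewrite (eqP (introT commgP _)) ?group1 //; apply/commute_sym/commuteX.
Qed.

(* Ktwo and Kthree are Z_2(J) and Z_3(J); the generator 1 only makes Ktwo an
   instance of commuting_gen3P. *)
Definition Kthree := <<[set a ^+ pm; b ^+ pm; c ^+ pm]>>.
Definition Ktwo := <<[set y; c ^+ pm; 1]>>.

Lemma KthreeP u : u \in Kthree ->
  exists i j k, u = a ^+ (pm * i) * b ^+ (pm * j) * c ^+ (pm * k).
Proof.
move/(commuting_gen3P apm_bpm apm_cpm bpm_cpm) => [i [j [k ->]]].
by exists i, j, k; rewrite !expgM.
Qed.

Lemma KtwoP u : u \in Ktwo -> exists r k, u = y ^+ r * c ^+ (pm * k).
Proof.
have y_c : commute y (c ^+ pm) by apply: y_comm; rewrite groupX ?Jc.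
have y_1 : commute y 1 by apply: y_comm.
have c_1 : commute (c ^+ pm) 1 by rewrite /commute mulg1 mul1g.
move/(commuting_gen3P y_c y_1 c_1) => [i [j [k ->]]].
by exists i, j; rewrite expg1n mulg1 !expgM.
Qed.

Lemma Ktwo_y r : y ^+ r \in Ktwo. Proof. by rewrite groupX // mem_gen // !inE eqxx. Qed.
Lemma Ktwo_c : c ^+ pm \in Ktwo. Proof. by rewrite mem_gen // !inE eqxx orbT. Qed.
Lemma Kthree_a : a ^+ pm \in Kthree. Proof. by rewrite mem_gen // !inE eqxx. Qed.
Lemma Kthree_b : b ^+ pm \in Kthree. Proof. by rewrite mem_gen // !inE eqxx orbT. Qed.
Lemma Kthree_c : c ^+ pm \in Kthree. Proof. by rewrite mem_gen // !inE eqxx !orbT. Qed.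
Lemma Kthree_y r : y ^+ r \in Kthree.
Proof. by rewrite groupX // /y p2m_e expgM groupX // Kthree_a. Qed.

Lemma conj_y u : u \in J -> y ^ u = y.
Proof. by move=> Ju; apply/conjg_fixP/commgP/y_comm. Qed.

Lemma Ktwo_norm : J \subset 'N(Ktwo).
Proof.
have [s hs] := conj_a_cpm; have [r [hr _]] := conj_b_cpm.
rewrite defJ; apply: gen2_norm => u; rewrite -/Ktwo !inE -orbA => /or3P[] /eqP->.
- by rewrite !conj_y ?Ja ?Jb // (Ktwo_y 1).
- rewrite !conjg_mulR -invgR commgEl hs mulKg -[[~ _, b]]invgR commgEl hr mulKg.
  by rewrite !groupM ?groupV ?Ktwo_c ?Ktwo_y.
- by rewrite !conj1g group1.
Qed.

Lemma Kthree_norm : J \subset 'N(Kthree).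
Proof.
have [s hs] := conj_a_cpm; have [r [hr _]] := conj_b_cpm.
have [s1 hs1] := commg_a_b (dvdnn pm); have [s2 hs2] := commg_b_aX (dvdnn pm).
rewrite defJ; apply: gen2_norm => u; rewrite -/Kthree !inE -orbA => /or3P[] /eqP->.
- rewrite !conjg_mulR hs1 (eqP (introT commgP _)) ?mulg1; last exact/commute_sym/commuteX.
  by rewrite !groupM ?groupV ?Kthree_a ?Kthree_c ?Kthree_y.
- rewrite !conjg_mulR hs2 [[~ _, b]](eqP (introT commgP _)) ?mulg1; last exact/commute_sym/commuteX.
  by rewrite !groupM ?groupV ?Kthree_b ?Kthree_c ?Kthree_y.
- rewrite !conjg_mulR -invgR commgEl hs mulKg -[[~ _, b]]invgR commgEl hr mulKg.
  by rewrite !groupM ?groupV ?Kthree_c ?Kthree_y.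
Qed.

Lemma macdonald_nf u : u \in J -> exists e : 'I_p3m * 'I_p2m * 'I_p2m,
  u = a ^+ e.1.1 * b ^+ e.1.2 * c ^+ e.2.
Proof.
case: macdonald_powers => ab a1 _ c1 _ Ju.
by apply: factor_normal_form; rewrite ?pm_gt0 // -macdonald_factor.
Qed.

Lemma macdonald_card_le : #|J| <= p ^ (7 * m).
Proof.
have sJ : J \subset [set a ^+ e.1.1 * b ^+ e.1.2 * c ^+ e.2 | e : 'I_p3m * 'I_p2m * 'I_p2m].
  by apply/subsetP=> u /macdonald_nf[e' ->]; apply/imsetP; exists e'.
apply: leq_trans (subset_leq_card sJ) (leq_trans (leq_imset_card _ _) _).
rewrite cardE -cardT !card_prod !card_ord -!expnD leq_exp2l ?prime_gt1 //.
by clear; lia.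
Qed.

Hypothesis cardJ : #|J| = (p ^ (7 * m))%N.

(** Because a^p2m b^p2m = 1, the exponent i matters only through i - j modulo p^(3m); the sums avoid
    subtraction in [nat]. *)
Lemma macdonald_nf_eq i j k i' j' k' :
    a ^+ i * b ^+ j * c ^+ k = a ^+ i' * b ^+ j' * c ^+ k' ->
  [/\ i + j' = i' + j %[mod p3m], j = j' %[mod p2m] & k = k' %[mod p2m]].
Proof.
pose f (e : 'I_p3m * 'I_p2m * 'I_p2m) := a ^+ e.1.1 * b ^+ e.1.2 * c ^+ e.2.
have [f_inj _] : injective f /\ (forall u, u \in J -> exists! t, u = f t).
  apply: surj_card_unique macdonald_nf _.
  rewrite cardJ !card_prod !card_ord -!expnD leq_exp2l ?prime_gt1 //.
  by clear; lia.
case: macdonald_powers => ab a1 _ c1 _.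
(* The reduced triple: the part of j divisible by p2m passes to a with the opposite sign, and
   [p3m.-1] represents -1 modulo p3m. *)
pose nf i j k : 'I_p3m * 'I_p2m * 'I_p2m :=
  (Ordinal (ltn_pmod (i + (p3m.-1 * (p2m * (j %/ p2m)))) (pm_gt0 (3 * m))),
   Ordinal (ltn_pmod j (pm_gt0 (2 * m))), Ordinal (ltn_pmod k (pm_gt0 (2 * m)))).
have nfE i0 j0 k0 : a ^+ i0 * b ^+ j0 * c ^+ k0 = f (nf i0 j0 k0).
  have aV t : a ^+ (p3m.-1 * t) = a ^- t.
    rewrite expgM -expVgn; congr (_ ^+ _); apply/(mulIg a).
    by rewrite mulVg -expgSr prednK ?pm_gt0.
  rewrite /f /= (expg_mod _ a1) (expg_mod _ c1) expgD aV {1}(divn_eq j0 p2m).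
  by rewrite mulnC expgD [b ^+ (_ * _)]expgM b_p2m expVgn -expgM !mulgA.
rewrite !nfE => /f_inj [] hi hj hk; split=> //.
set q := (j %/ p2m)%N in hi *; set q' := (j' %/ p2m)%N in hi *.
rewrite (divn_eq j p2m) (divn_eq j' p2m) -hj -/q -/q'.
have p3m_gt0 := pm_gt0 (3 * m).
have shift (u v w : nat) :
    ((u + p3m.-1 * v) + (v + w) = (u + w) + v * p3m)%N.
  by rewrite -[X in (_ = _ + v * X)%N](prednK p3m_gt0); ring.
move/eqP: hi; rewrite -(eqn_modDr (p2m * q + (p2m * q' + j %% p2m))) shift.
rewrite [(p2m * q + _)%N]addnCA shift ![(_ + _ * p3m)%N]addnC !modnMDl => /eqP hi.
by rewrite ![(_ * p2m)%N]mulnC hi.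
Qed.

Canonical Ktwo_group := [group of Ktwo].
Canonical Kthree_group := [group of Kthree].

Lemma commute_cancelr (hT : finGroupType) (x u s : hT) :
  commute u s -> commute (x * u) s -> commute x s.
Proof.
move=> us xus; rewrite -(mulgK u x); apply/commute_sym/commuteM; first exact/commute_sym.
exact/commuteV/commute_sym.
Qed.

Lemma commute_cancell (hT : finGroupType) (x u s : hT) :
  commute x s -> commute (x * u) s -> commute u s.
Proof.
move=> xs xus; rewrite -(mulKg x u); apply/commute_sym/commuteM; last exact/commute_sym.
exact/commuteV/commute_sym.
Qed.

Section CommutatorsModulo.

Variable N : {group gT}.
Hypothesis nNJ : J \subset 'N(N).
Let nN u : u \in J -> u \in 'N(N). Proof. exact: (subsetP nNJ). Qed.

Let mem_commg_coset u v : u \in J -> v \in J ->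
  ([~ u, v] \in N) = ([~ coset N u, coset N v] == 1).
Proof.
move=> Ju Jv; rewrite -morphR ?nN //=; apply/idP/eqP => [/coset_id // |].
by apply: coset_idr; rewrite nN ?groupR.
Qed.

Let Jai i : a ^+ i \in J. Proof. by rewrite groupX ?Ja. Qed.
Let Jbj j : b ^+ j \in J. Proof. by rewrite groupX ?Jb. Qed.
Let Jck k : c ^+ k \in J. Proof. by rewrite groupX ?Jc. Qed.

Let cosetM u v : u \in J -> v \in J -> coset N (u * v) = coset N u * coset N v.
Proof. by move=> Ju Jv; rewrite morphM ?nN. Qed.

Let cosetX u i : u \in J -> coset N (u ^+ i) = coset N u ^+ i.
Proof. by move=> Ju; rewrite morphX ?nN. Qed.

(** In J/N the element b commutes with b^j, with c^k and with the whole product, hence with a^i.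
    This allows testing a normal form one factor at a time. *)
Lemma commg_factor_b i j k : [~ c ^+ k, b] \in N ->
  [~ a ^+ i * b ^+ j * c ^+ k, b] \in N -> [~ a ^+ i, b] \in N.
Proof.
rewrite !mem_commg_coset ?Jb ?groupM // !cosetM ?groupM // (cosetX j Jb).
move=> /commgP ckb /commgP gb; apply/commgP/(commute_cancelr _ (commute_cancelr ckb gb)).
exact/commute_sym/commuteX.
Qed.

Lemma commg_factor_a i j k : [~ c ^+ k, a] \in N ->
  [~ a ^+ i * b ^+ j * c ^+ k, a] \in N -> [~ b ^+ j, a] \in N.
Proof.
rewrite !mem_commg_coset ?Ja ?groupM // !cosetM ?groupM // (cosetX i Ja).
move=> /commgP ckb /commgP gb; apply/commgP/(commute_cancell _ (commute_cancelr ckb gb)).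
exact/commute_sym/commuteX.
Qed.

Lemma commg_factor_c i j k : [~ b ^+ j, a] \in N ->
  [~ a ^+ i * b ^+ j * c ^+ k, a] \in N -> [~ c ^+ k, a] \in N.
Proof.
rewrite !mem_commg_coset ?Ja ?groupM // !cosetM ?groupM // (cosetX i Ja).
move=> /commgP bja /commgP gb; apply/commgP/(commute_cancell _ gb).
apply/commute_sym/commuteM; first exact/commuteX.
exact/commute_sym.
Qed.

End CommutatorsModulo.

Lemma commg_c_a k : [~ c ^+ k, a] = a ^- ((1 + e) ^ k - 1).
Proof.
rewrite -invgR commgEl (conjg_exp_iter _ ac); congr _^-1.
by rewrite -{1}(subnKC (_ : 0 < (1 + e) ^ k)) ?expn_gt0 // expgD expg1 mulKg.
Qed.

(** Negative powers appear because the relation for b involves c^-1; positive ones are obtained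
    later by writing c^k as c^(-(#[c] - 1) k). *)
Lemma commg_cV_b k : [~ c ^- k, b] = b ^- ((1 + e) ^ k - 1).
Proof.
rewrite -expVgn -invgR commgEl (conjg_exp_iter _ bc); congr _^-1.
by rewrite -{1}(subnKC (_ : 0 < (1 + e) ^ k)) ?expn_gt0 // expgD expg1 mulKg.
Qed.

Lemma pfactor_exp1De d k : 0 < k -> (p ^ d %| (1 + e) ^ k - 1) = (d <= m + logn p k).
Proof.
move=> k_gt0; rewrite pfactor_dvdn ?logn_exp1D ?p_dvd_e ?logn_e //.
by rewrite subn_gt0 -{1}(exp1n k) ltn_exp2r // add1n ltnS.
Qed.

Lemma Kthree_commg_c k u : u \in [set a; b] -> [~ c ^+ k, u] \in Kthree.
Proof.
have pm_sub k' : pm %| (1 + e) ^ k' - 1.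
  by case: k' => [|k']; rewrite ?subnn ?dvdn0 // pfactor_exp1De // leq_addr.
case/set2P=> ->.
  rewrite commg_c_a groupV; have /dvdnP[q ->] := pm_sub k.
  by rewrite mulnC expgM groupX ?Kthree_a.
have -> : c ^+ k = c ^- (#[c].-1 * k) by rewrite expgM -invg_expg expVgn invgK.
rewrite commg_cV_b groupV; have /dvdnP[q ->] := pm_sub (#[c].-1 * k)%N.
by rewrite mulnC expgM groupX ?Kthree_b.
Qed.

Lemma Z1_commg_c k u : pm %| k -> u \in [set a; b] -> [~ c ^+ k, u] \in <[y]>.
Proof.
have p2m_sub k' : pm %| k' -> p2m %| (1 + e) ^ k' - 1.
  case: k' => [|k']; rewrite ?subnn ?dvdn0 // => pm_k'.
  by rewrite pfactor_exp1De // mul2n -addnn leq_add2l -pfactor_dvdn.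
move=> pm_k; case/set2P=> ->.
  rewrite commg_c_a groupV; have /dvdnP[q ->] := p2m_sub k pm_k.
  by rewrite mulnC expgM mem_cycle.
have -> : c ^+ k = c ^- (#[c].-1 * k) by rewrite expgM -invg_expg expVgn invgK.
rewrite commg_cV_b groupV; have /dvdnP[q ->] := p2m_sub (#[c].-1 * k)%N (dvdn_mull _ pm_k).
by rewrite mulnC expgM b_p2m groupX // groupV cycle_id.
Qed.

Lemma sub_y_Ktwo : <[y]> \subset Ktwo.
Proof. by rewrite cycle_subG (Ktwo_y 1). Qed.

Lemma Ktwo_sub_Kthree : Ktwo \subset Kthree.
Proof.
by rewrite gen_subG; apply/subsetP=> u; rewrite !inE -orbA => /or3P[] /eqP->;
  rewrite ?(Kthree_y 1) ?Kthree_c ?group1.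
Qed.

Lemma pm_dvd_p2m : pm %| p2m. Proof. by rewrite p2m_e dvdn_mulr. Qed.

Lemma Kthree_cX i : c ^+ i \in Kthree -> pm %| i.
Proof.
case/KthreeP=> i' [j' [k' eq_c]].
have [|_ _ kk'] := @macdonald_nf_eq 0 0 i (pm * i') (pm * j') (pm * k').
  by rewrite -eq_c !expg0 !mul1g.
have := dvdn_mulr k' (dvdnn pm).
by rewrite /dvdn -(modn_dvdm _ pm_dvd_p2m) -kk' modn_dvdm ?pm_dvd_p2m.
Qed.

(** The order of the three tests matters. Modulo [Kthree] every c^k is central, so the c-parts of
    [a^i, b] and [b^j, a] force pm | i and pm | j. Then [b^j, a] lies in [Ktwo], hence so does
    [c^k, a], a power of a; lifting the exponent gives pm | k. *)
Lemma Kthree_of_commg u : u \in J -> [~ u, a] \in Ktwo -> [~ u, b] \in Ktwo ->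
  exists i j k, u = a ^+ (pm * i) * b ^+ (pm * j) * c ^+ (pm * k).
Proof.
move=> Ju ua ub; have [[[[i _] [j _]] [k _]] /= def_u] := macdonald_nf Ju.
have sK2 := subsetP Ktwo_sub_Kthree.
have K3a := Kthree_commg_c k (set21 a b); have K3b := Kthree_commg_c k (set22 a b).
have pm_eT l : pm %| e * Tsum e l by rewrite dvdn_mulr ?pm_e.
have pm_i : pm %| i.
  have : [~ a ^+ i, b] \in Kthree.
    by apply: (commg_factor_b Kthree_norm (j := j) K3b); rewrite -def_u sK2.
  rewrite (commXg_Tsum i (erefl c) ac) groupMr; first exact: Kthree_cX.
  by rewrite groupV; have /dvdnP[q ->] := pm_eT i; rewrite mulnC expgM groupX ?Kthree_a.
have pm_j : pm %| j.
  have : [~ b ^+ j, a] \in Kthree.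
    by apply: (commg_factor_a Kthree_norm (i := i) K3a); rewrite -def_u sK2.
  rewrite commg_b_a groupMr ?groupV; first exact: Kthree_cX.
  by have /dvdnP[q ->] := pm_eT j; rewrite mulnC expgM groupX ?Kthree_b.
have pm_k : pm %| k.
  have : [~ c ^+ k, a] \in Ktwo.
    apply: (commg_factor_c Ktwo_norm (i := i) (j := j)); last by rewrite -def_u.
    have [r ->] := commg_b_aX pm_j; rewrite groupM ?Ktwo_y // groupV.
    by have /dvdnP[q ->] := pm_j; rewrite mulnC expgM groupX ?Ktwo_c.
  case: (posnP k) => [-> | k_gt0]; first by rewrite dvdn0.
  rewrite commg_c_a groupV => /KtwoP[r [k' eq_a]].
  have [|] := @macdonald_nf_eq ((1 + e) ^ k - 1) 0 0 (p2m * r) 0 (pm * k').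
    by rewrite !expg0 !mulg1 expgM.
  rewrite !addn0 => eq_mod _ _.
  have : p2m %| (1 + e) ^ k - 1.
    have p23 : p2m %| p3m by rewrite p3m_e dvdn_mull.
    by rewrite /dvdn -(modn_dvdm _ p23) eq_mod modn_dvdm // modnMr.
  by rewrite pfactor_exp1De // mul2n -addnn leq_add2l pfactor_dvdn.
exists (i %/ pm)%N, (j %/ pm)%N, (k %/ pm)%N.
by rewrite ![(pm * _)%N]mulnC !divnK.
Qed.

(** The same argument one level lower: modulo <y> the exponents of a and b become multiples of p2m,
    and such powers lie in <y>. *)
Lemma Ktwo_of_commg u : u \in J -> [~ u, a] \in <[y]> -> [~ u, b] \in <[y]> ->
  exists r k, u = y ^+ r * c ^+ (pm * k).
Proof.
move=> Ju ua ub; have sY := subsetP sub_y_Ktwo.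
have [i [j [k def_u]]] := Kthree_of_commg Ju (sY _ ua) (sY _ ub).
have nY : J \subset 'N(<[y]>).
  by rewrite cents_norm // centsC cycle_subG; case/setIP: y_center.
have Za := Z1_commg_c (dvdn_mulr k (dvdnn pm)) (set21 a b).
have Zb := Z1_commg_c (dvdn_mulr k (dvdnn pm)) (set22 a b).
have y_cX l : c ^+ l \in <[y]> -> p2m %| l.
  case/cycleP=> r eq_c; have [|_ _] := @macdonald_nf_eq 0 0 l (p2m * r) 0 0.
    by rewrite !expg0 !mul1g !mulg1 expgM.
  by rewrite mod0n => /eqP.
have p2_i : p2m %| pm * i.
  have := commg_factor_b nY (i := pm * i) (j := pm * j) Zb.
  rewrite -def_u => /(_ ub).
  have [r ->] := commg_a_b (dvdn_mulr i (dvdnn pm)).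
  by rewrite groupMr ?groupV ?mem_cycle //; apply: y_cX.
have p2_j : p2m %| pm * j.
  have := commg_factor_a nY (i := pm * i) (j := pm * j) Za.
  rewrite -def_u => /(_ ua).
  have [r ->] := commg_b_aX (dvdn_mulr j (dvdnn pm)).
  by rewrite groupMr ?mem_cycle // groupV; apply: y_cX.
have : a ^+ (pm * i) * b ^+ (pm * j) \in <[y]>.
  have /dvdnP[i' ->] := p2_i; have /dvdnP[j' ->] := p2_j.
  by rewrite ![(_ * p2m)%N]mulnC !expgM b_p2m -/y groupM ?mem_cycle // expVgn groupV mem_cycle.
by case/cycleP=> r def_r; exists r, k; rewrite def_u def_r.
Qed.

(** Commuting with a forces p^(3m) to divide (1 + e)^(pm k) - 1, so p^(2m) divides pm k and the
    c-part is trivial. *)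
Lemma macdonald_center : 'Z(J) = <[y]>.
Proof.
apply/eqP; rewrite eqEsubset cycle_subG y_center andbT; apply/subsetP=> u.
case/centerP=> Ju uC.
have u1 s : s \in J -> [~ u, s] \in <[y]>.
  by move=> Js; have /commgP/eqP-> := uC s Js; rewrite group1.
have [r [k def_u]] := Ktwo_of_commg Ju (u1 a Ja) (u1 b Jb).
have : commute (c ^+ (pm * k)) a.
  have : commute u a by apply: uC; apply: Ja.
  rewrite def_u; apply: commute_cancell.
  by apply/commute_sym/commuteX/a_y.
move/commgP/eqP; rewrite commg_c_a => /eqP; rewrite invg_eq1 => /eqP aN.
suffices ck1 : c ^+ (pm * k) = 1 by rewrite def_u ck1 mulg1 mem_cycle.
case: (posnP k) => [-> | k_gt0]; first by rewrite muln0.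
suffices /dvdnP[q ->] : p2m %| pm * k.
  by case: macdonald_powers => _ _ _ c1 _; rewrite mulnC expgM c1 expg1n.
have [|] := @macdonald_nf_eq ((1 + e) ^ (pm * k) - 1) 0 0 0 0 0.
  by rewrite aN !expg0.
rewrite !addn0 mod0n => /eqP.
rewrite -/(p3m %| _) pfactor_exp1De ?muln_gt0 ?pm_gt0 // (mulSn 2 m) leq_add2l => le2.
by move=> _ _; rewrite pfactor_dvdn ?muln_gt0 ?pm_gt0.
Qed.

Lemma macdonald_Z3 : 'Z_3(J) = Kthree.
Proof.
have Z1 : 'Z_1(J) = <[y]> by rewrite ucn1 macdonald_center.
have comm n u s : u \in 'Z_(n.+1)(J) -> s \in J -> [~ u, s] \in 'Z_n(J).
  by move=> Zu Js; apply: (subsetP (ucn_comm n J)); rewrite mem_commg.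
have sub n u : u \in 'Z_n(J) -> u \in J := subsetP (ucn_sub n J) u.
have Z2 u : u \in 'Z_2(J) -> u \in Ktwo.
  move=> Zu; have [r [k ->]] := Ktwo_of_commg (sub _ _ Zu)
    (eq_ind _ (fun A : {set gT} => _ \in A) (comm _ _ _ Zu Ja) _ Z1)
    (eq_ind _ (fun A : {set gT} => _ \in A) (comm _ _ _ Zu Jb) _ Z1).
  by rewrite expgM groupM ?Ktwo_y // groupX ?Ktwo_c.
apply/eqP; rewrite eqEsubset; apply/andP; split; last first.
  rewrite gen_subG; apply/subsetP=> u /setUP[/set2P[] -> | /set1P ->].
  - exact: apm_Z3.
  - exact: bpm_Z3.
  - exact: (subsetP (ucn_subS _ _)) cpm_Z2.
apply/subsetP=> u Zu; have [i [j [k ->]]] := Kthree_of_commg (sub _ _ Zu)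
  (Z2 _ (comm _ _ _ Zu Ja)) (Z2 _ (comm _ _ _ Zu Jb)).
rewrite !expgM; apply: groupM; [apply: groupM|]; apply: groupX.
- exact: Kthree_a.
- exact: Kthree_b.
- exact: Kthree_c.
Qed.

(** * The subgroup of Z_3(G_p) that will be N_p *)

Section KernelSubgroup.

Variables (h n : nat).
Hypothesis m_hn : m = (h + n)%N.
Local Notation P := (p ^ (m + h))%N.

Let x1 := a ^+ (p ^ (m + 2 * h)).
Let x2 := a ^+ P * b ^+ P.
Let x3 := c ^+ P.

Definition Ngen := <<[set x1; x2; x3]>>.
Canonical Ngen_group := [group of Ngen].

Lemma Kthree_comm u v : u \in Kthree -> v \in Kthree -> commute u v.
Proof.
suffices /centsP abK : abelian Kthree by move=> Ku Kv; apply: abK.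
rewrite abelian_gen; apply/centsP=> {}u Su {}v Sv.
have [ab ac' bc'] := And3 apm_bpm apm_cpm bpm_cpm.
case/setUP: Su => [/set2P[] -> | /set1P ->]; case/setUP: Sv => [/set2P[] -> | /set1P ->];
  by [|apply: commute_sym].
Qed.

Let Pe : (P = pm * p ^ h)%N. Proof. by rewrite expnD. Qed.
Let x1e : (p ^ (m + 2 * h) = P * p ^ h)%N.
Proof. by rewrite -expnD; congr (_ ^ _)%N; lia. Qed.
Let Ppn : (P * p ^ n = p2m)%N. Proof. by rewrite -expnD; congr (_ ^ _)%N; lia. Qed.
Let x1pn : (p ^ (m + 2 * h) * p ^ n = p2m * p ^ h)%N.
Proof. by rewrite -!expnD; congr (_ ^ _)%N; lia. Qed.
Let x1p2n : (p ^ (m + 2 * h) * p ^ (2 * n) = p3m)%N.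
Proof. by rewrite -!expnD; congr (_ ^ _)%N; lia. Qed.

Lemma Kthree_aP i : a ^+ (P * i) \in Kthree.
Proof. by rewrite Pe -mulnA expgM groupX // Kthree_a. Qed.
Lemma Kthree_bP i : b ^+ (P * i) \in Kthree.
Proof. by rewrite Pe -mulnA expgM groupX // Kthree_b. Qed.
Lemma Kthree_cP i : c ^+ (P * i) \in Kthree.
Proof. by rewrite Pe -mulnA expgM groupX // Kthree_c. Qed.

Let Kx1 : x1 \in Kthree. Proof. by rewrite /x1 x1e Kthree_aP. Qed.
Let Kx2 : x2 \in Kthree.
Proof. by rewrite groupM //; [have := Kthree_aP 1 | have := Kthree_bP 1]; rewrite muln1. Qed.
Let Kx3 : x3 \in Kthree. Proof. by have := Kthree_cP 1; rewrite muln1. Qed.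

Lemma x2X s : x2 ^+ s = a ^+ (P * s) * b ^+ (P * s).
Proof.
rewrite expgMn ?expgM //; apply: Kthree_comm.
  by have := Kthree_aP 1; rewrite muln1.
by have := Kthree_bP 1; rewrite muln1.
Qed.

Lemma NgenP u : u \in Ngen -> exists r s t, u = x1 ^+ r * x2 ^+ s * x3 ^+ t.
Proof.
apply: commuting_gen3P; apply: Kthree_comm; by [exact: Kx1 | exact: Kx2 | exact: Kx3].
Qed.

Lemma x1_p2n : x1 ^+ (p ^ (2 * n)) = 1.
Proof. by rewrite -expgM x1p2n; case: macdonald_powers. Qed.

Lemma x2_pn : x2 ^+ (p ^ n) = 1.
Proof. by rewrite x2X Ppn; case: macdonald_powers. Qed.

Lemma x3_pn : x3 ^+ (p ^ n) = 1.
Proof. by rewrite -expgM Ppn; case: macdonald_powers. Qed.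

Lemma Ngen_nf r s t : x1 ^+ r * x2 ^+ s * x3 ^+ t
  = a ^+ (p ^ (m + 2 * h) * r + P * s) * b ^+ (P * s) * c ^+ (P * t).
Proof. by rewrite x2X expgD !expgM !mulgA. Qed.

(** In x2 the exponents of a and b agree, so it drops out of the difference that [macdonald_nf_eq]
    controls modulo p3m, which isolates r. *)
Lemma Ngen_eq1 r s t : x1 ^+ r * x2 ^+ s * x3 ^+ t = 1 ->
  [/\ p ^ (2 * n) %| r, p ^ n %| s & p ^ n %| t].
Proof.
have P_gt0 := pm_gt0 (m + h).
rewrite Ngen_nf => eq1.
have [|eq_a eq_b eq_c] := @macdonald_nf_eq (p ^ (m + 2 * h) * r + P * s) (P * s) (P * t) 0 0 0.
  by rewrite eq1 !expg0 !mulg1.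
have pn_s : p ^ n %| s by rewrite -(dvdn_pmul2l P_gt0) Ppn /dvdn eq_b mod0n.
have pn_t : p ^ n %| t by rewrite -(dvdn_pmul2l P_gt0) Ppn /dvdn eq_c mod0n.
split=> //; rewrite -(dvdn_pmul2l (pm_gt0 (m + 2 * h))) x1p2n.
by move/eqP: eq_a; rewrite addn0 eqn_modDr mod0n.
Qed.

Lemma order_eq (hT : finGroupType) (x : hT) N : x ^+ N = 1 ->
  (forall r, x ^+ r = 1 -> N %| r) -> #[x] = N.
Proof.
move=> x1' xN; apply/eqP; rewrite eqn_dvd order_dvdn x1' eqxx /=.
by apply: xN; rewrite expg_order.
Qed.

Lemma Ngen_dprod : <[x1]> \x <[x2]> \x <[x3]> = Ngen.
Proof.
have c12 : commute x1 x2 := Kthree_comm Kx1 Kx2.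
have c13 : commute x1 x3 := Kthree_comm Kx1 Kx3.
have c23 : commute x2 x3 := Kthree_comm Kx2 Kx3.
have cyx : <[x2]> \subset 'C(<[x1]>) by rewrite cent_cycle cycle_subG; apply/cent1P/esym.
have czxy : <[x3]> \subset 'C(<[x1]> <*> <[x2]>).
  by rewrite centY !cent_cycle cycle_subG inE; apply/andP; split; apply/cent1P/esym.
have ti12 : <[x1]> :&: <[x2]> = 1.
  apply/trivgP/subsetP=> _ /setIP[/cycleP[r ->] /cycleP[s eq_rs]].
  have [|pr _ _] := @Ngen_eq1 r (p ^ n * s - s) 0.
    rewrite mulg1 eq_rs -expgD subnKC ?leq_pmull ?pm_gt0 //.
    by rewrite expgM x2_pn expg1n.
  by rewrite inE; have /dvdnP[q ->] := pr; rewrite mulnC expgM x1_p2n expg1n.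
have ti3 : (<[x1]> <*> <[x2]>) :&: <[x3]> = 1.
  apply/trivgP/subsetP=> v /setIP[]; rewrite /= {1}(cent_joinEr cyx).
  move=> /mulsgP[_ _ /cycleP[r ->] /cycleP[s ->] ->] /cycleP[t eq_t].
  have [|pr ps _] := @Ngen_eq1 r s (p ^ n * t - t).
    rewrite eq_t -expgD subnKC ?leq_pmull ?pm_gt0 //.
    by rewrite expgM x3_pn expg1n.
  rewrite inE; have /dvdnP[q ->] := pr; have /dvdnP[q' ->] := ps.
  by rewrite ![(_ * p ^ _)%N]mulnC !expgM x1_p2n x2_pn !expg1n mulg1.
rewrite (dprodE cyx ti12) -(cent_joinEr cyx) dprodE // -(cent_joinEr czxy) /=.
apply/eqP; rewrite eqEsubset; apply/andP; split; last first.
  rewrite gen_subG; apply/subsetP=> u /setUP[/set2P[] -> | /set1P ->].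
  - by rewrite mem_gen // inE mem_gen // inE cycle_id.
  - by rewrite mem_gen // inE mem_gen // inE cycle_id orbT.
  - by rewrite mem_gen // inE cycle_id orbT.
rewrite !join_subG !cycle_subG -andbA; apply/and3P; split; rewrite mem_gen // !inE eqxx ?orbT //.
Qed.

Lemma order_x1 : #[x1] = (p ^ (2 * n))%N.
Proof.
apply: order_eq x1_p2n _ => r xr.
by have [|] := @Ngen_eq1 r 0 0; rewrite ?xr ?expg0 ?mulg1.
Qed.

Lemma order_x2 : #[x2] = (p ^ n)%N.
Proof.
apply: order_eq x2_pn _ => r xr.
by have [|] := @Ngen_eq1 0 r 0; rewrite ?xr ?expg0 ?mulg1.
Qed.

Lemma order_x3 : #[x3] = (p ^ n)%N.
Proof.
apply: order_eq x3_pn _ => r xr.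
by have [|] := @Ngen_eq1 0 0 r; rewrite ?xr ?expg0 ?mulg1.
Qed.

Lemma card_Ngen : #|Ngen| = (p ^ (4 * n))%N.
Proof.
case/dprodP: (Ngen_dprod) => [[A B defA defB] defN _ _].
have := dprod_card Ngen_dprod; rewrite defA -(dprod_card defA) => <-.
rewrite -!orderE order_x1 order_x2 order_x3 -!expnD; congr (_ ^ _)%N.
by clear; lia.
Qed.

Lemma setX_isog (aT bT cT dT : finGroupType) (A : {group aT}) (B : {group bT})
    (C : {group cT}) (D : {group dT}) :
  A \isog C -> B \isog D -> setX A B \isog setX C D.
Proof.
move=> AC BD; apply: isog_dprod (setX_dprod A B) (setX_dprod C D) _ _.
  exact: isog_trans (isog_symr (isog_setX1 _ A)) (isog_trans AC (isog_setX1 _ C)).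
exact: isog_trans (isog_symr (isog_set1X _ B)) (isog_trans BD (isog_set1X _ D)).
Qed.

Lemma isog_Ngen :
  Ngen \isog setX (setX (Zp (p ^ (2 * n))) (Zp (p ^ n))) (Zp (p ^ n)).
Proof.
have := Ngen_dprod; case/dprodP=> [[A B defA defB]].
rewrite defA => defN cAB tiAB.
have dpN : A \x <[x3]> = Ngen by rewrite -defN dprodE // defB.
have iN : setX A <[x3]> \isog Ngen by apply: misom_isog; apply/mulgmP.
have iA : setX <[x1]> <[x2]> \isog A by apply: misom_isog; apply/mulgmP.
have Zp_x N x : #[x] = N -> Zp N \isog <[x]> by move=> <-; apply: Zp_isog.
rewrite isog_sym; apply: isog_trans iN.
apply: setX_isog; last exact: Zp_x order_x3.
apply: isog_trans iA.
by apply: setX_isog; apply: Zp_x; [exact: order_x1 | exact: order_x2].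
Qed.

(** The power x2^(p^h) is the product of the two generators to be exchanged. *)
Lemma Ngen_swap : Ngen = <<[set b ^+ (p ^ (m + 2 * h)); x2; x3]>>.
Proof.
have x2ph : x2 ^+ (p ^ h) = x1 * b ^+ (p ^ (m + 2 * h)) by rewrite x2X -x1e.
apply/eqP; rewrite eqEsubset !gen_subG.
apply/andP; split; apply/subsetP=> u /setUP[/set2P[] -> | /set1P ->];
  try by rewrite mem_gen // !inE eqxx ?orbT.
  rewrite -(mulgK (b ^+ (p ^ (m + 2 * h))) x1) -x2ph.
  by apply: groupM; [apply: groupX | rewrite groupV]; rewrite mem_gen // !inE eqxx ?orbT.
rewrite -(mulKg x1 (b ^+ _)) -x2ph.
by apply: groupM; [rewrite groupV | apply: groupX]; rewrite mem_gen // !inE eqxx ?orbT.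
Qed.

(** Let V = a^(pm i) b^(pm j) c^(pm k). A central V^(p^n) forces p^h to divide i, j and k, and
    V^(p^(2n)) = 1 forces i = j modulo p^(2h). The common part of i and j gives a power of x2, their
    difference one of x1, and k one of x3. *)
Lemma Ngen_center : Ngen = Mset J p n :&: Lset J p (2 * n).
Proof.
have P_gt0 := pm_gt0 (m + h).
apply/eqP; rewrite eqEsubset; apply/andP; split; apply/subsetP=> V.
  move=> NV; have KV : V \in 'Z_3(J).
    rewrite macdonald_Z3; apply: subsetP NV; rewrite gen_subG.
    by apply/subsetP=> u /setUP[/set2P[] -> | /set1P ->]; [exact: Kx1|exact: Kx2|exact: Kx3].
  rewrite inE [V \in Mset _ _ _]inE [V \in Lset _ _ _]inE KV /=.
  have [r [s [t def_V]]] := NgenP NV.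
  have Vpn : V ^+ (p ^ n) = y ^+ (p ^ h * r).
    have c12 : commute (x1 ^+ r) (x2 ^+ s) by apply: commuteX2; exact: Kthree_comm Kx1 Kx2.
    have c13 : commute (x1 ^+ r * x2 ^+ s) (x3 ^+ t).
      apply: commute_sym; apply: commuteM; apply: commuteX2; apply: Kthree_comm;
      by [exact: Kx1 | exact: Kx2 | exact: Kx3].
    rewrite def_V (expgMn _ c13) (expgMn _ c12) [x2 ^+ s ^+ _]expgnAC [x3 ^+ t ^+ _]expgnAC x2_pn x3_pn.
    rewrite !expg1n !mulg1 /x1 /y -!expgM; congr (_ ^+ _).
    by transitivity (p ^ (m + 2 * h) * p ^ n * r)%N; [ring | rewrite x1pn; ring].
  apply/andP; split; first by rewrite Vpn groupX ?y_center.
  rewrite mul2n -addnn expnD expgM Vpn -expgM.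
  rewrite (_ : p ^ h * r * p ^ n = pm * r)%N; last by rewrite m_hn expnD; ring.
  by rewrite expgM y_pm expg1n.
rewrite inE [V \in Mset _ _ _]inE [V \in Lset _ _ _]inE macdonald_Z3 macdonald_center.
case/andP=> /andP[KV yV] /andP[_ /eqP V1].
have [i [j [k def_V]]] := KthreeP KV.
have VX l : V ^+ l = a ^+ (pm * i * l) * b ^+ (pm * j * l) * c ^+ (pm * k * l).
  have ci : commute (a ^+ (pm * i)) (b ^+ (pm * j)).
    by rewrite !expgM; apply: commuteX2; exact: apm_bpm.
  have ck : commute (a ^+ (pm * i) * b ^+ (pm * j)) (c ^+ (pm * k)).
    apply: commute_sym; apply: commuteM; rewrite !expgM; apply: commuteX2; apply: commute_sym.
      exact: apm_cpm.
    exact: bpm_cpm.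
  by rewrite def_V (expgMn _ ck) (expgMn _ ci) -!expgM.
case/cycleP: yV => r eq_r.
have [|eq_a eq_b eq_c] := @macdonald_nf_eq (pm * i * p ^ n) (pm * j * p ^ n) (pm * k * p ^ n) (p2m * r) 0 0.
  by rewrite -VX eq_r !expg0 !mulg1 expgM.
have pmpn : (p2m = pm * p ^ n * p ^ h)%N by rewrite -!expnD; congr (_ ^ _)%N; clear -m_hn; lia.
have dvd_ph l : p2m %| pm * l * p ^ n -> p ^ h %| l.
  by rewrite mulnAC pmpn dvdn_pmul2l // muln_gt0 !pm_gt0.
have /dvdnP[k' def_k] : p ^ h %| k by apply: dvd_ph; rewrite /dvdn eq_c mod0n.
have p2_j : p2m %| pm * j * p ^ n by rewrite /dvdn eq_b mod0n.
have /dvdnP[j' def_j] := dvd_ph _ p2_j.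
have /dvdnP[i' def_i] : p ^ h %| i.
  apply: dvd_ph; have p23 : p2m %| p3m by rewrite p3m_e dvdn_mull.
  rewrite addn0 in eq_a; rewrite /dvdn -(modn_dvdm _ p23) eq_a modn_dvdm //.
  by rewrite -/(p2m %| _) dvdn_add // dvdn_mulr.
have [|eq_ij _ _] := @macdonald_nf_eq (pm * i * p ^ (2 * n)) (pm * j * p ^ (2 * n)) (pm * k * p ^ (2 * n)) 0 0 0.
  by rewrite -VX V1 !expg0 !mulg1.
have eq_ij' : i' = j' %[mod p ^ h].
  move: eq_ij; rewrite addn0 add0n def_i def_j.
  have p3e l : (pm * (l * p ^ h) * p ^ (2 * n) = p ^ (m + h + 2 * n) * l)%N.
    by rewrite !expnD; ring.
  rewrite !p3e (_ : p3m = p ^ (m + h + 2 * n) * p ^ h)%N.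
    rewrite -!muln_modr => /eqP; rewrite eqn_pmul2l ?pm_gt0 // => /eqP //.
  by rewrite -expnD; congr (_ ^ _)%N; clear -m_hn; lia.
(* This is the difference i' - j', with [p3m.-1] in the place of -1. *)
have /dvdnP[r' def_r'] : p ^ h %| i' + p3m.-1 * j'.
  rewrite /dvdn -modnDml eq_ij' modnDml -mulSn prednK ?pm_gt0 // -/(p ^ h %| _).
  by rewrite dvdn_mulr // dvdn_exp2l //; clear -m_hn; lia.
rewrite def_V (_ : _ * _ = x1 ^+ r' * x2 ^+ j' * x3 ^+ k').
  by rewrite !groupM // groupX // mem_gen // !inE eqxx ?orbT.
rewrite Ngen_nf x1e def_k def_j def_i.
have -> : (pm * (j' * p ^ h) = P * j')%N by rewrite Pe; ring.
have -> : (pm * (k' * p ^ h) = P * k')%N by rewrite Pe; ring.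
have -> : (pm * (i' * p ^ h) = P * i')%N by rewrite Pe; ring.
congr (_ * _ * _).
rewrite (_ : P * p ^ h * r' + P * j' = P * i' + p3m * (P * j'))%N.
  by rewrite expgD [a ^+ (p3m * _)]expgM; case: macdonald_powers => _ -> _ _ _; rewrite expg1n mulg1.
rewrite -mulnA [(p ^ h * r')%N]mulnC -def_r' -{2}(prednK (pm_gt0 (3 * m))).
ring.
Qed.

End KernelSubgroup.

End MacdonaldGroup.

(** * Passing to Sylow subgroups *)

Lemma zexpg_mod (H : groupType) (x : H) (z : int) (k N : nat) :
  x ^+ N = 1 -> (N%:Z %| (z - k%:Z)%R)%Z -> zexpg x z = x ^+ k.
Proof.
move=> xN /dvdzP[q].
have xNX r : x ^+ (r * N)%N = 1 by rewrite mulnC expgnA xN expg1n.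
case: z => [r | r] /= def_q.
  have [le_kr | /ltnW le_rk] := leqP k r.
    have /dvdnP[u hu] : (N %| r - k)%N.
      by have : (N%:Z %| (r - k)%N%:Z)%Z by apply/dvdzP; exists q; rewrite -def_q; lia.
    by rewrite -(subnKC le_kr) expgnDr hu xNX mulg1.
  have /dvdnP[u hu] : (N %| k - r)%N.
    by have : (N%:Z %| (k - r)%N%:Z)%Z by apply/dvdzP; exists (- q)%R; rewrite mulNr -def_q; lia.
  by rewrite -(subnKC le_rk) expgnDr hu xNX mulg1.
have /dvdnP[u hu] : (N %| k + r.+1)%N.
  by have : (N%:Z %| (k + r.+1)%N%:Z)%Z by apply/dvdzP; exists (- q)%R; rewrite mulNr -def_q NegzE; lia.
by apply: (mulIg (x ^+ r.+1)); rewrite mulVg -expgnDr hu xNX.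
Qed.

Lemma zexpg_morph (H : groupType) (T : finGroupType) (f : T -> H) (x : T) (z : int) :
  {morph f : u v / u * v} -> f (zexpg x z) = zexpg (f x) z.
Proof.
move=> fM; have f1 : f 1 = 1 by apply: (mulgI (f 1)); rewrite -fM !mulg1.
have fX k : f (x ^+ k) = f x ^+ k.
  by elim: k => [|k IHk]; rewrite ?expg0 // !expgS fM IHk.
have fV u : f u^-1 = (f u)^-1 by apply: (mulIg (f u)); rewrite -fM !mulVg.
by case: z => k /=; rewrite ?fV fX.
Qed.

(** From p^r = #[x] <= M one gets r < M. The crude bound lets a single M serve all p-elements of G
    and W, so that integer exponents matter only modulo p^M. *)
Lemma p_elt_expn (gT : finGroupType) (p M : nat) (x : gT) :
  prime p -> p.-elt x -> #|gT| <= M -> x ^+ (p ^ M) = 1.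
Proof.
move=> p_pr p_x le_M; apply/eqP; rewrite -order_dvdn.
have /p_natP[r def_r] : p.-nat #[x] by [].
rewrite def_r dvdn_exp2l // (leq_trans _ le_M) // -cardsT.
apply: leq_trans (subset_leq_card (subsetT <[x]>)); rewrite -orderE def_r.
by apply/ltnW/ltn_expl/prime_gt1.
Qed.

Lemma logn_cong (p M : nat) (z w : int) : prime p ->
  w <> 0%R -> ((p ^ M)%N%:Z %| (z - w)%R)%Z -> logn p `|w|%N < M ->
  z <> 0%R /\ logn p `|z|%N = logn p `|w|%N.
Proof.
move=> p_pr w0 zw lt_wM; set v := logn p `|w|%N in lt_wM *.
have w_gt0 : 0 < `|w| by rewrite absz_gt0; apply/eqP.
have dvd_zw d : d <= M -> (p ^ d %| `|z|)%N = (p ^ d %| `|w|)%N.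
  move=> le_dM; have : ((p ^ d)%N%:Z %| (z - w)%R)%Z.
    by apply: dvdz_trans zw; rewrite dvdzE dvdn_exp2l.
  move=> d_zw; change (((p ^ d)%N%:Z %| z)%Z = ((p ^ d)%N%:Z %| w)%Z).
  by rewrite -[in LHS](subrK w z) rpredDl.
have z0 : z <> 0%R.
  move=> z0; have := dvd_zw M (leqnn M).
  by rewrite z0 dvdn0 pfactor_dvdn // => /esym; rewrite leqNgt lt_wM.
have z_gt0 : 0 < `|z| by rewrite absz_gt0; apply/eqP.
split=> //; apply/eqP; rewrite eqn_leq -[_ <= v]ltnS ltnNge -!pfactor_dvdn //.
by rewrite !dvd_zw ?(ltnW lt_wM) // !pfactor_dvdn // leqnn ltnn.
Qed.

Lemma dvdz_subX (N al : int) (y i : nat) : (N %| (al - y%:Z)%R)%Z ->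
  (N %| (al ^+ i - (y ^ i)%N%:Z)%R)%Z.
Proof.
have -> : ((y ^ i)%N%:Z = y%:Z ^+ i)%R.
  by elim: i => // i IHi; rewrite expnS exprS PoszM IHi.
by move=> al_y; rewrite subrXX dvdz_mulr.
Qed.

(* Modulo p^M, alpha may be replaced by a natural number x + 1 greater than 1. *)
Lemma nat_parameters (alpha : int) (gamma p M : nat) :
    prime p -> odd p -> 0 < gamma -> (alpha ^+ gamma)%R <> 1%R ->
    (p%:Z %| (alpha - 1)%R)%Z ->
    (p = 3 -> ~ ((alpha ^+ gamma)%R = 7%:Z %[mod 9%:Z])%Z) ->
    padic_val p (alpha - 1)%R + logn p gamma < M -> 1 < M ->
  exists x e : nat,
    [/\ 0 < x, 0 < e, (x.+1 ^ gamma = 1 + e)%N & ((p ^ M)%N%:Z %| (alpha - x.+1%:Z)%R)%Z] /\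
    [/\ padic_val p (alpha - 1)%R = logn p x,
        padic_val p (alpha ^+ gamma - 1)%R = logn p e,
        logn p e = (logn p x + logn p gamma)%N,
        0 < logn p x & p = 3 -> (1 + e) %% 9 <> 7].
Proof.
move=> p_pr p_odd gamma_gt0 alphaX1 p_alpha mod9 lt_M M_gt1.
have alpha1 : (alpha - 1)%R <> 0%R.
  by move=> /eqP; rewrite subr_eq0 => /eqP alpha1; case: alphaX1; rewrite alpha1 expr1n.
have pM_gt0 : 0 < p ^ M by rewrite expn_gt0 prime_gt0.
pose al := `|(alpha %% (p ^ M)%N%:Z)%Z|%N.
have al_eq : ((p ^ M)%N%:Z %| (alpha - al%:Z)%R)%Z.
  apply/dvdzP; exists (alpha %/ (p ^ M)%N%:Z)%Z.
  have ge0 : (0 <= (alpha %% (p ^ M)%N%:Z)%Z)%R by rewrite modz_ge0 // eqz_nat -lt0n.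
  by rewrite /al gez0_abs // {1}(divz_eq alpha (p ^ M)%N%:Z) addrK.
have al_gt0 : 0 < al.
  rewrite lt0n; apply/eqP => al0; move: al_eq; rewrite al0 subr0 => pM_alpha.
  have p_alpha' : (p%:Z %| alpha)%Z.
    by apply: dvdz_trans pM_alpha; rewrite dvdzE /= dvdn_exp // ltnW.
  have : (p%:Z %| (alpha - (alpha - 1))%R)%Z by rewrite rpredB.
  by rewrite subKr dvdzE /= dvdn1 => /eqP p1; have := prime_gt1 p_pr; rewrite p1.
have h_gt0 : 0 < padic_val p (alpha - 1)%R.
  rewrite /padic_val logn_gt0 mem_primes p_pr absz_gt0 (introN eqP alpha1) /=.
  by move: p_alpha; rewrite dvdzE.
have [||x0 x_h] := @logn_cong p M al.-1%:Z (alpha - 1)%R p_pr alpha1.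
- rewrite (_ : _ - _ = - (alpha - al%:Z))%R ?rpredN // -{2}(prednK al_gt0).
  by rewrite -addn1 PoszD; ring.
- exact: leq_ltn_trans (leq_addr _ _) lt_M.
have x_gt0 : 0 < al.-1 by rewrite lt0n; apply/eqP => al0; case: x0; rewrite al0.
rewrite absz_nat in x_h.
pose e := ((1 + al.-1) ^ gamma - 1)%N.
have alXe : (al ^ gamma = 1 + e)%N.
  by rewrite /e [(1 + al.-1)%N]add1n prednK // subnKC // expn_gt0 al_gt0.
have p_x : p %| al.-1.
  by move: h_gt0; rewrite /padic_val -x_h logn_gt0 mem_primes => /and3P[].
have logn_e : logn p e = (logn p al.-1 + logn p gamma)%N by apply: logn_exp1D.
have e_gt0 : 0 < e.
  rewrite subn_gt0 -{1}(exp1n gamma) ltn_exp2r //; lia.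
have alXe_eq : ((p ^ M)%N%:Z %| (alpha ^+ gamma - (1 + e)%N%:Z)%R)%Z.
  by rewrite -alXe; apply: dvdz_subX.
have [|||_ m_e] := @logn_cong p M (alpha ^+ gamma - 1)%R e%:Z p_pr.
- by case: (e) e_gt0.
- by rewrite (_ : _ - _ = alpha ^+ gamma - (1 + e)%N%:Z)%R // PoszD; ring.
- by rewrite absz_nat logn_e x_h.
exists al.-1, e; split; split=> //; rewrite ?prednK ?x_h //.
move=> p3 e9; apply: (mod9 p3).
have p9 : (9%:Z %| (alpha ^+ gamma - (1 + e)%N%:Z)%R)%Z.
  apply: dvdz_trans alXe_eq; rewrite p3 dvdzE /= -[9]/(3 ^ 2)%N.
  by rewrite dvdn_exp2l.
have : ((alpha ^+ gamma)%R = (1 + e)%N%:Z %[mod 9%:Z])%Z.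
  by apply/eqP; rewrite eqz_mod_dvd.
by move=> ->; rewrite modz_nat e9.
Qed.

(** The p-constituent is a power of x, so it is compatible with conjugation, powers and morphisms;
    it replaces the projection from here on. *)
Lemma sylow_proj_constt (gT : finGroupType) (p : nat) (G : {group gT}) (x : gT) :
  nilpotent G -> x \in G -> sylow_proj p G x = x.`_p.
Proof.
move=> nilG Gx; rewrite /sylow_proj -{1}(consttC p x).
have [_ _ _ tiO] := dprodP (nilpotent_pcoreC p nilG).
have mem_O pi : x.`_pi \in 'O_pi(G).
  by rewrite (mem_normal_Hall (nilpotent_pcore_Hall pi nilG)) ?pcore_normal ?p_elt_constt ?groupX.
by rewrite divgrMid ?mem_O.
Qed.

Lemma constt_morph (gT : finGroupType) (p : nat) (G : {group gT}) :
  nilpotent G -> {in G &, {morph (fun x => x.`_p) : x y / x * y}}.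
Proof.
move=> nilG x y Gx Gy.
rewrite -!(@sylow_proj_constt _ _ G) ?groupM // /sylow_proj.
have dpG := nilpotent_pcoreC p nilG.
have [_ _ cO _] := dprodP dpG.
apply: (@divgrM _ _ _ G) => //; apply/complP.
by have [_ /= defG _ tiO] := dprodP dpG.
Qed.

Lemma zexpg_constt (gT : finGroupType) (p : nat) (x : gT) (z : int) :
  (zexpg x z).`_p = zexpg x.`_p z.
Proof. by case: z => k; rewrite /= ?consttV consttX. Qed.

(** This is how the order of a concrete model becomes a lower bound for a presented group. *)
Lemma presented_dvdn (gT hT : finGroupType) (g : seq gT) (R : relations) (s : seq hT) :
  presented_by [set: gT] g R -> R hT s -> #|<<[set x in s]>>| %| #|gT|.
Proof.
case=> genG _ univ /univ[f [fM def_s]].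
pose fm := Morphism (D := [set: gT]) fM.
have -> : <<[set x in s]>> = fm @* [set: gT].
  have <- : fm @* <<[set x in g]>> = fm @* [set: gT] by rewrite genG.
  rewrite morphim_gen ?subsetT // morphimEsub ?subsetT //.
  congr <<_>>; apply/setP=> v; rewrite inE -def_s; apply/mapP/imsetP => [] [u gu ->].
    by exists u; rewrite ?inE.
  by exists u; rewrite inE in gu.
by rewrite -cardsT dvdn_morphim.
Qed.

Lemma pnat_dvdn_card_Sylow (gT : finGroupType) (p k : nat) (G J : {group gT}) :
  prime p -> p.-Sylow(G) J -> p ^ k %| #|G| -> p ^ k <= #|J|.
Proof.
move=> p_pr sylJ pk_G; apply: dvdn_leq => //; rewrite (card_Hall sylJ).
by rewrite p_part dvdn_exp2l // -pfactor_dvdn.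
Qed.

Lemma set_seq2 (T : finType) (u v : T) : [set w in [:: u; v]] = [set u; v].
Proof. by apply/setP=> w; rewrite !inE. Qed.

Section MacdonaldSylow.

Variables (alpha : int) (gamma p e M : nat) (gT : finGroupType) (A B : gT).
Hypotheses (p_pr : prime p) (p_odd : odd p).
Hypothesis presG : presented_by [set: gT] [:: A; B] (macdonald_rel alpha gamma).
Hypothesis nilG : nilpotent [set: gT].
Variable J : {group gT}.
Hypothesis sylJ : p.-Sylow([set: gT]) J.
Hypotheses (gT_le : #|gT| <= M).
Hypothesis alphaX_e : ((p ^ M)%N%:Z %| (alpha ^+ gamma - (1 + e)%N%:Z)%R)%Z.
Hypotheses (e_gt0 : 0 < e) (m_gt0 : 0 < logn p e) (e_mod : p = 3 -> (1 + e) %% 9 <> 7).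
Hypothesis m_M : logn p e < M.

Let a := A.`_p.
Let b := B.`_p.
Let c := [~ a, b].
Let m := logn p e.

Definition constt_morphism := Morphism (D := [set: gT]) (@constt_morph _ p _ nilG).
Let prm := constt_morphism.

Lemma constt_commg : c = [~ A, B].`_p.
Proof. by rewrite -[RHS]/(prm _) morphR ?inE. Qed.

Lemma zexpg_p_elt (u : gT) : p.-elt u -> zexpg u (alpha ^+ gamma)%R = u ^+ (1 + e).
Proof. by move=> p_u; apply: zexpg_mod alphaX_e; apply: p_elt_expn. Qed.

Lemma macdonald_ac : a ^ c = a ^+ (1 + e).
Proof.
have [_ [A_C _] _] := presG.
by rewrite constt_commg -zexpg_p_elt ?p_elt_constt // -zexpg_constt -A_C -[RHS]/(prm _) morphJ ?inE.
Qed.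

Lemma macdonald_bc : b ^ c^-1 = b ^+ (1 + e).
Proof.
have [_ [_ B_C] _] := presG.
rewrite constt_commg -zexpg_p_elt ?p_elt_constt // -zexpg_constt -B_C -[RHS]/(prm _) morphJ ?inE //=.
by rewrite consttV.
Qed.

Lemma Sylow_pcore : J :=: 'O_p([set: gT]).
Proof. exact: nilpotent_Hall_pcore. Qed.

Lemma Sylow_constt u : u.`_p \in J.
Proof.
rewrite Sylow_pcore (mem_normal_Hall (nilpotent_pcore_Hall p nilG)) ?pcore_normal ?p_elt_constt //.
by rewrite inE.
Qed.

Lemma Sylow_constt_id u : u \in J -> u.`_p = u.
Proof. by move=> Ju; apply/constt_p_elt/(mem_p_elt (pHall_pgroup sylJ)). Qed.

Lemma macdonald_sylow_gen : J :=: <<[set a; b]>>.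
Proof.
have [genG _ _] := presG.
have -> : J :=: prm @* [set: gT].
  apply/setP=> u; apply/idP/morphimP => [Ju | [v _ _ ->]]; last exact: Sylow_constt.
  by exists u; rewrite ?inE //= Sylow_constt_id.
have <- : prm @* <<[set u in [:: A; B]]>> = prm @* [set: gT] by rewrite genG.
rewrite morphim_gen ?subsetT // set_seq2 morphimEsub ?subsetT //.
by rewrite imsetU !imset_set1.
Qed.

Lemma sylow_pgroup : p.-group J. Proof. exact: pHall_pgroup sylJ. Qed.

Lemma Sylow_card : #|J| = (p ^ (7 * m))%N.
Proof.
have le := macdonald_card_le p_pr p_odd m_gt0 e_gt0 (erefl _) e_mod sylow_pgroup macdonald_sylow_gen macdonald_ac macdonald_bc.
apply/eqP; rewrite eqn_leq le /=; apply: (pnat_dvdn_card_Sylow p_pr sylJ).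
have pm_alphaX : ((p ^ m)%N%:Z %| (alpha ^+ gamma - 1)%R)%Z.
  rewrite (_ : _ - _ = alpha ^+ gamma - (1 + e)%N%:Z + e%:Z)%R; last by rewrite PoszD; ring.
  apply: rpredD; last by rewrite dvdzE /= pfactor_dvdnn.
  by apply: dvdz_trans alphaX_e; rewrite dvdzE dvdn_exp2l // ltnW.
(* For gamma = 1 Wamsley's relations for alpha^gamma are Macdonald's, since Z = [X, Y]. *)
have [|T [X [Y [Z [[hX hY hZ]]]]]] :=
  @wamsley_model (alpha ^+ gamma)%R 1 p m 0 p_pr p_odd m_gt0 pm_alphaX (dvd1n 1).
  by rewrite addn0 expr1.
have -> : (7 * m + 4 * 0 = 7 * m)%N by rewrite muln0 addn0.
rewrite expg1 in hZ => dv; apply: dvdn_trans dv _; rewrite cardsT.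
have -> : <<[set u in [:: X; Y; Z]]>> = <<[set u in [:: X; Y]]>>.
  apply/eqP; rewrite eqEsubset !gen_subG; apply/andP; split; apply/subsetP=> u.
    rewrite !inE => /or3P[] /eqP->; rewrite ?hZ ?groupR // mem_gen // !inE eqxx ?orbT //.
  by rewrite !inE => u_s; rewrite mem_gen // !inE; case/orP: u_s => ->; rewrite ?orbT.
apply: (presented_dvdn presG); rewrite /macdonald_rel -hZ.
by split.
Qed.

End MacdonaldSylow.

(** * Maps determined on generators and homomorphisms into arbitrary groups *)

Lemma in_morph1 (gT : finGroupType) (H : groupType) (G : {group gT}) (f : gT -> H) :
  {in G &, {morph f : x y / x * y}} -> f 1 = 1.
Proof. by move=> fM; apply: (mulgI (f 1)); rewrite -fM ?group1 // !mulg1. Qed.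

Lemma morph_gen_eq (gT : finGroupType) (H : groupType) (G : {group gT}) (S : {set gT})
    (f g : gT -> H) : G :=: <<S>> ->
    {in G &, {morph f : x y / x * y}} -> {in G &, {morph g : x y / x * y}} ->
  (forall s, s \in S -> f s = g s) -> forall u, u \in G -> f u = g u.
Proof.
move=> defG fM gM eqS.
have K_group : group_set [set u in G | f u == g u].
  apply/group_setP; split=> [|u v].
    by rewrite inE group1 (in_morph1 fM) (in_morph1 gM) eqxx.
  rewrite !inE => /andP[Gu /eqP eq_u] /andP[Gv /eqP eq_v].
  by rewrite groupM // fM // gM // eq_u eq_v eqxx.
suffices sGK : G \subset Group K_group.
  by move=> u /(subsetP sGK); rewrite inE => /andP[_ /eqP].
rewrite {1}defG gen_subG; apply/subsetP=> s Ss.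
by rewrite inE eqS // eqxx andbT defG mem_gen.
Qed.

(** An endomorphism whose square fixes the generators is its own inverse, so no kernel has to be
    computed. *)
Lemma aut_of_involution (gT : finGroupType) (G : {group gT}) (S : {set gT}) (f : gT -> gT) :
    G :=: <<S>> -> {in G &, {morph f : x y / x * y}} ->
    (forall s, s \in S -> f s \in G /\ f (f s) = s) ->
  exists sigma : {perm gT}, sigma \in Aut G /\ {in G, forall u, sigma u = f u}.
Proof.
move=> defG fM fS; pose fm := Morphism (D := G) fM.
have sSG : S \subset G by rewrite defG subset_gen.
have fG u : u \in G -> f u \in G.
  suffices sfG : fm @* G \subset G.
    by move=> Gu; apply: (subsetP sfG); exact: (mem_morphim fm Gu Gu).
  have -> : fm @* G = fm @* <<S>> by rewrite -defG.
  rewrite morphim_gen // gen_subG morphimEsub //.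
  by apply/subsetP=> _ /imsetP[s /fS[? _] ->].
have ffK u : u \in G -> f (f u) = u.
  move=> Gu; apply: (@morph_gen_eq _ _ G S (fun u => f (f u)) id) => //.
    by move=> v w Gv Gw; rewrite !fM ?fG.
  by move=> s /fS[].
have f_inj : 'injm fm by apply/injmP=> u v Gu Gv /= eq_f; rewrite -(ffK u) // eq_f ffK.
have fGG : fm @* G = G.
  apply/eqP; rewrite eqEcard card_injm // leqnn andbT morphimEdom.
  by apply/subsetP=> _ /imsetP[u Gu ->]; exact: fG.
exists (aut f_inj fGG); split; first exact: Aut_aut.
by move=> u Gu; rewrite autE.
Qed.

Lemma expg_coprime_eq1 (H : groupType) (v : H) i j :
  coprime i j -> 0 < i -> v ^+ i = 1 -> v ^+ j = 1 -> v = 1.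
Proof.
move=> co_ij i_gt0 vi vj; have [k l kl _] := egcdnP j i_gt0.
have : v ^+ (k * i)%N = 1 by rewrite mulnC expgnA vi expg1n.
by rewrite kl (eqP co_ij) expgnDr expg1 mulnC expgnA vj expg1n mul1g.
Qed.

Section TotalMorphism.

Variables (gT : finGroupType) (H : groupType) (f : gT -> H).
Hypothesis fM : {morph f : u v / u * v}.

Lemma tmorph1 : f 1 = 1.
Proof. by apply: (mulgI (f 1)); rewrite -fM !mulg1. Qed.

Lemma tmorphX u k : f (u ^+ k) = f u ^+ k.
Proof. by elim: k => [|k IHk]; rewrite ?tmorph1 // !expgS fM IHk. Qed.

Lemma tmorphV u : f u^-1 = (f u)^-1.
Proof. by apply: (mulIg (f u)); rewrite -fM !mulVg tmorph1. Qed.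

Lemma tmorphJ u v : f (u ^ v) = f u ^ f v.
Proof. by rewrite !conjgE !fM tmorphV. Qed.

Lemma tmorphR u v : f [~ u, v] = [~ f u, f v].
Proof. by rewrite !commgEl fM tmorphV tmorphJ. Qed.

(** The p'-part of u is a power of u, so its image is killed both by p^k and by an exponent prime to
    p. *)
Lemma tmorph_constt (p k : nat) u : prime p -> f u ^+ (p ^ k) = 1 -> f u.`_p = f u.
Proof.
move=> p_pr fu1; set w := u.`_p^'.
suffices fw : f w = 1 by rewrite -{2}(consttC p u) fM fw mulg1.
have p'w : (p : nat_pred)^'.-elt w by apply: p_elt_constt.
apply: (@expg_coprime_eq1 _ _ (p ^ k) #[w]).
- by rewrite coprimeXl // (pnat_coprime (pnat_id p_pr)).
- by rewrite expn_gt0 prime_gt0.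
- have /cycleP[i ->] : w \in <[u]> by rewrite groupX ?cycle_id.
  by rewrite tmorphX -expgnA mulnC expgnA fu1 expg1n.
- by rewrite -tmorphX expg_order tmorph1.
Qed.

Lemma tmorph_gen1 (S : {set gT}) : (forall s, s \in S -> f s = 1) ->
  forall u, u \in <<S>> -> f u = 1.
Proof.
move=> fS u Su; rewrite -[RHS]/((fun=> 1) u : H).
apply: (@morph_gen_eq _ _ <<S>>%G S f (fun=> 1)) => //.
by move=> v w _ _; rewrite /= mulg1.
Qed.

End TotalMorphism.

Lemma in_morphV (gT : finGroupType) (H : groupType) (G : {group gT}) (f : gT -> H) :
  {in G &, {morph f : x y / x * y}} -> {in G, forall u, f u^-1 = (f u)^-1}.
Proof.
by move=> fM u Gu; apply: (mulIg (f u)); rewrite -fM ?groupV // !mulVg (in_morph1 fM).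
Qed.

Lemma quotient_rel_swap (alpha : int) (gamma p m h : nat) (H : groupType) (a b c : H) :
  quotient_rel alpha gamma p m h [:: a; b; c] ->
  quotient_rel alpha gamma p m h [:: b; a; c^-1].
Proof.
case=> [[def_c ac bc] [ha hab hb hc]]; split; split=> //.
- by rewrite def_c invgR.
- by rewrite invgK.
- by rewrite -(mulg1_eq hab) mulVg.
- by rewrite expVgn hc invg1.
Qed.

Lemma sylowW_rel_swap (alpha : int) (gamma p m h n q k : nat) (H : groupType) (a b c d : H) :
  sylowW_rel alpha gamma p m h n q k [:: a; b; c; d] ->
  sylowW_rel alpha gamma p m h n q k [:: b; a; c^-1; d^-1].
Proof.
case=> /quotient_rel_swap rel [ad bd dpn]; split=> //; split; rewrite ?invgK //.
by rewrite !expVgn dpn.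
Qed.

(** * The Sylow subgroup of the Wamsley group *)

Section WamsleySylow.

Variables (alpha : int) (gamma p x e M : nat) (gT wT : finGroupType) (A B : gT) (X Y Z : wT).
Hypotheses (p_pr : prime p) (p_odd : odd p) (gamma_gt0 : 0 < gamma).
Hypothesis presG : presented_by [set: gT] [:: A; B] (macdonald_rel alpha gamma).
Hypothesis nilG : nilpotent [set: gT].
Hypothesis presW : presented_by [set: wT] [:: X; Y; Z] (wamsley_rel alpha gamma).
Variable phi : {morphism [set: gT] >-> wT}.
Hypotheses (phiA : phi A = X) (phiB : phi B = Y).
Variables (J : {group gT}) (P : {group wT}).
Hypotheses (sylJ : p.-Sylow([set: gT]) J) (sylP : p.-Sylow([set: wT]) P).
Hypotheses (gT_le : #|gT| <= M) (wT_le : #|wT| <= M).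
Hypothesis alpha_x : ((p ^ M)%N%:Z %| (alpha - x.+1%:Z)%R)%Z.
Hypothesis alphaX_e : ((p ^ M)%N%:Z %| (alpha ^+ gamma - (1 + e)%N%:Z)%R)%Z.
Hypotheses (x_gt0 : 0 < x) (e_gt0 : 0 < e) (h_gt0 : 0 < logn p x).
Hypothesis e_mod : p = 3 -> (1 + e) %% 9 <> 7.
Hypothesis logn_e : logn p e = (logn p x + logn p gamma)%N.
Hypothesis m_M : logn p e < M.

Let h := logn p x.
Let n := logn p gamma.
Let m := logn p e.
Let a := A.`_p.
Let b := B.`_p.
Let c := [~ a, b].
Let a1 := phi a.
Let b1 := phi b.
Let c1 := phi c.
Let Np := ('ker phi :&: J)%G.

Let m_gt0 : 0 < m. Proof. by rewrite /m logn_e addn_gt0 h_gt0. Qed.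
Let ac : a ^ c = a ^+ (1 + e).
Proof. exact: macdonald_ac p_pr presG nilG gT_le alphaX_e. Qed.
Let bc : b ^ c^-1 = b ^+ (1 + e).
Proof. exact: macdonald_bc p_pr presG nilG gT_le alphaX_e. Qed.
Let defJ : J :=: <<[set a; b]>>.
Proof. by have := macdonald_sylow_gen presG nilG sylJ. Qed.
Let cardJ : #|J| = (p ^ (7 * m))%N.
Proof.
by have := Sylow_card p_pr p_odd presG nilG sylJ gT_le alphaX_e e_gt0 m_gt0 e_mod m_M.
Qed.
Let pJ : p.-group J. Proof. exact: sylow_pgroup sylJ. Qed.

Let Ja : a \in J. Proof. by rewrite defJ mem_gen // !inE eqxx. Qed.
Let Jb : b \in J. Proof. by rewrite defJ mem_gen // !inE eqxx orbT. Qed.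
Let Jc : c \in J. Proof. by rewrite groupR. Qed.

Lemma a1E : a1 = X.`_p. Proof. by rewrite /a1 morph_constt ?inE // phiA. Qed.
Lemma b1E : b1 = Y.`_p. Proof. by rewrite /b1 morph_constt ?inE // phiB. Qed.
Lemma c1E : c1 = [~ a1, b1]. Proof. by rewrite /c1 morphR ?inE. Qed.

(** As a power of Z, c1 commutes with Z, which is what [central_powers] asks of z. *)
Lemma c1Z : c1 = (Z ^+ gamma).`_p.
Proof.
have [_ [_ _ ->] _] := presW.
by rewrite /c1 /c (constt_commg p A B nilG) morph_constt ?inE // morphR ?inE // phiA phiB.
Qed.

Lemma zexpg_alpha (u : wT) : p.-elt u -> zexpg u alpha = u ^+ x.+1.
Proof. by move=> p_u; apply: zexpg_mod alpha_x; apply: p_elt_expn. Qed.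

Lemma a1_Z : a1 ^ Z = a1 ^+ x.+1.
Proof.
have [_ [XZ _ _] _] := presW.
by rewrite -zexpg_alpha ?a1E ?p_elt_constt // -consttJ XZ zexpg_constt.
Qed.

Lemma b1_Z : (b1 ^+ x.+1) ^ Z = b1.
Proof.
have [_ [_ YZ _] _] := presW.
by rewrite -zexpg_alpha ?b1E ?p_elt_constt // -zexpg_constt -YZ consttJ conjgKV.
Qed.

Lemma c1_Z : c1 ^ Z = c1.
Proof.
rewrite c1Z; apply/conjg_fixP/commgP/commute_sym/commuteX.
exact: commuteX.
Qed.

Lemma logn_dvd_e : p ^ m %| e. Proof. exact: pfactor_dvdnn. Qed.
Lemma m_hn : m = (h + n)%N. Proof. exact: logn_e. Qed.

(** This is [central_powers] with z = Z, where [x.+1] stands for alpha. The relevant w is now e *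
    Tsum e (x + 1), with p-part p^(m+h) in place of p^(2m). *)
Lemma image_powers :
  [/\ a1 ^+ (p ^ (m + 2 * h)) = 1, a1 ^+ (p ^ (m + h)) * b1 ^+ (p ^ (m + h)) = 1,
      b1 ^+ (p ^ (m + 2 * h)) = 1 & c1 ^+ (p ^ (m + h)) = 1].
Proof.
have p_gt0 := prime_gt0 p_pr.
have h_le : 0 < h <= m by rewrite h_gt0 m_hn leq_addr.
have x_max : ~~ (p ^ h.+1 %| x) by rewrite pfactor_dvdn // ltnn.
have [t Tt co_pt] := Tsum_val p_pr p_odd m_gt0 logn_dvd_e h_le (pfactor_dvdnn p x) x_max e_mod.
have [x0 co_x0 def_x] := pfactor_coprime p_pr x_gt0.
have [e0 co_e0 def_e] := pfactor_coprime p_pr e_gt0.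
have pos k : coprime p k -> 0 < k.
  by case: k => //; rewrite /coprime gcdn0 => /eqP p1; have := prime_gt1 p_pr; rewrite p1.
have p_e : p %| e by rewrite (dvdn_trans _ logn_dvd_e) // dvdn_exp.
have p_x : p %| x by rewrite (dvdn_trans _ (pfactor_dvdnn p x)) // dvdn_exp.
have p_a1 : p.-elt a1 by rewrite a1E p_elt_constt.
have p_b1 : p.-elt b1 by rewrite b1E p_elt_constt.
have := @central_powers wT a1 b1 Z p x e (p ^ (m + h)) h p_pr p_odd p_a1 p_b1 a1_Z b1_Z.
rewrite -c1E => /(_ c1_Z).
have ac1 : a1 ^ c1 = a1 ^+ (1 + e) by rewrite /a1 /c1 -morphJ ?inE // ac morphX ?inE.
have bc1 : b1 ^ c1^-1 = b1 ^+ (1 + e).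
  by rewrite /b1 /c1 -morphV ?inE // -morphJ ?inE // bc morphX ?inE.
move=> /(_ ac1 bc1 p_e p_x x0); rewrite {1}mulnC => /(_ def_x co_x0 (e0 * t)%N).
have wE : (e * Tsum e x.+1 = p ^ (m + h) * (e0 * t))%N.
  by rewrite Tt {1}def_e expnD -/m; ring.
have co_et : coprime p (e0 * t) by rewrite coprimeMr co_e0.
move=> /(_ wE co_et (pos _ co_et)).
have PT : p ^ (m + h) * p ^ h %| e * Tsum e (p ^ (m + h)).
  have d_le : m + h <= 2 * m by rewrite mul2n -addnn leq_add2l m_hn leq_addr.
  have dT := dvdn_Tsum p_pr p_odd m_gt0 logn_dvd_e d_le (dvdnn _).
  apply: dvdn_trans (dvdn_mul logn_dvd_e dT).
  by rewrite -!expnD dvdn_exp2l // addnC leq_add2r m_hn leq_addr.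
case/(_ PT) => h1 h2 h3 h4 _.
have -> : (p ^ (m + 2 * h) = p ^ (m + h) * p ^ h)%N by rewrite -expnD -addnA addnn mul2n.
by split.
Qed.

Lemma image_factor u : u \in phi @* J -> u \in <[a1]> * (<[b1]> * <[c1]>).
Proof.
case/morphimP=> v _; rewrite (macdonald_factor p_pr p_odd m_gt0 e_gt0 (erefl _) e_mod pJ defJ ac bc).
case/mulsgP=> _ _ /cycleP[i ->] /mulsgP[_ _ /cycleP[j ->] /cycleP[k ->] ->] -> ->.
rewrite !morphM ?inE //.
rewrite (morphX phi i (in_setT a)) (morphX phi j (in_setT b)) (morphX phi k (in_setT c)).
by apply: mem_mulg; [|apply: mem_mulg]; apply: mem_cycle.
Qed.

Lemma image_nf u : u \in phi @* J ->
  exists w : 'I_(p ^ (m + 2 * h)) * 'I_(p ^ (m + h)) * 'I_(p ^ (m + h)),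
    u = a1 ^+ w.1.1 * b1 ^+ w.1.2 * c1 ^+ w.2.
Proof.
have [ha hab _ hc] := image_powers.
by move/image_factor; apply: factor_normal_form; rewrite ?expn_gt0 ?prime_gt0.
Qed.

Lemma card_nf : #|{: 'I_(p ^ (m + 2 * h)) * 'I_(p ^ (m + h)) * 'I_(p ^ (m + h))}|
  = (p ^ (7 * h + 3 * n))%N.
Proof.
by rewrite !card_prod !card_ord -!expnD m_hn; congr (_ ^ _)%N; clear; lia.
Qed.

Lemma image_card_le : #|phi @* J| <= p ^ (7 * h + 3 * n).
Proof.
pose f (w : 'I_(p ^ (m + 2 * h)) * 'I_(p ^ (m + h)) * 'I_(p ^ (m + h))) :=
  a1 ^+ w.1.1 * b1 ^+ w.1.2 * c1 ^+ w.2.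
have sJ : phi @* J \subset f @: setT.
  by apply/subsetP=> u /image_nf[w ->]; apply/imsetP; exists w.
rewrite -card_nf -cardsT.
exact: leq_trans (subset_leq_card sJ) (leq_imset_card _ _).
Qed.

(** * The orders of W_p and of the image of G_p *)

Let D := (phi @* [set: gT])%G.

Lemma D_gen : D :=: <[X]> <*> <[Y]>.
Proof.
have [genG _ _] := presG.
rewrite /=; have <- : phi @* <<[set u in [:: A; B]]>> = phi @* [set: gT] by rewrite genG.
rewrite morphim_gen ?subsetT // set_seq2 morphimEsub ?subsetT // imsetU !imset_set1 phiA phiB.
by rewrite joing_idl joing_idr.
Qed.

Lemma cycle_norm_zexpg (hT : finGroupType) (u z : hT) k : u ^ z = zexpg u k -> z \in 'N(<[u]>).
Proof.
move=> uz; rewrite inE -genJ gen_subG conjg_set1 sub1set uz.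
by case: k {uz} => k /=; rewrite ?groupV mem_cycle.
Qed.

Lemma D_normal : D <| [set: wT].
Proof.
have [genW [XZ YZ _] _] := presW.
have DX : X \in D by rewrite -phiA mem_morphim ?inE.
have DY : Y \in D by rewrite -phiB mem_morphim ?inE.
rewrite /normal subsetT -genW gen_subG; apply/subsetP=> u; rewrite inE !in_cons in_nil orbF.
case/or3P=> /eqP->; [exact: (subsetP (normG D)) | exact: (subsetP (normG D)) |].
rewrite D_gen; apply: (subsetP (normsY (A := [set Z]) _ _)); rewrite ?set11 // sub1set.
  exact: cycle_norm_zexpg XZ.
by rewrite -groupV; apply: cycle_norm_zexpg YZ.
Qed.

Lemma W_quotient : [set: wT] / D = <[coset D Z]>.
Proof.
have [genW _ _] := presW.
have NZ u : u \in 'N(D) by rewrite (subsetP (normal_norm D_normal)) ?inE.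
have DX : X \in D by rewrite -phiA mem_morphim ?inE.
have DY : Y \in D by rewrite -phiB mem_morphim ?inE.
apply/eqP; rewrite eqEsubset cycle_subG mem_quotient ?inE // andbT.
rewrite -{1}genW quotient_gen ?gen_subG; last by apply/subsetP.
apply/subsetP=> _ /morphimP[u _ + ->]; rewrite inE !in_cons in_nil orbF.
case/or3P=> /eqP->; [by rewrite /= (coset_id DX) group1 | by rewrite /= (coset_id DY) group1 | exact: cycle_id].
Qed.

Lemma W_index : #|[set: wT] / D| %| gamma.
Proof.
have [_ [_ _ Zg] _] := presW.
have NZ u : u \in 'N(D) by rewrite (subsetP (normal_norm D_normal)) ?inE.
rewrite W_quotient -orderE order_dvdn -morphX //= coset_id // Zg.
by rewrite -phiA -phiB groupR ?mem_morphim ?inE.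
Qed.

(** The order of W_p is the product of two factors: the image of G_p has order at most p^(7h+3n),
    and the p-part of W/D is at most p^n. The model bounds this product from below by p^(7h+4n), so
    both bounds are attained. *)
Lemma W_cards : [/\ #|phi @* J| = (p ^ (7 * h + 3 * n))%N,
  (#|[set: wT] / D|`_p = p ^ n)%N & #|P| = (p ^ (7 * h + 4 * n))%N].
Proof.
have cardP : #|P| = (#|phi @* J| * #|[set: wT] / D|`_p)%N.
  rewrite (card_Hall sylP) -(Lagrange (normal_sub D_normal)) partnM ?indexg_gt0 //.
  rewrite -(card_quotient (normal_norm D_normal)); congr (_ * _)%N.
  by rewrite -(card_Hall (morphim_pHall phi (subsetT _) sylJ)).
have le1 := image_card_le.
have le2 : (#|[set: wT] / D|`_p <= p ^ n)%N.
  apply: leq_trans (dvdn_leq _ (partn_dvd p gamma_gt0 W_index)) _; first exact: part_gt0.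
  by rewrite p_part.
have ge : p ^ (7 * h + 4 * n) <= #|P|.
  apply: (pnat_dvdn_card_Sylow p_pr sylP).
  have ph_alpha : ((p ^ h)%N%:Z %| (alpha - 1)%R)%Z.
    rewrite (_ : _ - _ = alpha - x.+1%:Z + x%:Z)%R; last by rewrite -addn1 PoszD; ring.
    apply: rpredD; last by rewrite dvdzE /= pfactor_dvdnn.
    apply: dvdz_trans alpha_x; rewrite dvdzE dvdn_exp2l // ltnW //.
    by apply: leq_ltn_trans m_M; rewrite logn_e leq_addr.
  have pm_alphaX : ((p ^ (h + n))%N%:Z %| (alpha ^+ gamma - 1)%R)%Z.
    rewrite (_ : _ - _ = alpha ^+ gamma - (1 + e)%N%:Z + e%:Z)%R; last by rewrite PoszD; ring.
    apply: rpredD; last by rewrite dvdzE /= -m_hn pfactor_dvdnn.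
    by apply: dvdz_trans alphaX_e; rewrite dvdzE dvdn_exp2l // -m_hn ltnW.
  have [T [X' [Y' [Z' [rel dv]]]]] :=
    @wamsley_model alpha gamma p h n p_pr p_odd h_gt0 ph_alpha (pfactor_dvdnn p gamma) pm_alphaX.
  by apply: dvdn_trans dv _; rewrite cardsT; apply: presented_dvdn presW rel.
have pe : (p ^ (7 * h + 4 * n) = p ^ (7 * h + 3 * n) * p ^ n)%N.
  by rewrite -expnD; congr (_ ^ _)%N; clear; lia.
have pn_gt0 : 0 < p ^ n by rewrite expn_gt0 prime_gt0.
have pk_gt0 : 0 < p ^ (7 * h + 3 * n) by rewrite expn_gt0 prime_gt0.
rewrite cardP pe in ge.
have eq1 : #|phi @* J| = (p ^ (7 * h + 3 * n))%N.
  apply/eqP; rewrite eqn_leq le1 -(leq_pmul2r pn_gt0); apply: leq_trans ge _.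
  by rewrite leq_mul2l le2 orbT.
have eq2 : (#|[set: wT] / D|`_p = p ^ n)%N.
  by apply/eqP; rewrite eqn_leq le2 -(leq_pmul2l pk_gt0) -{2}eq1.
by rewrite cardP eq1 eq2 pe.
Qed.

Let nN u : u \in 'N(Np).
Proof.
have nK : Np <| [set: gT].
  apply: normalI; first by rewrite ker_normal.
  by rewrite (Sylow_pcore nilG sylJ) pcore_normal.
by rewrite (subsetP (normal_norm nK)) ?inE.
Qed.

Let nNJ : J \subset 'N(Np). Proof. by apply/subsetP=> u _; exact: nN. Qed.

Let NpJ : Np <| J.
Proof. by rewrite /normal nNJ andbT subsetIr. Qed.

Lemma mem_Np u : (u \in Np) = (phi u == 1) && (u \in J).
Proof. by rewrite in_setI; congr (_ && _); apply/kerP/eqP => //; rewrite inE. Qed.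

Lemma card_quotient_Np : #|J / Np| = (p ^ (7 * h + 3 * n))%N.
Proof.
have [<- _ _] := W_cards.
by rewrite card_quotient // card_morphim setTI -[RHS]indexgI [J :&: _]setIC.
Qed.

(** The power relations in W give one inclusion, and both groups have order p^(7m - 7h - 3n) =
    p^(4n). *)
Lemma kernel_gen : Np :=: Ngen a b p m h.
Proof.
have [ha hab hb hc] := image_powers.
apply/esym/eqP; rewrite eqEcard; apply/andP; split.
  rewrite gen_subG; apply/subsetP=> u /setUP[/set2P[] -> | /set1P ->]; rewrite mem_Np.
  - by rewrite (morphX phi _ (in_setT a)) ha eqxx groupX.
  - rewrite morphM ?inE // (morphX phi _ (in_setT a)) (morphX phi _ (in_setT b)) hab eqxx.
    by apply: groupM; apply: groupX.
  - by rewrite (morphX phi _ (in_setT c)) hc eqxx groupX.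
rewrite (card_Ngen p_pr p_odd m_gt0 e_gt0 (erefl _) e_mod pJ defJ ac bc cardJ m_hn).
rewrite -(leq_pmul2r (_ : 0 < p ^ (7 * h + 3 * n))) ?expn_gt0 ?prime_gt0 //.
rewrite -expnD -{1}card_quotient_Np card_quotient // Lagrange ?normal_sub // cardJ.
by rewrite leq_exp2l ?prime_gt1 // m_hn; clear; lia.
Qed.

Lemma coset_morphT : {morph coset Np : u v / u * v}.
Proof. by move=> u v; rewrite morphM. Qed.

Lemma mem_quotientP w : w \in J / Np -> exists2 v, v \in J & w = coset Np v.
Proof. by case/morphimP=> v _ Jv ->; exists v. Qed.

(** * Presentation and normal form of G_p/N_p *)

Let a0 := coset Np a.
Let b0 := coset Np b.
Let c0 := coset Np c.

Lemma zexpg_alphaX (u : gT) : p.-elt u -> zexpg u (alpha ^+ gamma)%R = u ^+ (1 + e).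
Proof. exact: (zexpg_p_elt p_pr gT_le alphaX_e). Qed.

Lemma quotient_relations : quotient_rel alpha gamma p m h [:: a0; b0; c0].
Proof.
have fM := coset_morphT.
have Nker u : u \in Np -> coset Np u = 1 by apply: coset_id.
have Ng := kernel_gen.
split; split.
- by rewrite /c0 (tmorphR fM).
- by rewrite -(tmorphJ fM) ac -zexpg_alphaX ?p_elt_constt // (zexpg_morph _ _ fM).
- by rewrite -(tmorphV fM) -(tmorphJ fM) bc -zexpg_alphaX ?p_elt_constt // (zexpg_morph _ _ fM).
- by rewrite -(tmorphX fM) Nker // Ng mem_gen // !inE eqxx.
- by rewrite -!(tmorphX fM) -fM Nker // Ng mem_gen // !inE eqxx orbT.
- rewrite -(tmorphX fM) Nker // Ng.
  rewrite (Ngen_swap p_pr p_odd m_gt0 e_gt0 (erefl _) e_mod pJ defJ ac bc cardJ m_hn).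
  by rewrite mem_gen // !inE eqxx.
- by rewrite -(tmorphX fM) Nker // Ng mem_gen // !inE eqxx !orbT.
Qed.

Section UniversalProperty.

Variables (H : groupType) (a' b' c' : H).
Hypothesis rel' : quotient_rel alpha gamma p m h [:: a'; b'; c'].

(** The first three relations extend A, B to a map on G, and the power relations do the rest: a' and
    b' have p-power order, so passing to p-parts changes nothing, and the generators of N_p found in
    [kernel_gen] are sent to 1. *)
Lemma lift_exists : exists f : gT -> H,
  [/\ {morph f : u v / u * v}, f a = a', f b = b', f c = c' &
      forall u, u \in Np -> f u = 1].
Proof.
have [_ _ univ] := presG; have [[def_c ac' bc'] [ha hab hb hc]] := rel'.
have [|f [fM' [fA fB]]] := univ H [:: a'; b'].
  by rewrite /macdonald_rel -def_c.
have fM : {morph f : u v / u * v} by move=> u v; rewrite fM' ?inE.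
have fa : f a = a' by rewrite (tmorph_constt fM (k := m + 2 * h) p_pr) ?fA.
have fb : f b = b' by rewrite (tmorph_constt fM (k := m + 2 * h) p_pr) ?fB.
have fc : f c = c' by rewrite (tmorphR fM) fa fb.
exists f; split=> // u; rewrite kernel_gen; apply: (tmorph_gen1 fM) => {}u.
case/setUP=> [/set2P[] -> | /set1P ->].
- by rewrite (tmorphX fM a) fa.
- by rewrite fM (tmorphX fM a) (tmorphX fM b) fa fb.
- by rewrite (tmorphX fM c) fc.
Qed.

Lemma quotient_lift_exists : exists f0 : coset_of Np -> H,
  {in J / Np &, {morph f0 : u v / u * v}} /\ map f0 [:: a0; b0; c0] = [:: a'; b'; c'].
Proof.
have [f [fM fa fb fc fN]] := lift_exists.
have f0E v : f (repr (coset Np v)) = f v.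
  have : repr (coset Np v) \in Np :* v by rewrite -val_coset ?nN // mem_repr_coset.
  by case/rcosetP=> w Nw ->; rewrite fM fN // mul1g.
exists (fun u => f (repr u)); split; last by rewrite /= !f0E fa fb fc.
move=> _ _ /mem_quotientP[u _ ->] /mem_quotientP[v _ ->].
by rewrite -coset_morphT !f0E fM.
Qed.

End UniversalProperty.

Lemma quotient_gen_abc : <<[set u in [:: a0; b0; c0]]>> = J / Np.
Proof.
apply/eqP; rewrite eqEsubset gen_subG; apply/andP; split.
  apply/subsetP=> u; rewrite !inE => /or3P[] /eqP->; exact: mem_quotient.
rewrite {1}defJ quotient_gen ?gen_subG; last by apply/subsetP=> u _.
apply/subsetP=> _ /morphimP[u _ /set2P[] -> ->]; rewrite /= mem_gen // !inE eqxx ?orbT //.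
Qed.

Lemma quotient_presented :
  presented_by (J / Np) [:: a0; b0; c0] (quotient_rel alpha gamma p m h).
Proof.
split; [exact: quotient_gen_abc | exact: quotient_relations |].
move=> H [|a' [|b' [|c' [|d' s]]]] //; exact: quotient_lift_exists.
Qed.

Lemma quotient_nf u : u \in J / Np ->
  exists! w : 'I_(p ^ (m + 2 * h)) * 'I_(p ^ (m + h)) * 'I_(p ^ (m + h)),
    u = a0 ^+ w.1.1 * b0 ^+ w.1.2 * c0 ^+ w.2.
Proof.
have [_ [ha hab hb hc]] := quotient_relations.
have fM := coset_morphT.
have ex v : v \in J / Np -> exists w : 'I_(p ^ (m + 2 * h)) * 'I_(p ^ (m + h)) * 'I_(p ^ (m + h)),
    v = a0 ^+ w.1.1 * b0 ^+ w.1.2 * c0 ^+ w.2.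
  case/mem_quotientP=> v'; rewrite (macdonald_factor p_pr p_odd m_gt0 e_gt0 (erefl _) e_mod pJ defJ ac bc).
  case/mulsgP=> _ _ /cycleP[i ->] /mulsgP[_ _ /cycleP[j ->] /cycleP[k ->] ->] -> ->.
  apply: factor_normal_form; rewrite ?expn_gt0 ?prime_gt0 //.
  rewrite !fM (tmorphX fM a i) (tmorphX fM b j) (tmorphX fM c k).
  by apply: mem_mulg; [|apply: mem_mulg]; apply: mem_cycle.
have [|_] := surj_card_unique ex; last exact.
by rewrite card_nf card_quotient_Np.
Qed.

(** * The additional generator of W_p *)

Let q := #|[set: gT] / J|.
Let k := (gamma %/ p ^ n)%N.
Let S := (phi @* J)%G.
(** The factor k completes p^n to gamma, and q kills the p'-part of Z^gamma = phi [A, B]. Hence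
    z0^(p^n) = c1^q, which makes z0 a p-element. *)
Let z0 := Z ^+ (q * k).
Let kap := (x.+1 ^ (q * k))%N.

Let Sa : a1 \in S. Proof. by rewrite mem_morphim ?inE. Qed.
Let Sb : b1 \in S. Proof. by rewrite mem_morphim ?inE. Qed.
Let Sc : c1 \in S. Proof. by rewrite mem_morphim ?inE. Qed.

Lemma J_normal : J <| [set: gT].
Proof. by rewrite (Sylow_pcore nilG sylJ) pcore_normal. Qed.

Lemma image_normal : S <| [set: wT].
Proof.
have sylS : p.-Sylow(D) S by apply: morphim_pHall sylJ; rewrite subsetT.
have nSD : S <| D by apply: morphim_normal J_normal.
rewrite -(normal_Hall_pcore sylS nSD) (char_normal_trans _ D_normal) //.
exact: pcore_char.
Qed.

Lemma image_gen : S :=: <<[set a1; b1]>>.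
Proof.
rewrite /= {1}defJ morphim_gen ?subsetT // morphimEsub ?subsetT //.
by rewrite imsetU !imset_set1.
Qed.

Lemma gamma_pk : gamma = (k * p ^ n)%N.
Proof. by rewrite divnK ?pfactor_dvdnn. Qed.

Lemma p_coprime_qk : coprime p (q * k).
Proof.
rewrite coprimeMr; apply/andP; split.
  rewrite /q card_quotient ?(normal_norm J_normal) // prime_coprime // -p'natE //.
  by have /and3P[] := sylJ.
have [k' co_k' def_g] := pfactor_coprime p_pr gamma_gt0.
by rewrite /k {1}def_g mulnK ?expn_gt0 ?prime_gt0.
Qed.

Lemma z0_pn : z0 ^+ (p ^ n) = c1 ^+ q.
Proof.
have [_ [_ _ Zg] _] := presW.
have -> : z0 ^+ (p ^ n) = (Z ^+ gamma) ^+ q.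
  by rewrite -!expgM {1}gamma_pk; congr (_ ^+ _); ring.
rewrite c1Z; set w := Z ^+ gamma; rewrite -{1}(consttC p w) expgMn; last first.
  by apply: commuteX2.
suffices -> : w.`_p^' ^+ q = 1 by rewrite mulg1.
have -> : w = phi [~ A, B] by rewrite /w Zg morphR ?inE // phiA phiB.
rewrite -morph_constt ?inE // -(morphX phi q (in_setT _)).
set v := _.`_p^'; suffices -> : v ^+ q = 1 by rewrite morph1.
apply/eqP; rewrite -order_dvdn.
have p'v : (p : nat_pred)^'.-elt v by apply: p_elt_constt.
have co : coprime #[v] #|J|.
  by rewrite coprime_sym; apply: (pnat_coprime pJ p'v).
rewrite -(Gauss_dvdr _ co) /q card_quotient ?(normal_norm J_normal) //.
by rewrite Lagrange ?subsetT // order_dvdG ?inE.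
Qed.

Lemma zexpg_kap (H : groupType) (u : H) : u ^+ (p ^ M) = 1 ->
  zexpg u (alpha ^+ (q * k)%N)%R = u ^+ kap.
Proof. by move=> uM; apply: zexpg_mod (dvdz_subX _ alpha_x). Qed.

Lemma a1_z0 : a1 ^ z0 = a1 ^+ kap.
Proof. exact: conjg_exp_iter a1_Z. Qed.

Lemma b1_z0 : b1 ^ z0^-1 = b1 ^+ kap.
Proof.
rewrite -expVgn; apply: conjg_exp_iter.
by rewrite -{1}b1_Z conjgK.
Qed.

(** W/D is cyclic, generated by the image of Z, with order of p-part p^n, while q k is prime to
    p. *)
Lemma z0_S s : z0 ^+ s \in S -> p ^ n %| s.
Proof.
move=> zS; have NZ u : u \in 'N(D) by rewrite (subsetP (normal_norm D_normal)) ?inE.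
have [_ hpn _] := W_cards.
have : (coset D Z) ^+ (q * k * s) = 1.
  rewrite -morphX //= coset_id // expgM; apply: subsetP zS; exact: morphimS.
move/eqP; rewrite -order_dvdn => dv.
rewrite -(@Gauss_dvdr (p ^ n) (q * k)) ?coprimeXl ?p_coprime_qk //.
by apply: dvdn_trans dv; rewrite orderE -W_quotient -hpn dvdn_part.
Qed.

(* Some conjugate of S <*> <[z0]> is P; as W = <Z> phi(G) and Z, S normalise
   S <*> <[z0]>, the conjugating element may be taken in the p'-part of phi(G),
   which centralises S. *)
Lemma exists_d0 : exists d0 : wT,
  [/\ a1 ^ d0 = a1 ^+ kap, b1 ^ d0^-1 = b1 ^+ kap, d0 ^+ (p ^ n) = c1 ^+ q,
      P :=: S <*> <[d0]> & forall s, d0 ^+ s \in S -> p ^ n %| s].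
Proof.
have nS u : u \in 'N(S) by rewrite (subsetP (normal_norm image_normal)) ?inE.
have nS' (K : {set wT}) : K \subset 'N(S) by apply/subsetP=> u _.
have p_z0 : p.-elt z0.
  have : z0 ^+ (p ^ n * p ^ M) = 1.
    by rewrite expgM z0_pn -expgM mulnC expgM p_elt_expn ?expg1n // c1Z p_elt_constt.
  by move/eqP; rewrite -order_dvdn -expnD => /pnat_dvd; apply; rewrite pnatX pnat_id.
have pS : p.-group S by apply: morphim_pgroup.
pose P1 := (S <*> <[z0]>)%G.
have defP1 : P1 :=: S * <[z0]> by rewrite /= norm_joinEr.
have pP1 : p.-group P1 by rewrite defP1 pgroupM pS.
have nSP1 : S <| P1 by rewrite /normal nS' andbT joing_subl.
have cardP1 : #|P| <= #|P1|.
  have [cS _ ->] := W_cards; rewrite -(Lagrange (normal_sub nSP1)) [#|S|]cS.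
  rewrite (_ : 7 * h + 4 * n = 7 * h + 3 * n + n)%N; last by clear; lia.
  rewrite expnD leq_pmul2l ?expn_gt0 ?prime_gt0 // -card_quotient //.
  apply: (@leq_trans #[coset S z0]); last first.
    by rewrite orderE subset_leq_card // cycle_subG mem_quotient // mem_gen // inE cycle_id orbT.
  apply: dvdn_leq => //; apply: z0_S; apply: coset_idr; first exact: nS.
  by rewrite morphX ?nS //= expg_order.
have [w _ sP1P] := Sylow_Jsub sylP (subsetT P1) pP1.
have defP : P :=: P1 :^ w by apply/eqP; rewrite eq_sym eqEcard sP1P cardJg.
have [i [g def_w]] : exists i g, w = Z ^+ i * phi g.
  have NZ u : u \in 'N(D) by rewrite (subsetP (normal_norm D_normal)) ?inE.
  have : coset D w \in <[coset D Z]> by rewrite -W_quotient mem_quotient ?inE.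
  case/cycleP=> i eq_i; exists i.
  have : Z ^- i * w \in D.
    apply: coset_idr; rewrite ?NZ // morphM ?NZ // morphV ?NZ // morphX ?NZ //=.
    by rewrite eq_i mulVg.
  by case/morphimP=> g _ _ eq_g; exists g; rewrite -eq_g mulKVg.
have nP1Z : Z ^+ i \in 'N(P1).
  apply: groupX; rewrite -sub1set; apply: normsY; rewrite sub1set ?nS //.
  apply: (subsetP (cent_sub _)); rewrite cent_cycle; apply/cent1P.
  by rewrite /commute /z0 -expgS -expgSr.
pose o := phi g.`_p^'.
have S_gp : phi g.`_p \in S by rewrite mem_morphim ?inE ?(Sylow_constt nilG sylJ).
have defPo : P :=: P1 :^ o.
  rewrite defP def_w conjsgM (normP nP1Z) -[g in phi g](consttC p) morphM ?inE // conjsgM.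
  by rewrite (conjGid (_ : _ \in P1)) //= mem_gen // inE S_gp.
have So v : v \in J -> phi v ^ o = phi v.
  move=> Jv; rewrite /o -morphJ ?inE //; congr (phi _); apply/conjg_fixP/commgP.
  have [_ _ cO _] := dprodP (nilpotent_pcoreC p nilG).
  apply/commute_sym/(centsP cO); last by rewrite -(Sylow_pcore nilG sylJ).
  by rewrite (mem_normal_Hall (nilpotent_pcore_Hall _ nilG)) ?pcore_normal ?p_elt_constt ?inE.
(* Since o centralises the image of J, replacing z0 by z0^o keeps all its relations with a1, b1 and
   c1. *)
have ao : a1 ^ o = a1 := So a Ja.
have bo : b1 ^ o = b1 := So b Jb.
have co : c1 ^ o = c1 := So c Jc.
exists (z0 ^ o); split.
- by rewrite -{1}ao -conjJg a1_z0 conjXg ao.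
- by rewrite -conjVg -{1}bo -conjJg b1_z0 conjXg bo.
- by rewrite -conjXg z0_pn conjXg co.
- rewrite defPo conjYg; congr (_ <*> _); last by rewrite -genJ conjg_set1.
  by apply/normP/nS.
move=> s; rewrite -conjXg memJ_norm ?nS //; exact: z0_S.
Qed.

Lemma image_relations : quotient_rel alpha gamma p m h [:: a1; b1; c1].
Proof.
have fM : {morph phi : u v / u * v} by move=> u v; rewrite morphM ?inE.
have [ha hab hb hc] := image_powers.
split; split=> //; first exact: c1E.
  by rewrite /a1 /c1 -(tmorphJ fM) ac -zexpg_alphaX ?p_elt_constt // (zexpg_morph _ _ fM).
by rewrite /b1 /c1 -(tmorphV fM) -(tmorphJ fM) bc -zexpg_alphaX ?p_elt_constt // (zexpg_morph _ _ fM).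
Qed.

(** * Presentation, normal form and symmetry of W_p *)

Section Presentation.

Variable d0 : wT.
Hypotheses (a_d0 : a1 ^ d0 = a1 ^+ kap) (b_d0 : b1 ^ d0^-1 = b1 ^+ kap).
Hypothesis d0_pn : d0 ^+ (p ^ n) = c1 ^+ q.
Hypothesis defP : P :=: S <*> <[d0]>.
Hypothesis d0_S : forall s, d0 ^+ s \in S -> p ^ n %| s.

Let wT_expM (u : wT) : p.-elt u -> u ^+ (p ^ M) = 1.
Proof. by move=> p_u; apply: p_elt_expn. Qed.

Let a1M : a1 ^+ (p ^ M) = 1. Proof. by rewrite wT_expM // a1E p_elt_constt. Qed.
Let b1M : b1 ^+ (p ^ M) = 1. Proof. by rewrite wT_expM // b1E p_elt_constt. Qed.

Lemma sylowW_relations : sylowW_rel alpha gamma p m h n q k [:: a1; b1; c1; d0].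
Proof.
split; first exact: image_relations.
by split; rewrite ?zexpg_kap.
Qed.

Let nSd0 u : u \in 'N(S). Proof. by rewrite (subsetP (normal_norm image_normal)) ?inE. Qed.

Lemma P_factor u : u \in P -> exists v r, v \in J /\ u = phi v * d0 ^+ r.
Proof.
rewrite defP norm_joinEr; last by apply/subsetP=> w _; exact: nSd0.
case/mulsgP=> _ _ /morphimP[v _ Jv ->] /cycleP[r ->] ->.
by exists v, r.
Qed.

Lemma P_nf u : u \in P ->
  exists! w : 'I_(p ^ (m + 2 * h)) * 'I_(p ^ (m + h)) * 'I_(p ^ (m + h)) * 'I_(p ^ n),
    u = a1 ^+ w.1.1.1 * b1 ^+ w.1.1.2 * c1 ^+ w.1.2 * d0 ^+ w.2.
Proof.
have pn_gt0 : 0 < p ^ n by rewrite expn_gt0 prime_gt0.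
have ex v : v \in P -> exists w : 'I_(p ^ (m + 2 * h)) * 'I_(p ^ (m + h)) * 'I_(p ^ (m + h)) * 'I_(p ^ n),
    v = a1 ^+ w.1.1.1 * b1 ^+ w.1.1.2 * c1 ^+ w.1.2 * d0 ^+ w.2.
  case/P_factor=> v' [r [Jv' ->]].
  have : phi v' * c1 ^+ (q * (r %/ p ^ n)) \in S.
    by apply: groupM; [rewrite mem_morphim ?inE | apply: groupX].
  case/image_nf=> w hw; exists (w, Ordinal (ltn_pmod r pn_gt0)); rewrite -hw /=.
  by rewrite {1}(divn_eq r (p ^ n)) expgD mulnC expgM d0_pn -expgM mulgA.
have [|_] := surj_card_unique ex; last exact.
rewrite card_prod card_nf card_ord; have [_ _ ->] := W_cards.
by rewrite -expnD leq_exp2l ?prime_gt1 //; clear; lia.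
Qed.

Lemma P_gen : <<[set u in [:: a1; b1; c1; d0]]>> = P.
Proof.
apply/eqP; rewrite eqEsubset gen_subG; apply/andP; split.
  have SP : S \subset P by rewrite defP joing_subl.
  apply/subsetP=> u; rewrite inE !in_cons in_nil orbF => /or4P[] /eqP->.
  - exact: (subsetP SP).
  - exact: (subsetP SP).
  - exact: (subsetP SP).
  - by rewrite defP mem_gen // inE cycle_id orbT.
rewrite defP join_subG cycle_subG image_gen gen_subG; apply/andP; split.
  by apply/subsetP=> u /set2P[] ->; rewrite mem_gen // !inE eqxx ?orbT.
by rewrite mem_gen // !inE eqxx !orbT.
Qed.

Section UniversalP.

Variables (H : groupType) (a' b' c' d' : H).
Hypothesis rel' : sylowW_rel alpha gamma p m h n q k [:: a'; b'; c'; d'].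

(* The lift sends phi v * d0^r to f v * d'^r, where f : G -> H is the lift on G;
   this is well defined since f is trivial on Np and d0^r lies in S only if p^n | r. *)
Lemma P_lift_exists : exists F : wT -> H,
  {in P &, {morph F : u v / u * v}} /\ map F [:: a1; b1; c1; d0] = [:: a'; b'; c'; d'].
Proof.
have [qrel [ad' bd' dpn']] := rel'.
have [f [fM fa fb fc fN]] := lift_exists qrel.
have aM : a ^+ (p ^ M) = 1 by rewrite p_elt_expn ?p_elt_constt.
have bM : b ^+ (p ^ M) = 1 by rewrite p_elt_expn ?p_elt_constt.
have a'M : a' ^+ (p ^ M) = 1 by rewrite -fa -(tmorphX fM) aM (tmorph1 fM).
have b'M : b' ^+ (p ^ M) = 1 by rewrite -fb -(tmorphX fM) bM (tmorph1 fM).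
rewrite zexpg_kap // in ad'; rewrite zexpg_kap // in bd'.
have phiM : {morph phi : u v / u * v} by move=> u v; rewrite morphM ?inE.
have f_phi u v : u \in J -> v \in J -> phi u = phi v -> f u = f v.
  move=> Ju Jv eq_uv; have : u * v^-1 \in Np.
    by rewrite mem_Np phiM (tmorphV phiM) eq_uv mulgV eqxx groupM ?groupV.
  by move/fN; rewrite fM (tmorphV fM) => /(canRL (mulgKV _)); rewrite mul1g.
(* Here r - s = p^n t for some t, and d0^(p^n t) = c1^(q t) can be absorbed into phi u; the same
   relation for d' and c' absorbs the corresponding factor in H. *)
have well_defined u v r s : u \in J -> v \in J -> s <= r ->
    phi u * d0 ^+ r = phi v * d0 ^+ s -> f u * d' ^+ r = f v * d' ^+ s.
  move=> Ju Jv le_sr eq_uv.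
  have eq_d : phi u * d0 ^+ (r - s) = phi v.
    by apply: (mulIg (d0 ^+ s)); rewrite -mulgA -expgD subnK.
  have /dvdnP[t def_rs] : p ^ n %| r - s.
    apply: d0_S; rewrite -(mulKg (phi u) (d0 ^+ _)) eq_d.
    by rewrite groupM ?groupV ?mem_morphim ?inE.
  rewrite -(subnK le_sr) expgnDr mulgA; congr (_ * _).
  have : phi (u * c ^+ (q * t)) = phi v.
    by rewrite phiM (tmorphX phiM c) -eq_d def_rs [(t * _)%N]mulnC [d0 ^+ _]expgM d0_pn -expgM.
  move/(f_phi _ _ (groupM Ju (groupX _ Jc)) Jv) => <-.
  by rewrite fM (tmorphX fM c) fc def_rs [(t * _)%N]mulnC [d' ^+ _]expgnA dpn' -expgnA.
(* Exponents of d0 below p^n make the choice range over a finite type; [FE] then evaluates F for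
   every exponent. *)
pose F (u : wT) := if [pick w : gT * 'I_(p ^ n) | (w.1 \in J) && (u == phi w.1 * d0 ^+ w.2)]
  is Some w then f w.1 * d' ^+ w.2 else 1.
have FE v r : v \in J -> F (phi v * d0 ^+ r) = f v * d' ^+ r.
  move=> Jv; rewrite /F; case: pickP => [w /andP[Jw /eqP eq_w] | no_w].
    have [le_r | /ltnW le_r] := leqP w.2 r; first exact/esym/well_defined.
    exact/well_defined.
  have pn_gt0 : 0 < p ^ n by rewrite expn_gt0 prime_gt0.
  have /negP[] := negbT (no_w (v * c ^+ (q * (r %/ p ^ n)), Ordinal (ltn_pmod r pn_gt0))).
  rewrite /= groupM ?groupX //= phiM (tmorphX phiM c) {1}(divn_eq r (p ^ n)) expgD.
  by rewrite [(_ * p ^ n)%N]mulnC [d0 ^+ (_ * _)]expgM d0_pn -expgM mulgA.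
(* Conjugation by d0^-1 raises b to [kap], but a to the inverse exponent [mu]. *)
have [mu kap_mu] : exists mu, kap * mu = 1 %[mod p ^ M].
  apply: coprime_inv_modn; last by rewrite expn_gt0.
  rewrite coprimeXl // coprimeXr // prime_coprime // -addn1 dvdn_addr ?dvdn1 ?neq_ltn ?prime_gt1 ?orbT //.
  by rewrite (dvdn_trans _ (pfactor_dvdnn p x)) // dvdn_exp.
have M_gt1 : 1 < p ^ M by rewrite (ltn_exp2l 0) ?prime_gt1 // (leq_trans _ m_M).
have exp_mu (hT : groupType) (w z : hT) : w ^+ (p ^ M) = 1 -> w ^ z = w ^+ kap -> w ^ z^-1 = w ^+ mu.
  move=> wM wz; apply: (canLR (conjgK z)); rewrite conjXg wz -expgnA.
  rewrite (divn_eq (kap * mu) (p ^ M)) kap_mu modn_small // expgnDr mulnC expgnA wM.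
  by rewrite expg1n mul1g.
have conj1 v : v \in J -> exists2 v', v' \in J & phi v' = phi v ^ d0^-1 /\ f v' = f v ^ d'^-1.
  (* The elements whose conjugate by d0^-1 lifts to J compatibly with f form a subgroup, so only a
     and b have to be checked. *)
  pose K := [set v in J | [exists v' in J, (phi v' == phi v ^ d0^-1) && (f v' == f v ^ d'^-1)]].
  have K_group : group_set K.
    apply/group_setP; split=> [|u w].
      rewrite inE group1; apply/existsP; exists 1.
      by rewrite group1 (tmorph1 phiM) (tmorph1 fM) !conj1g !eqxx.
    rewrite !inE => /andP[Ju /existsP[u' /and3P[Ju' /eqP u1 /eqP u2]]].
    case/andP=> Jw /existsP[w' /and3P[Jw' /eqP w1 /eqP w2]].
    rewrite groupM //; apply/existsP; exists (u' * w').
    by rewrite groupM // !phiM !fM !conjMg u1 u2 w1 w2 !eqxx.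
  suffices sJK : J \subset Group K_group.
    move/(subsetP sJK); rewrite inE => /andP[_ /existsP[v' /and3P[Jv' /eqP v1 /eqP v2]]].
    by exists v'.
  rewrite {1}defJ gen_subG; apply/subsetP=> u /set2P[] ->; rewrite inE ?Ja ?Jb; apply/existsP.
    exists (a ^+ mu); rewrite groupX // (tmorphX phiM a) (tmorphX fM a) fa.
    by rewrite !exp_mu ?eqxx.
  exists (b ^+ kap); rewrite groupX // (tmorphX phiM b) (tmorphX fM b) fb.
  by rewrite -/b1 b_d0 bd' !eqxx.
have conj_r r v : v \in J -> exists2 v', v' \in J & phi v' = phi v ^ d0 ^- r /\ f v' = f v ^ d' ^- r.
  elim: r v => [|r IHr] v Jv; first by exists v; rewrite ?invg1 ?conjg1.
  have [v1 Jv1 [e1 e2]] := IHr v Jv; have [v2 Jv2 [e3 e4]] := conj1 v1 Jv1.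
  by exists v2; rewrite // e3 e4 e1 e2 -!conjgM -!invMg -!expgS.
exists F; split.
  move=> _ _ /P_factor[v1 [r1 [Jv1 ->]]] /P_factor[v2 [r2 [Jv2 ->]]].
  have [v2' Jv2' [e1 e2]] := conj_r r1 v2 Jv2.
  rewrite !FE //.
  have -> : phi v1 * d0 ^+ r1 * (phi v2 * d0 ^+ r2) = phi (v1 * v2') * d0 ^+ (r1 + r2).
    by rewrite phiM e1 expgD conjgE invgK !mulgA mulgKV.
  by rewrite FE ?groupM // fM e2 expgnDr conjgE invgK !mulgA mulgKV.
have F0 v : v \in J -> F (phi v) = f v by move=> Jv; have := FE v 0 Jv; rewrite !expg0 !mulg1.
rewrite /= /a1 /b1 /c1 !F0 // fa fb fc.
by have := FE 1 1%N (group1 J); rewrite (tmorph1 phiM) (tmorph1 fM) !mul1g !expg1 => ->.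
Qed.

End UniversalP.

Lemma P_presented : presented_by P [:: a1; b1; c1; d0] (sylowW_rel alpha gamma p m h n q k).
Proof.
split; [exact: P_gen | exact: sylowW_relations |].
move=> H [|a' [|b' [|c' [|d' [|z' s]]]]] //; exact: P_lift_exists.
Qed.

(** The relations of G, of G_p/N_p and of W_p are all stable under the swap, so each universal
    property gives an endomorphism that is an involution on generators. Compatibility of the three
    maps then needs checking only on a and b. *)
Lemma swap_automorphisms :
  exists sigma : {perm gT}, exists sigma0 : {perm coset_of Np}, exists tau : {perm wT},
  [/\ sigma \in Aut J, sigma a = b, sigma b = a, sigma c = c^-1 & sigma c^-1 = c] /\
  [/\ sigma0 \in Aut (J / Np),
      {in J, forall x, sigma0 (coset Np x) = coset Np (sigma x)} &
      [/\ sigma0 a0 = b0, sigma0 b0 = a0, sigma0 c0 = c0^-1 & sigma0 c0^-1 = c0]] /\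
  [/\ tau \in Aut P, {in J, forall x, tau (phi x) = phi (sigma x)},
      tau d0 = d0^-1 & tau d0^-1 = d0].
Proof.
have phiM : {morph phi : u v / u * v} by move=> u v; rewrite morphM ?inE.
have cosM := coset_morphT.
have [sigma [autS sigE sa sb]] : exists sigma : {perm gT},
    [/\ sigma \in Aut J, {in J &, {morph sigma : u v / u * v}}, sigma a = b & sigma b = a].
  have [_ [AC BC] univ] := presG.
  have [|f [fM [fA fB]]] := univ gT [:: B; A].
    by rewrite /macdonald_rel -invgR invgK.
  have fa : f a = b.
    by have := morph_constt (Morphism (D := [set: gT]) fM) p (in_setT A); rewrite /= fA.
  have fb : f b = a.
    by have := morph_constt (Morphism (D := [set: gT]) fM) p (in_setT B); rewrite /= fB.
  have fMJ : {in J &, {morph f : u v / u * v}} by move=> u v _ _; rewrite fM ?inE.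
  have [|sigma [autS sigE]] := aut_of_involution defJ fMJ.
    by move=> u /set2P[] ->; rewrite ?fa ?fb ?fa.
  exists sigma; split; rewrite ?sigE //.
  by move=> u v Ju Jv; rewrite !sigE ?groupM // fMJ.
have [sigma0 [autS0 sigE0 sa0 sb0 sc0]] : exists sigma0 : {perm coset_of Np},
    [/\ sigma0 \in Aut (J / Np), {in J / Np &, {morph sigma0 : u v / u * v}},
        sigma0 a0 = b0, sigma0 b0 = a0 & sigma0 c0 = c0^-1].
  have [f [fM [fa fb fc]]] := quotient_lift_exists (quotient_rel_swap quotient_relations).
  have Ja0 : a0 \in J / Np by apply: mem_quotient.
  have Jb0 : b0 \in J / Np by apply: mem_quotient.
  have Jc0 : c0 \in J / Np by apply: mem_quotient.
  have genQ : (J / Np)%G :=: <<[set a0; b0]>>.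
    have genab : <<[set a; b]>> / Np = J / Np by rewrite -defJ.
    apply: etrans (esym genab) _; rewrite quotient_gen; last by apply/subsetP=> u /set2P[] ->; apply: nN.
    congr <<_>>; apply/setP=> u; apply/morphimP/set2P => [[v _ /set2P[] -> ->] | ]; [by left | by right |].
    by case=> ->; [exists a | exists b]; rewrite ?nN // !inE eqxx ?orbT.
  have [|sigma0 [autS0 sigE0]] := aut_of_involution genQ fM.
    by move=> u /set2P[] ->; rewrite ?fa ?fb ?fa.
  exists sigma0; split; rewrite ?sigE0 //.
  by move=> u v Ju Jv; rewrite !sigE0 ?groupM // fM.
have [tau [autT tauE ta tb td]] : exists tau : {perm wT},
    [/\ tau \in Aut P, {in P &, {morph tau : u v / u * v}},
        tau a1 = b1, tau b1 = a1 & tau d0 = d0^-1].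
  have [f [fM [fa fb _ fd]]] := P_lift_exists (sylowW_rel_swap sylowW_relations).
  have SP : S \subset P by rewrite defP joing_subl.
  have Pa : a1 \in P by apply: (subsetP SP).
  have Pb : b1 \in P by apply: (subsetP SP).
  have Pd : d0 \in P by rewrite defP mem_gen // inE cycle_id orbT.
  have genP : P :=: <<[set a1; b1; d0]>>.
    apply/eqP; rewrite eqEsubset gen_subG; apply/andP; split.
      rewrite defP join_subG cycle_subG image_gen gen_subG; apply/andP; split.
        by apply/subsetP=> u /set2P[] ->; rewrite mem_gen // !inE eqxx ?orbT.
      by rewrite mem_gen // !inE eqxx !orbT.
    by apply/subsetP=> u /setUP[/set2P[] -> | /set1P ->].
  have [|tau [autT tauE]] := aut_of_involution genP fM.
    move=> u /setUP[/set2P[] -> | /set1P ->]; rewrite ?fa ?fb ?fa ?fd ?groupV //.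
    by rewrite (in_morphV fM) // fd invgK.
  exists tau; split; rewrite ?tauE //.
  by move=> u v Ju Jv; rewrite !tauE ?groupM // fM.
have sJ u : u \in J -> sigma u \in J by move=> Ju; rewrite Aut_closed.
have sc : sigma c = c^-1.
  have sV := in_morphV sigE; rewrite /c !commgEl !conjgE.
  by rewrite !sigE ?sV ?sa ?sb ?groupM ?groupV //; rewrite -!conjgE -!commgEl invgR.
have PJ u : u \in J -> phi u \in P.
  by move=> Ju; apply: (subsetP (_ : S \subset P)); rewrite ?defP ?joing_subl ?mem_morphim ?inE.
exists sigma, sigma0, tau; split; split=> //.
- by rewrite (in_morphV sigE) // sc invgK.
- split=> //.
    apply: (@morph_gen_eq _ _ J [set a; b] (fun u => sigma0 (coset Np u)) (fun u => coset Np (sigma u)) defJ).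
    + by move=> u v Ju Jv; rewrite cosM sigE0 ?mem_quotient.
    + by move=> u v Ju Jv; rewrite sigE // cosM.
    + by move=> u /set2P[] ->; rewrite ?sa ?sb.
  by split=> //; rewrite (in_morphV sigE0) ?mem_quotient // sc0 invgK.
- split=> //.
    apply: (@morph_gen_eq _ _ J [set a; b] (fun u => tau (phi u)) (fun u => phi (sigma u)) defJ).
    + by move=> u v Ju Jv; rewrite phiM tauE ?PJ.
    + by move=> u v Ju Jv; rewrite sigE // phiM.
    + by move=> u /set2P[] ->; rewrite ?sa ?sb.
  rewrite (in_morphV tauE) ?td ?invgK //.
  by rewrite defP mem_gen // inE cycle_id orbT.
Qed.

End Presentation.

End WamsleySylow.

Theorem theorem4p9
  (alpha : int) (gamma p : nat)
  (gamma_gt0 : (0 < gamma)%N)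
  (alphaX_neq1 : (alpha ^+ gamma)%R <> 1%R)
  (p_prime : prime p) (p_odd : odd p)
  (p_dvd : (p%:Z %| (alpha - 1)%R)%Z)
  (p3 : p = 3 -> ~ ((alpha ^+ gamma)%R = 7%:Z %[mod 9%:Z])%Z)
  (* the finite groups G = [set: gT] and W = [set: wT], and the map G -> W *)
  (gT wT : finGroupType) (A B : gT) (X Y Z : wT)
  (presG : presented_by [set: gT] [:: A; B] (macdonald_rel alpha gamma))
  (nilG : nilpotent [set: gT])
  (presW : presented_by [set: wT] [:: X; Y; Z] (wamsley_rel alpha gamma))
  (phi : {morphism [set: gT] >-> wT}) (phiA : phi A = X) (phiB : phi B = Y)
  (* J = G_p and P = W_p *)
  (J : {group gT}) (sylJ : p.-Sylow([set: gT]) J)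
  (P : {group wT}) (sylP : p.-Sylow([set: wT]) P) :
  let m := padic_val p (alpha ^+ gamma - 1)%R in
  let n := logn p gamma in
  let h := padic_val p (alpha - 1)%R in
  let k := (gamma %/ p ^ n)%N in
  let q := #|[set: gT] / J| in
  let Np := ('ker phi :&: J)%G in
  let a := sylow_proj p [set: gT] A in
  let b := sylow_proj p [set: gT] B in
  let c := [~ a, b] in
  (* a0, b0, c0 as elements of G_p / N_p *)
  let a0 := coset Np a in
  let b0 := coset Np b in
  let c0 := coset Np c in
  (* a0, b0, c0 as elements of W_p *)
  let a1 := phi a in
  let b1 := phi b in
  let c1 := phi c in
  m = (h + n)%N /\
  (* (1) *)
  [/\ Np :=: Mset J p n :&: Lset J p (2 * n),
      Np :=: <<[set a ^+ (p ^ (m + 2 * h));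
                    a ^+ (p ^ (m + h)) * b ^+ (p ^ (m + h));
                    c ^+ (p ^ (m + h))]>>,
      Np :=: <<[set b ^+ (p ^ (m + 2 * h));
                    a ^+ (p ^ (m + h)) * b ^+ (p ^ (m + h));
                    c ^+ (p ^ (m + h))]>> &
      Np \isog setX (setX (Zp (p ^ (2 * n))) (Zp (p ^ n))) (Zp (p ^ n))] /\
  [/\ #|Np| = (p ^ (4 * n))%N,
      #|J / Np| = (p ^ (7 * h + 3 * n))%N,
      #|P| = (p ^ (7 * h + 4 * n))%N &
      #|P| = (p ^ (7 * m - 3 * n))%N] /\
  (* (2) *)
  (presented_by (J / Np) [:: a0; b0; c0] (quotient_rel alpha gamma p m h) /\
   forall u, u \in J / Np ->
     exists! e : 'I_(p ^ (m + 2 * h)) * 'I_(p ^ (m + h)) * 'I_(p ^ (m + h)),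
       u = a0 ^+ e.1.1 * b0 ^+ e.1.2 * c0 ^+ e.2) /\
  exists d0 : wT,
  (* (3) *)
  (presented_by P [:: a1; b1; c1; d0]
     (sylowW_rel alpha gamma p m h n q k) /\
   forall u, u \in P ->
     exists! e : 'I_(p ^ (m + 2 * h)) * 'I_(p ^ (m + h)) * 'I_(p ^ (m + h))
                 * 'I_(p ^ n),
       u = a1 ^+ e.1.1.1 * b1 ^+ e.1.1.2 * c1 ^+ e.1.2 * d0 ^+ e.2) /\
  (* (4) *)
  exists sigma : {perm gT}, exists sigma0 : {perm coset_of Np},
  exists tau : {perm wT},
  [/\ sigma \in Aut J, sigma a = b, sigma b = a,
      sigma c = c^-1 & sigma c^-1 = c] /\
  [/\ sigma0 \in Aut (J / Np),
      {in J, forall x, sigma0 (coset Np x) = coset Np (sigma x)} &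
      [/\ sigma0 a0 = b0, sigma0 b0 = a0,
          sigma0 c0 = c0^-1 & sigma0 c0^-1 = c0]] /\
  [/\ tau \in Aut P,
      {in J, forall x, tau (phi x) = phi (sigma x)},
      tau d0 = d0^-1 & tau d0^-1 = d0].
Proof.
move=> m n h k q Np a b c a0 b0 c0 a1 b1 c1.
(* Since M >= |G|, |W|, raising to the power p^M kills all p-elements of G and W. *)
pose M := (#|gT| + #|wT| + (padic_val p (alpha - 1)%R + logn p gamma) + 2)%N.
have gT_le : #|gT| <= M by rewrite /M -!addnA leq_addr.
have wT_le : #|wT| <= M by rewrite /M addnAC -!addnA addnCA leq_addr.
have [||x [e [[x_gt0 e_gt0 xe alpha_x] [hE mE logn_e h_gt0 e_mod]]]] :=
  @nat_parameters alpha gamma p M p_prime p_odd gamma_gt0 alphaX_neq1 p_dvd p3.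
- by rewrite /M addn2 ltnS leqW ?leq_addl.
- by rewrite /M addn2.
have alphaX_e := dvdz_subX gamma alpha_x; rewrite xe in alphaX_e.
have m_M : logn p e < M.
  by rewrite logn_e -hE /M addn2 ltnS leqW ?leq_addl.
have aE : a = A.`_p by apply: (@sylow_proj_constt gT p [set: gT]%G); rewrite ?inE.
have bE : b = B.`_p by apply: (@sylow_proj_constt gT p [set: gT]%G); rewrite ?inE.
(* From here on m and h are the valuations of the natural numbers e and x, and a and b are
   p-constituents. *)
rewrite /m /h mE hE /a1 /b1 /c1 /a0 /b0 /c0 /c aE bE {m h mE hE a1 b1 c1 a0 b0 c0 c aE bE a b}.
have m_gt0 : 0 < logn p e by rewrite logn_e addn_gt0 h_gt0.
have ac := macdonald_ac p_prime presG nilG gT_le alphaX_e.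
have bc := macdonald_bc p_prime presG nilG gT_le alphaX_e.
have defJ := macdonald_sylow_gen presG nilG sylJ.
have cardJ := Sylow_card p_prime p_odd presG nilG sylJ gT_le alphaX_e e_gt0 m_gt0 e_mod m_M.
have pJ := sylow_pgroup sylJ.
have NpE : Np :=: Ngen A.`_p B.`_p p (logn p e) (logn p x).
  by have := kernel_gen p_prime p_odd gamma_gt0 presG nilG presW phiA phiB
    sylJ sylP gT_le wT_le alpha_x alphaX_e x_gt0 e_gt0 h_gt0 e_mod logn_e m_M.
have center := Ngen_center p_prime p_odd m_gt0 e_gt0 (erefl _) e_mod pJ defJ ac bc cardJ logn_e.
have swap := Ngen_swap p_prime p_odd m_gt0 e_gt0 (erefl _) e_mod pJ defJ ac bc cardJ logn_e.
have isogN := isog_Ngen p_prime p_odd m_gt0 e_gt0 (erefl _) e_mod pJ defJ ac bc cardJ logn_e.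
have cardN := card_Ngen p_prime p_odd m_gt0 e_gt0 (erefl _) e_mod pJ defJ ac bc cardJ logn_e.
have cardQ := card_quotient_Np p_prime p_odd gamma_gt0 presG nilG presW phiA phiB
  sylJ sylP gT_le wT_le alpha_x alphaX_e x_gt0 e_gt0 h_gt0 e_mod logn_e m_M.
have [_ _ cardP] := W_cards p_prime p_odd gamma_gt0 presG nilG presW phiA phiB
  sylJ sylP gT_le wT_le alpha_x alphaX_e x_gt0 e_gt0 h_gt0 e_mod logn_e m_M.
split; first exact: logn_e.
split; first by rewrite NpE; split.
split.
  split; [by rewrite NpE | by have := cardQ | by [] |].
  by rewrite cardP logn_e; congr (p ^ _)%N; rewrite /n; clear; lia.
split.
  split.
    by have := quotient_presented p_prime p_odd gamma_gt0 presG nilG presW phiA phiB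
      sylJ sylP gT_le wT_le alpha_x alphaX_e x_gt0 e_gt0 h_gt0 e_mod logn_e m_M.
  by have := quotient_nf p_prime p_odd gamma_gt0 presG nilG presW phiA phiB
    sylJ sylP gT_le wT_le alpha_x alphaX_e x_gt0 e_gt0 h_gt0 e_mod logn_e m_M.
have [d0 [a_d0 b_d0 d0_pn defP d0_S]] := exists_d0 p_prime p_odd gamma_gt0 presG nilG presW
  phiA phiB sylJ sylP gT_le wT_le alpha_x alphaX_e x_gt0 e_gt0 h_gt0 e_mod logn_e m_M.
exists d0; split; [split|].
- by have := P_presented p_prime p_odd gamma_gt0 presG nilG presW phiA phiB
    sylJ sylP gT_le wT_le alpha_x alphaX_e x_gt0 e_gt0 h_gt0 e_mod logn_e m_M
    a_d0 b_d0 d0_pn defP d0_S.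
- by have := P_nf p_prime p_odd gamma_gt0 presG nilG presW phiA phiB
    sylJ sylP gT_le wT_le alpha_x alphaX_e x_gt0 e_gt0 h_gt0 e_mod logn_e m_M
    d0_pn defP.
by have := swap_automorphisms p_prime p_odd gamma_gt0 presG nilG presW phiA phiB
  sylJ sylP gT_le wT_le alpha_x alphaX_e x_gt0 e_gt0 h_gt0 e_mod logn_e m_M
  a_d0 b_d0 d0_pn defP d0_S.
Qed.
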